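(* Let $(X_t,\mathcal{F}_t,\mathbf{P}_x)$ be a one-dimensional diffusion on the canonical space as in the context whose part on $S$ is a recurrent strong Markov process. Let $Z\colon(\Omega,\mathcal{F}_{\tau_2})\to(\mathbb{R},\mathcal{B}(\mathbb{R}))$ be measurable, bounded below, with $Z\in\bigcap_{d\in\mathtt{D}}L^2(\mathbf{P}_d)$ and $\mathbf{E}_d(Z)=0$ for all $d\in\mathtt{D}$. Let $Z_1=Z$ and $Z_n=Z\circ\mathrm{sh}_{\tau_n}$ for $n\ge2$. Then for any initial probability measure $\mu$ on $S$, under $\mathbf{P}_\mu=\int\mathbf{P}_x\,d\mu(x)$ the distribution of $$n^{-1/2}\sum_{k=1}^nZ_k$$ converges to the normal distribution with mean zero and variance $\sigma^2=\sum_{d\in\mathtt{D}}p_d\,\mathbf{E}_d(Z^2)$, where $p=(p_d)$ is the left-fixed probability row vector of the Markov chain $(X_{\tau_n},\mathcal{F}_{\tau_n})$.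
   Context: $S$ is one of $\mathbb{R}$, $[0,\infty)$, $(0,\infty)$; $\Omega=C([0,\infty);S)$, $X_t$ the coordinate process, $\mathcal{F}_t=\sigma(X_u:u\le t)$. $\mathtt{D}=\{d_1<\dots<d_s\}\subset S$ finite ($s\ge2$); $\tau_1=\inf\{t\ge0:X_t\in\mathtt{D}\}$, $\tau_{n+1}=\inf\{t\ge\tau_n:X_t\in\mathtt{D}\setminus\{X_{\tau_n}\}\}$. For a stopping time $\tau$, $\mathrm{sh}_\tau(\omega)(\cdot)=\omega(\tau(\omega)+\cdot)$ is the shift. The chain $(X_{\tau_n})$ on $\mathtt{D}$ has irreducible transition matrix and unique invariant probability row vector $p$ with positive entries. *)

(* Defs.v *)
From HB Require Import structures.
From mathcomp Require Import all_boot all_order all_algebra.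
From mathcomp Require Import all_classical all_reals all_analysis.
From mathcomp Require Import measurable_realfun normal_distribution.

Set Implicit Arguments.
Unset Strict Implicit.
Unset Printing Implicit Defensive.

Import Order.TTheory GRing.Theory Num.Theory.
Import numFieldNormedType.Exports.

Local Open Scope classical_set_scope.
Local Open Scope ring_scope.

Inductive state_space := SReal | SNonneg | SPos.

Definition Sset {R : realType} (k : state_space) : set R :=
  match k with
  | SReal => setT
  | SNonneg => [set x | 0 <= x]
  | SPos => [set x | 0 < x]
  end.

Lemma Sset1 {R : realType} k : Sset k (1 : R).
Proof. by case: k => //=; rewrite ler01 // ltr01. Qed.

(* Canonical representation of C([0,oo); S): a continuous path w : R -> R,
   S-valued, and constant (equal to w 0) on (-oo, 0]; the restriction to
   [0,oo) is a bijection with C([0,oo); S). *)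
Definition is_path {R : realType} (k : state_space) (w : R -> R) : Prop :=
  [/\ continuous w, (forall t, t <= 0 -> w t = w 0) & (forall t, Sset k (w t))].

Record path {R : realType} (k : state_space) := Path {
  pval :> R -> R ;
  pvalP : is_path k pval }.

Section path_instances.
Variables (R : realType) (k : state_space).

Lemma cst1_path : is_path k (fun _ : R => 1).
Proof. by split => //; [exact: cst_continuous|move=> t; exact: Sset1]. Qed.

HB.instance Definition _ := gen_eqMixin (@path R k).
HB.instance Definition _ := gen_choiceMixin (@path R k).
HB.instance Definition _ := isPointed.Build (@path R k) (Path cst1_path).
End path_instances.

Definition coord {R : realType} {k : state_space} (t : R) (w : @path R k) : R :=
  pval w t.

Definition coord_gen {R : realType} (k : state_space) (t : \bar R)
  : set (set (@path R k)) :=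
  [set A | exists u : R, exists B : set R,
     [/\ 0 <= u, (u%:E <= t)%E, measurable B & A = coord u @^-1` B]].

Definition Omega (R : realType) (k : state_space) :=
  g_sigma_algebraType (@coord_gen R k +oo%E).

Section process.
Variables (R : realType) (k : state_space).
Local Notation Om := (Omega R k).

Definition filtr (t : R) : set (set Om) := <<s @coord_gen R k t%:E >>.

Definition Finf : set (set Om) := measurable.

Definition stopping_time (tau : Om -> \bar R) : Prop :=
  (forall w, (0 <= tau w)%E) /\
  (forall t : R, 0 <= t -> filtr t [set w | (tau w <= t%:E)%E]).

Definition F_tau (tau : Om -> \bar R) : set (set Om) :=
  [set A | Finf A /\
     forall t : R, 0 <= t -> filtr t (A `&` [set w | (tau w <= t%:E)%E])].

(* the value of the path at an extended time (junk value w 0 at +oo/-oo) *)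
Definition Xat (s : \bar R) (w : Om) : R :=
  match s with EFin r => pval w r | _ => pval w 0 end.

Lemma shift_cont (c : R) : continuous (fun s : R => c + Num.max s 0).
Proof.
move=> x; apply: (@continuousD R R R^o (fun=> c) (fun s => Num.max s 0)).
  by move=> y; exact: cvg_cst.
by apply: continuous_max; [exact: cvg_id|exact: cvg_cst].
Qed.

Lemma shift_is_path (r : R) (w : Om) :
  is_path k (fun s : R => pval w (Num.max r 0 + Num.max s 0)).
Proof.
case: w => /= w [wc w0 wS]; split.
- move=> x; apply: (@continuous_comp _ _ _ (fun s : R => Num.max r 0 + Num.max s 0) w).
  + exact: shift_cont.
  + exact: wc.
- by move=> t t0; rewrite (max_r t0) (max_r (lexx (0:R))).
- by move=> t; exact: wS.
Qed.

Definition path_shift (r : R) (w : Om) : Om := Path (shift_is_path r w).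

(* the shift sh_tau; on {tau = +oo} (a null set in our use) it is the identity *)
Definition shift_at (tau : Om -> \bar R) (w : Om) : Om :=
  match tau w with EFin r => path_shift r w | _ => w end.

End process.

Arguments filtr {R k}.
Arguments Finf {R k}.
Arguments stopping_time {R k}.
Arguments F_tau {R k}.
Arguments Xat {R k}.
Arguments path_shift {R k}.
Arguments shift_at {R k}.

(* (X_t, F_t, P_x), x in S: a one-dimensional diffusion on the canonical space
   whose part on S is a recurrent strong Markov process.  P x is only
   meaningful for x in S. *)
Definition recurrent_diffusion {R : realType} (k : state_space)
    (P : R -> probability (Omega R k) R) : Prop :=
  [/\
      (forall x, Sset k x -> P x [set w | pval w 0 = x] = 1%E),
      (forall B : set (Omega R k), measurable B ->
         measurable_fun (Sset k) (fun x : R => (P x B : \bar R))),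
      (forall x, Sset k x -> forall tau, stopping_time tau ->
         forall A, F_tau tau A -> forall B : set (Omega R k), measurable B ->
         P x (A `&` [set w | (tau w < +oo)%E] `&` shift_at tau @^-1` B)
         = (\int[P x]_(w in A `&` [set w | (tau w < +oo)%E])
              P (Xat (tau w) w) B)%E) &
      (forall x y, Sset k x -> Sset k y ->
         P x [set w | exists t : R, 0 <= t /\ pval w t = y] = 1%E)].

Section hitting.
Variables (R : realType) (k : state_space) (D : seq R).
Local Notation Om := (Omega R k).

Definition first_hit (w : Om) : \bar R :=
  ereal_inf (EFin @` [set t : R | 0 <= t /\ pval w t \in D]).

Definition next_hit (s : \bar R) (w : Om) : \bar R :=
  ereal_inf (EFin @` [set t : R | (s <= t%:E)%E /\ pval w t \in D /\
                                  pval w t != Xat s w]).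

Fixpoint tau_aux (n : nat) (w : Om) : \bar R :=
  match n with
  | 0 => first_hit w
  | n'.+1 => next_hit (tau_aux n' w) w
  end.

(* tau_n for n >= 1 (tau_0 is an unused junk copy of tau_1) *)
Definition tau (n : nat) : Om -> \bar R := tau_aux n.-1.

Definition Zseq (Z : Om -> R) (n : nat) (w : Om) : R :=
  if (n <= 1)%N then Z w else Z (shift_at (tau n) w).

End hitting.

Arguments first_hit {R k}.
Arguments next_hit {R k}.
Arguments tau {R k}.
Arguments Zseq {R k}.

Definition trans_mx {R : realType} {k : state_space}
    (P : R -> probability (Omega R k) R) (D : seq R) (d d' : R) : R :=
  fine (P d [set w | Xat (tau D 2 w) w = d']).

Definition invariant_prob {R : realType} {k : state_space}
    (P : R -> probability (Omega R k) R) (D : seq R) (p : R -> R) : Prop :=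
  [/\ (forall d, d \in D -> 0 <= p d),
      \sum_(d <- D) p d = 1 &
      (forall d', d' \in D -> \sum_(d <- D) p d * trans_mx P D d d' = p d')].

(* Main.v *)
From HB Require Import structures.
From mathcomp Require Import all_boot all_order all_algebra.
From mathcomp Require Import all_classical all_reals all_analysis.
From mathcomp Require Import measurable_realfun normal_distribution.
From mathcomp Require Import ring lra giry.
Require Import Defs.

Import Order.TTheory GRing.Theory Num.Theory.
Import numFieldNormedType.Exports.

Set Implicit Arguments.
Unset Strict Implicit.
Unset Printing Implicit Defensive.

Local Open Scope classical_set_scope.
Local Open Scope ring_scope.

(* The cycles (Z_n, X_{tau_n}) form a Markov-modulated i.i.d. sequence: by the
   strong Markov property at tau_2, the future of the path given a cycle depends
   only on the point of D where the cycle ends.  Lindeberg's replacement method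
   applies: for a smooth test function u, prepending one cycle of step s = n^{-1/2}
   acts on u + (s^2/2) g u'' like convolution with N(0, s^2 sigma^2), up to
   o(s^2), provided that g solves the Poisson equation
     g_i - sum_j Q_ij g_j = E_i(Z^2) - sigma^2,
   where Q is the transition matrix of (X_{tau_n}).  As sigma^2 is the mean of
   E(Z^2) under the invariant p, this is solvable once the only Q-harmonic
   functions are the constants.  By the maximum principle, a nonconstant one
   yields a proper subset of D that the cycles never leave; recurrence makes the
   path hit a point outside at a finite time, so that infinitely many cycles
   would end before that time, which contradicts continuity of the path.
   Cubic spline steps then determine convergence for bounded continuous
   functions, and dominated convergence integrates over the initial law mu. *)

(** The corrector (s^2/2) g u'' answers an obstacle: E_i(Z^2) depends on the state i, so replacing
    one cycle by a Gaussian step of variance s^2 sigma^2 leaves an error of order s^2 = 1/n, and n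
    such errors do not vanish. With the corrector on both sides the second-order terms match in
    every state; being itself of size s^2, it costs nothing in the limit when inserted before the
    first replacement and removed after the last. Only second moments of Z are at hand, so Taylor
    remainders are measured by h^2 min(1, |h|) instead of |h|^3; their means are o(s^2) by dominated
    convergence. For x outside D nothing is known about the moments of Z under P_x. The first cycle
    is therefore split off: s Z tends to 0 pointwise, the test functions are bounded, and every
    later cycle starts in D. *)

Lemma cvg_sumR (R : realType) (I : Type) (r : seq I) (f : I -> nat -> R) (l : I -> R) :
  (forall i, f i @ \oo --> l i) ->
  (fun n => \sum_(i <- r) f i n) @ \oo --> \sum_(i <- r) l i.
Proof.
move=> fl; elim: r => [|i r IH].
  by rewrite big_nil; under eq_fun do rewrite big_nil; exact: cvg_cst.
by rewrite big_cons; under eq_fun do rewrite big_cons; exact: cvgD.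
Qed.

Lemma cvg_dist_squeeze (R : realType) (f b e : nat -> R) (l : R) :
  (forall n, `|f n - b n| <= e n) -> e @ \oo --> 0 -> b @ \oo --> l -> f @ \oo --> l.
Proof.
move=> fb e0 bl.
have fb0 : (fun n => f n - b n) @ \oo --> 0.
  apply: norm_cvg0; apply: (@squeeze_cvgr _ _ _ _ (fun=> 0) e) => //; last exact: cvg_cst.
  by apply: nearW => n; rewrite normr_ge0 fb.
rewrite -[l]add0r (_ : f = fun n => (f n - b n) + b n); first exact: cvgD.
by apply/funext => n; rewrite subrK.
Qed.

(** * Real-valued integrals under a probability *)

Section real_integral.
Context d (T : measurableType d) (R : realType) (P : probability T R).
Implicit Types f g : T -> R.
Local Notation intg f := (P.-integrable [set: T] (EFin \o f)).

Lemma integrable_le f g : measurable_fun setT f -> (forall x, `|f x| <= g x) ->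
  intg g -> intg f.
Proof.
move=> mf fg ig; apply: (@le_integrable _ _ _ P setT measurableT (EFin \o f) (EFin \o g)) => //.
  exact/measurable_EFinP.
by move=> x _ /=; rewrite lee_fin (le_trans (fg x))// ler_norm.
Qed.

Lemma integrable_cst_fin (c : R) : intg (fun=> c).
Proof. exact: finite_measure_integrable_cst. Qed.

Lemma integrable_bounded f (M : R) : measurable_fun setT f ->
  (forall x, `|f x| <= M) -> intg f.
Proof. by move=> mf fM; apply: (integrable_le mf fM); exact: integrable_cst_fin. Qed.

Lemma integrableD_fin f g : intg f -> intg g -> intg (fun x => f x + g x).
Proof. by move=> fi gi; exact: (integrableD measurableT fi gi). Qed.

Lemma integrableB_fin f g : intg f -> intg g -> intg (fun x => f x - g x).
Proof. by move=> fi gi; exact: (integrableB measurableT fi gi). Qed.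

Lemma integrableZl_fin (c : R) f : intg f -> intg (fun x => c * f x).
Proof. by move=> fi; exact: (integrableZl measurableT c fi). Qed.

Lemma integrable_sum_fin (I : Type) (s : seq I) (f : I -> T -> R) :
  (forall i, intg (f i)) -> intg (fun x => \sum_(i <- s) f i x).
Proof.
move=> fi; elim: s => [|i s IH].
  by under eq_fun do rewrite big_nil; exact: integrable_cst_fin.
by under eq_fun do rewrite big_cons; exact: integrableD_fin.
Qed.

Lemma Rintegral_sum_fin (I : Type) (s : seq I) (f : I -> T -> R) :
  (forall i, intg (f i)) ->
  \int[P]_x (\sum_(i <- s) f i x) = \sum_(i <- s) \int[P]_x f i x.
Proof.
move=> fi; elim: s => [|i s IH].
  rewrite big_nil; under eq_Rintegral do rewrite big_nil.
  by rewrite Rintegral_cst// mul0r.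
rewrite big_cons -IH -RintegralD//; last exact: integrable_sum_fin.
by apply: eq_Rintegral => x _; rewrite big_cons.
Qed.

Lemma Rintegral_probability_cst (c : R) : \int[P]_(x in [set: T]) c = c.
Proof. by rewrite Rintegral_cst//= probability_setT mulr1. Qed.

Lemma norm_Rintegral_le f g : measurable_fun setT f ->
  (forall x, `|f x| <= g x) -> intg g -> `|\int[P]_x f x| <= \int[P]_x g x.
Proof.
move=> mf fg ig; have fi := integrable_le mf fg ig.
rewrite (le_trans (le_normr_Rintegral _ _))//.
apply: le_Rintegral => //; apply: (integrable_le _ _ ig).
  exact: measurableT_comp.
by move=> x; rewrite normr_id.
Qed.

Lemma norm_Rintegral_le_cst f (M : R) : measurable_fun setT f ->
  (forall x, `|f x| <= M) -> `|\int[P]_x f x| <= M.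
Proof.
move=> mf fM; rewrite -[leRHS]Rintegral_probability_cst.
by apply: norm_Rintegral_le => //; exact: integrable_cst_fin.
Qed.

Lemma Rintegral_fin f : intg f -> (\int[P]_x (f x)%:E = (\int[P]_(x in [set: T]) f x)%R%:E)%E.
Proof. by move=> fi; rewrite /Rintegral fineK//; exact: integrable_fin_num. Qed.

Lemma integrable_sqrW f : measurable_fun setT f -> intg (fun x => f x ^+ 2) -> intg f.
Proof.
move=> mf f2; apply: (@integrable_le _ (fun x => 1 + f x ^+ 2)) => //.
  by move=> x; rewrite ler_norml; apply/andP; split; nra.
by apply: integrableD_fin => //; exact: integrable_cst_fin.
Qed.

Lemma Rintegral_cvg_dominated (f_ : nat -> T -> R) f g :
  (forall n, measurable_fun setT (f_ n)) -> measurable_fun setT f ->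
  (forall x, f_ ^~ x @ \oo --> f x) -> intg g ->
  (forall n x, `|f_ n x| <= g x) ->
  (fun n => \int[P]_x f_ n x) @ \oo --> \int[P]_x f x.
Proof.
move=> mf_ mf cf ig fg.
have fi n : intg (f_ n) by exact: integrable_le ig.
have [|||||fi0 _ h] := @dominated_convergence _ _ _ P setT measurableT
  (fun n x => (f_ n x)%:E) (EFin \o f) (EFin \o g).
- by move=> n; exact/measurable_EFinP.
- exact/measurable_EFinP.
- by apply: aeW => x _; apply: cvg_EFin; [exact: nearW|exact: cf].
- exact: ig.
- by apply: aeW => x n _ /=; rewrite lee_fin.
have fE := Rintegral_fin fi0.
move: h; rewrite [X in _ --> X]fE => /fine_cvg; exact.
Qed.

End real_integral.

(** * Gaussian integrals *)

Section gaussian.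
Context {R : realType}.
Notation leb := (@lebesgue_measure R).

(** The Radon-Nikodym derivative and [normal_pdf] have the same integral over every measurable set,
    so they agree almost everywhere. *)
Lemma ge0_integral_normal_prob (m s : R) (f : R -> \bar R) :
  measurable_fun setT f -> (forall x, 0 <= f x)%E ->
  (\int[normal_prob m s]_x f x = \int[leb]_x (f x * (normal_pdf m s x)%:E))%E.
Proof.
move=> mf f0; have dom := normal_prob_dominates m s.
rewrite -(Radon_Nikodym_SigmaFinite.change_of_variables dom)//.
apply: ae_eq_integral => //.
- apply: emeasurable_funM => //.
  by apply: (measurable_int leb); exact: Radon_Nikodym_SigmaFinite.f_integrable.
- apply: emeasurable_funM => //; apply/measurable_EFinP.
  exact: measurable_normal_pdf.
- apply: ae_eqe_mul2l => /=; apply: integral_ae_eq => //.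
  + exact: Radon_Nikodym_SigmaFinite.f_integrable.
  + by apply/measurable_EFinP; exact: measurable_normal_pdf.
  + by move=> E _ mE; rewrite -Radon_Nikodym_SigmaFinite.f_integral.
Qed.

Lemma ge0_integral_affine (G : R -> R) (m b : R) : 0 < b -> continuous G ->
  (forall x, 0 <= G x) ->
  (\int[leb]_x (G x)%:E = \int[leb]_x (G (m + b * x) * b)%:E)%E.
Proof.
move=> b0 cG G0.
(* Written as a product so that the limits at both infinities come from a translation followed by
   multiplication by b > 0. *)
pose F (x : R^o) := (x + m / b) * b.
have FE x : m + b * x = F x by rewrite /F mulrDl divfK ?gt_eqF// addrC mulrC.
have F'E : F^`()%classic = cst b.
  apply/funext => x; rewrite /F derive1E deriveM// deriveD// derive_cst scaler0.
  by rewrite add0r derive_id derive_cst addr0 /GRing.scale/= mulr1.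
rewrite (@increasing_ge0_integration_by_substitutionT _ F G)//.
- by apply: eq_integral => x _; rewrite F'E FE.
- by move=> x y xy; rewrite /F ltr_pM2r// ltrD2r.
- by rewrite F'E => ?; exact: cvg_cst.
- by rewrite F'E; exact: is_cvg_cst.
- by rewrite F'E; exact: is_cvg_cst.
- by apply/gt0_cvgMlNy; last exact: cvg_addrr_Ny.
- by apply/gt0_cvgMly; last exact: cvg_addrr.
Qed.

Lemma normal_peakE (s : R) : 0 < s -> normal_peak s = s^-1 * normal_peak 1.
Proof.
move=> s0; rewrite /normal_peak expr1n mul1r -[_ * pi *+ 2]mulrnAr sqrtrM ?sqr_ge0//.
by rewrite sqrtr_sqr (gtr0_norm s0) invfM.
Qed.

Lemma normal_pdf_affine (m b x : R) : 0 < b ->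
  normal_pdf m b (m + b * x) * b = normal_pdf 0 1 x.
Proof.
move=> b0; rewrite !normal_pdfE ?gt_eqF// normal_peakE// /normal_fun.
rewrite mulrC !mulrA mulfV ?gt_eqF// mul1r; congr (_ * _).
by congr expR; field; rewrite gt_eqF.
Qed.

Lemma integral_normal_affine (m b : R) (G : R -> R) : 0 < b -> continuous G ->
  (forall x, 0 <= G x) ->
  (\int[normal_prob 0 1]_x (G (m + b * x))%:E
   = \int[leb]_x (G x * normal_pdf m b x)%:E)%E.
Proof.
move=> b0 cG G0.
have cGm : continuous (fun x : R => G (m + b * x)).
  move=> x; apply: continuous_comp; last exact: cG.
  apply: (@continuousD R R R^o (fun=> m) (fun s => b * s)); first exact: cst_continuous.
  exact: mulrl_continuous.
rewrite (@ge0_integral_normal_prob 0 1 (fun x => (G (m + b * x))%:E)); first last.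
- by move=> x; rewrite lee_fin.
- by apply/measurable_EFinP; exact: continuous_measurable_fun.
rewrite (ge0_integral_affine m b0 (G := fun x => G x * normal_pdf m b x)).
- apply: eq_integral => x _ /=.
  by rewrite -mulrA normal_pdf_affine.
- move=> x; apply: (@continuousM R R); first exact: cG.
  by apply: continuous_normal_pdf; rewrite gt_eqF.
- by move=> x; rewrite mulr_ge0// normal_pdf_ge0.
Qed.

(** Bayes' formula for X of law N(0, a^2) and W of law N(X, b^2) given X: the joint density is also
    the marginal N(0, c^2) of W times the conditional density of X given W. The exponents agree by
    completing the square. *)
Lemma normal_pdf_mul (a b x w : R) : 0 < a -> 0 < b ->
  let c := Num.sqrt (a ^+ 2 + b ^+ 2) in
  normal_pdf 0 a x * normal_pdf x b w =
  normal_pdf 0 c w * normal_pdf (a ^+ 2 * w / c ^+ 2) (a * b / c) x.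
Proof.
move=> a0 b0 c.
have s0 : 0 < a ^+ 2 + b ^+ 2 by rewrite addr_gt0// exprn_gt0.
have c0 : 0 < c by rewrite sqrtr_gt0.
have cE : c ^+ 2 = a ^+ 2 + b ^+ 2 by rewrite sqr_sqrtr// ltW.
have abc0 : 0 < a * b / c by rewrite divr_gt0// mulr_gt0.
rewrite !normal_pdfE ?gt_eqF// /normal_fun.
rewrite (normal_peakE a0) (normal_peakE b0) (normal_peakE c0) (normal_peakE abc0).
rewrite mulrACA -expRD [RHS]mulrACA -expRD; congr (_ * expR _).
  by field; rewrite !gt_eqF.
rewrite !exprMn exprVn cE subr0; field.
by rewrite !gt_eqF.
Qed.

Lemma continuous_translate (f : R -> R) (e : R) :
  continuous f -> continuous (fun x => f (e + x)).
Proof.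
move=> cf x; apply: continuous_comp; last exact: cf.
by apply: (@continuousD R R R^o (fun=> e) id); [exact: cst_continuous|move=> ?; exact: cvg_id].
Qed.

Lemma continuous_dilate (f : R -> R) (e : R) :
  continuous f -> continuous (fun x => f (e * x)).
Proof.
move=> cf x; apply: continuous_comp; last exact: cf.
exact: mulrl_continuous.
Qed.

(** After Tonelli the x-integral is inner. By [normal_pdf_mul] its integrand is a constant times a
    normal density in x, which integrates to 1. *)
Lemma normal_convolution1 (b : R) (v : R -> R) : 0 < b ->
  continuous v -> (forall x, 0 <= v x) ->
  (\int[normal_prob 0 1]_x \int[normal_prob 0 1]_z (v (x + b * z))%:E =
   \int[normal_prob 0 1]_z (v (Num.sqrt (1 + b ^+ 2) * z))%:E)%E.
Proof.
move=> b0 cv v0; pose c := Num.sqrt (1 + b ^+ 2).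
have c0 : 0 < c by rewrite sqrtr_gt0 addr_gt0// exprn_gt0.
have cE : c = Num.sqrt (1 ^+ 2 + b ^+ 2) by rewrite expr1n.
under [RHS]eq_integral do rewrite -[_ * _]add0r.
rewrite [RHS](integral_normal_affine 0 c0 cv v0).
under eq_integral do rewrite (integral_normal_affine _ b0 cv v0).
pose k (z : R * R) := (v z.2 * normal_pdf z.1 b z.2)%:E.
have k0 z : (0 <= k z)%E by rewrite lee_fin mulr_ge0// normal_pdf_ge0.
have mk : measurable_fun setT k.
  apply/measurable_EFinP; apply: measurable_funM.
    by apply: measurableT_comp; [exact: continuous_measurable_fun|exact: measurable_snd].
  under eq_fun do rewrite normal_pdfE ?gt_eqF//.
  apply: measurable_funM => //; apply: measurableT_comp => //.
  apply: measurable_funM => //; apply: measurableT_comp => //.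
  by apply: measurable_funX; apply: measurable_funB; [exact: measurable_snd|exact: measurable_fst].
pose l (z : R * R) := (k z * (normal_pdf 0 1 z.1)%:E)%E.
have l0 z : (0 <= l z)%E by rewrite mule_ge0// lee_fin normal_pdf_ge0.
have ml : measurable_fun setT l.
  apply: emeasurable_funM => //; apply/measurable_EFinP.
  by apply: measurableT_comp; [exact: measurable_normal_pdf|exact: measurable_fst].
rewrite (@ge0_integral_normal_prob 0 1 (fun x => \int[leb]_w k (x, w))%E); first last.
- by move=> x; apply: integral_ge0.
- exact: measurable_fun_fubini_tonelli_F.
transitivity (\int[leb]_x \int[leb]_w l (x, w))%E.
  apply: eq_integral => x _; rewrite -ge0_integralZr//.
  - by apply: measurableT_comp => //; exact: measurable_pair1.
  - by rewrite lee_fin normal_pdf_ge0.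
rewrite (@fubini_tonelli _ _ _ _ _ leb leb l)//.
apply: eq_integral => w _.
transitivity (\int[leb]_x ((v w * normal_pdf 0 c w)%:E *
    (normal_pdf (1 ^+ 2 * w / c ^+ 2) (1 * b / c) x)%:E))%E.
  apply: eq_integral => x _; rewrite /l /k /= -!EFinM; congr EFin.
  transitivity (v w * (normal_pdf x b w * normal_pdf 0 1 x)); first by rewrite mulrA.
  rewrite -[RHS]mulrA; congr (_ * _).
  by have := normal_pdf_mul x w ltr01 b0; rewrite /= -cE => <-; exact: mulrC.
rewrite ge0_integralZl//.
- by rewrite integral_normal_pdf mule1.
- by apply/measurable_EFinP; exact: measurable_normal_pdf.
- by move=> x _; rewrite lee_fin normal_pdf_ge0.
- by rewrite lee_fin mulr_ge0// normal_pdf_ge0.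
Qed.

Lemma normal_convolution (a b m : R) (u : R -> R) : 0 < a -> 0 < b ->
  continuous u -> (forall x, 0 <= u x) ->
  (\int[normal_prob 0 1]_x \int[normal_prob 0 1]_z (u (m + a * x + b * z))%:E =
   \int[normal_prob 0 1]_z (u (m + Num.sqrt (a ^+ 2 + b ^+ 2) * z))%:E)%E.
Proof.
move=> a0 b0 cu u0; pose v w := u (m + a * w).
have cv : continuous v := continuous_dilate (continuous_translate cu).
have ba0 : 0 < b / a by rewrite divr_gt0.
transitivity (\int[normal_prob 0 1]_x \int[normal_prob 0 1]_z (v (x + b / a * z))%:E)%E.
  apply: eq_integral => x _; apply: eq_integral => z _; rewrite /v; congr (u _)%:E.
  by field; rewrite gt_eqF.
rewrite (normal_convolution1 ba0 cv)//; last by move=> x; exact: u0.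
apply: eq_integral => z _; rewrite /v; congr (u (_ + _))%:E.
rewrite mulrA; congr (_ * _).
have sa : Num.sqrt (a ^+ 2) = a by rewrite sqrtr_sqr gtr0_norm.
rewrite -{1}sa -sqrtrM ?sqr_ge0//; congr Num.sqrt.
by field; rewrite gt_eqF.
Qed.

(** The total mass 1 of the normal density, solved for the Gaussian integral. Its linear dependence
    on [r] is what yields the second moment below. *)
Lemma integral_normal_fun0 (r : R) : 0 < r ->
  (\int[leb]_x (expR (- x ^+ 2 / (r ^+ 2 *+ 2)))%:E = (r * Num.sqrt (pi *+ 2))%:E)%E.
Proof.
move=> r0; have p0 : 0 < normal_peak r by rewrite normal_peak_gt0// gt_eqF.
have := integral_normal_pdf 0 r.
under eq_integral do rewrite normal_pdfE ?gt_eqF// EFinM.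
rewrite ge0_integralZl//; first last.
- by rewrite lee_fin ltW.
- by move=> x _; rewrite lee_fin expR_ge0.
- by apply/measurable_EFinP; exact: measurable_normal_fun.
rewrite /normal_fun; under eq_integral do rewrite subr0.
move=> /(congr1 (fun t => (normal_peak r)^-1%:E * t)%E).
rewrite muleA -EFinM mulVf ?gt_eqF// mul1e mule1 => ->.
by rewrite normal_peakE// /normal_peak invfM !invrK expr1n mul1r.
Qed.

(** The second moment comes from the derivative at r = 1 of the integral of exp(- x^2 / (2 r^2)),
    which is r q. Integrating the convexity bound 1 + y <= exp y on either side of r = 1 avoids
    differentiating under the integral. *)
Lemma integral_sqr_normal : (\int[normal_prob 0 1]_(x in [set: R]) (x ^+ 2)%:E = 1)%E.
Proof.
pose q := Num.sqrt (pi *+ 2 : R).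
have q0 : 0 < q by rewrite sqrtr_gt0 mulrn_wgt0// pi_gt0.
pose e (r x : R) := expR (- x ^+ 2 / (r ^+ 2 *+ 2)).
have me r : measurable_fun setT (e r).
  by have := measurable_normal_fun (0 : R) r; rewrite /normal_fun; under eq_fun do rewrite subr0.
have ie r : 0 < r -> (\int[leb]_x (e r x)%:E = (r * q)%:E)%E by exact: integral_normal_fun0.
have me' r : measurable_fun setT (fun x : R => (e r x)%:E) by apply/measurable_EFinP; exact: me.
pose J := (\int[leb]_x (x ^+ 2 * e 1 x)%:E)%E.
have mJ : measurable_fun setT (fun x : R => x ^+ 2 * e 1 x) by exact: measurable_funM.
have NJ : (\int[normal_prob 0 1]_x (x ^+ 2)%:E = (q^-1)%:E * J)%E.
  rewrite (@ge0_integral_normal_prob 0 1 (fun x => (x ^+ 2)%:E)); first last.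
  - by move=> x; rewrite lee_fin sqr_ge0.
  - by apply/measurable_EFinP.
  rewrite -ge0_integralZl//; first last.
  - by rewrite lee_fin invr_ge0 ltW.
  - by move=> x _; rewrite lee_fin mulr_ge0 ?sqr_ge0 ?expR_ge0.
  - exact/measurable_EFinP.
  apply: eq_integral => x _; rewrite normal_pdfE ?gt_eqF//.
  rewrite /normal_peak /normal_fun subr0 -!EFinM expr1n mul1r /e expr1n; congr EFin.
  by rewrite mulrCA.
(* For r > 1 > r' the chords of s |-> exp (- s x^2 / 2) at 1 sandwich its derivative. *)
have ub (r : R) : 1 < r -> (((1 - r ^- 2) / 2)%:E * J <= ((r - 1) * q)%:E)%E.
  move=> r1; have r0 : 0 < r by rewrite (lt_trans _ r1).
  rewrite -ge0_integralZl//; first last.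
  - rewrite lee_fin divr_ge0// subr_ge0 invf_le1 ?exprn_gt0//.
    by rewrite exprn_ege1// ltW.
  - by move=> x _; rewrite lee_fin mulr_ge0 ?sqr_ge0 ?expR_ge0.
  - first [exact: me'|exact/measurable_EFinP].
  have : (\int[leb]_x ((((1 - r ^- 2) / 2)%:E * (x ^+ 2 * e 1 x)%:E) + (e 1 x)%:E)
     <= \int[leb]_x (e r x)%:E)%E.
    apply: ge0_le_integral => //=.
    - move=> x _; rewrite -EFinM -EFinD lee_fin addr_ge0 ?expR_ge0// mulr_ge0//.
      + rewrite divr_ge0// subr_ge0 invf_le1 ?exprn_gt0// exprn_ege1// ltW//.
      + by rewrite mulr_ge0 ?sqr_ge0 ?expR_ge0.
    - apply: emeasurable_funD; [|exact: me'].
      by apply: emeasurable_funM => //; first [exact: me'|exact/measurable_EFinP].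
    - first [exact: me'|exact/measurable_EFinP].
    - move=> x _; rewrite -EFinM -EFinD lee_fin.
      have -> : e r x = e 1 x * expR ((1 - r ^- 2) / 2 * x ^+ 2).
        by rewrite /e -expRD; congr expR; field; rewrite gt_eqF.
      have := expR_ge1Dx ((1 - r ^- 2) / 2 * x ^+ 2).
      have := expR_gt0 (- x ^+ 2 / (1 ^+ 2 *+ 2)); rewrite -/(e 1 x); nra.
  rewrite ge0_integralD//; first last.
  - first [exact: me'|exact/measurable_EFinP].
  - by move=> x _; rewrite lee_fin expR_ge0.
  - by apply: emeasurable_funM => //; first [exact: me'|exact/measurable_EFinP].
  - move=> x _; rewrite -EFinM lee_fin mulr_ge0//.
    + rewrite divr_ge0// subr_ge0 invf_le1 ?exprn_gt0// exprn_ege1// ltW//.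
    + by rewrite mulr_ge0 ?sqr_ge0 ?expR_ge0.
  rewrite !ie// mul1r -leeBrDr// -EFinB (_ : r * q - q = (r - 1) * q)//.
  by rewrite mulrBl mul1r.
have J0 : (0 <= J)%E.
  by apply: integral_ge0 => x _; rewrite lee_fin mulr_ge0 ?sqr_ge0 ?expR_ge0.
(* The bound at r = 2 excludes J = +oo. *)
have Jfin : J \is a fin_num.
  rewrite ge0_fin_numE//; have := ub 2 ltac:(lra).
  move: J0; case: (J) => [j|//|//] _; first by rewrite ltry.
  by rewrite gt0_muley ?lte_fin ?leye_eq//; lra.
have lb (r : R) : 0 < r -> r < 1 -> (((1 - r) * q)%:E <= ((r ^- 2 - 1) / 2)%:E * J)%E.
  move=> r0 r1; have r21 : 0 <= (r ^- 2 - 1) / 2.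
    by rewrite divr_ge0// subr_ge0 invf_ge1 ?exprn_gt0// expr_le1// ltW.
  rewrite -ge0_integralZl//; first last.
  - by move=> x _; rewrite lee_fin mulr_ge0 ?sqr_ge0 ?expR_ge0.
  - first [exact: me'|exact/measurable_EFinP].
  have : (\int[leb]_x (e 1 x)%:E <= \int[leb]_x ((((r ^- 2 - 1) / 2)%:E * (x ^+ 2 * e 1 x)%:E) + (e r x)%:E))%E.
    apply: ge0_le_integral => //=.
    - by move=> x _; rewrite lee_fin expR_ge0.
    - first [exact: me'|exact/measurable_EFinP].
    - apply: emeasurable_funD; [|exact: me'].
      by apply: emeasurable_funM => //; first [exact: me'|exact/measurable_EFinP].
    - move=> x _; rewrite -EFinM -EFinD lee_fin.
      have -> : e r x = e 1 x * expR (- ((r ^- 2 - 1) / 2 * x ^+ 2)).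
        by rewrite /e -expRD; congr expR; field; rewrite gt_eqF.
      have := expR_ge1Dx (- ((r ^- 2 - 1) / 2 * x ^+ 2)).
      have := expR_gt0 (- x ^+ 2 / (1 ^+ 2 *+ 2)); rewrite -/(e 1 x); nra.
  rewrite ge0_integralD//; first last.
  - first [exact: me'|exact/measurable_EFinP].
  - by move=> x _; rewrite lee_fin expR_ge0.
  - by apply: emeasurable_funM => //; first [exact: me'|exact/measurable_EFinP].
  - by move=> x _; rewrite -EFinM lee_fin mulr_ge0// mulr_ge0 ?sqr_ge0 ?expR_ge0.
  rewrite !ie// mul1r -leeBlDr// -EFinB (_ : q - r * q = (1 - r) * q)//.
  by rewrite mulrBl mul1r.
rewrite NJ; move: ub lb; rewrite -(fineK Jfin); set j := fine J => ub lb.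
rewrite -EFinM; congr EFin; apply/eqP; rewrite mulrC -subr_eq0 -[_ - _]subr0.
have jq : 0 <= j / q by rewrite divr_ge0 ?fine_ge0// ltW.
set t := j / q in jq *.
have jE : j = t * q by rewrite /t divfK// gt_eqF.
(* Cancelling the common factor r - 1 leaves inequalities that become 2 t <= 2 and 2 <= 2 t as r
   tends to 1. *)
have ub' r : 1 < r -> t * (r + 1) <= 2 * r ^+ 2.
  move=> r1; move: (ub _ r1); rewrite -EFinM lee_fin jE mulrA ler_pM2r//.
  rewrite (_ : (1 - r ^- 2) / 2 * t = (r - 1) * (t * (r + 1) / (2 * r ^+ 2))); last first.
    by field; rewrite gt_eqF// (lt_trans _ r1).
  rewrite -[leRHS]mulr1 ler_pM2l ?subr_gt0// ler_pdivrMr ?mul1r//.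
  by rewrite mulr_gt0// exprn_gt0// (lt_trans _ r1).
have lb' r : 0 < r -> r < 1 -> 2 * r ^+ 2 <= t * (r + 1).
  move=> r0 r1; move: (lb _ r0 r1); rewrite -EFinM lee_fin jE mulrA ler_pM2r//.
  rewrite (_ : (r ^- 2 - 1) / 2 * t = (1 - r) * (t * (r + 1) / (2 * r ^+ 2))); last first.
    by field; rewrite gt_eqF.
  rewrite -[leLHS]mulr1 ler_pM2l ?subr_gt0// ler_pdivlMr ?mul1r//.
  by rewrite mulr_gt0// exprn_gt0.
rewrite subr0 subr_eq0 eq_le; apply/andP; split; apply/ler_addgt0Pr => d d0.
(* For h <= 1 one has 2 (1 + h)^2 <= 2 + 6 h, hence the divisor 6. *)
- pose h := Num.min 1 (d / 6).
  have h0 : 0 < h by rewrite lt_min ltr01 divr_gt0.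
  have h1 : h <= 1 by rewrite ge_min lexx.
  have h2 : h <= d / 6 by rewrite ge_min lexx orbT.
  have := ub' (1 + h) ltac:(lra); nra.
- pose h := Num.min (2^-1) (d / 6).
  have h0 : 0 < h by rewrite lt_min invr_gt0 ltr0n divr_gt0.
  have h1 : h <= 2^-1 by rewrite ge_min lexx.
  have h2 : h <= d / 6 by rewrite ge_min lexx orbT.
  have := lb' (1 - h) ltac:(lra) ltac:(lra); nra.
Qed.

Lemma integrable_sqr_normal :
  (normal_prob 0 1).-integrable [set: R] (fun x => (x ^+ 2)%:E).
Proof.
apply/integrableP; split; first exact/measurable_EFinP.
under eq_integral do rewrite gee0_abs ?lee_fin ?sqr_ge0//.
by rewrite integral_sqr_normal ltry.
Qed.

Lemma integrable_id_normal : (normal_prob 0 1).-integrable [set: R] (EFin \o id).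
Proof. by apply: integrable_sqrW => //; exact: integrable_sqr_normal. Qed.

(* Integrating 1 + y <= exp y with y = t x - t^2 / 2, whose exponential is the
   density of N(t, 1) relative to N(0, 1), gives t m <= t^2 / 2 for all t. *)
Lemma Rintegral_id_normal : \int[normal_prob 0 1]_(x in [set: R]) x = 0.
Proof.
have bound (t : R) : t * (\int[normal_prob 0 1]_(x in [set: R]) x) <= t ^+ 2 / 2.
  have h : (\int[normal_prob 0 1]_(x in [set: R]) (expR (t * x - t ^+ 2 / 2))%:E = 1)%E.
    rewrite (@ge0_integral_normal_prob 0 1 (fun x => (expR (t * x - t ^+ 2 / 2))%:E)); first last.
    - by move=> x; rewrite lee_fin expR_ge0.
    - apply/measurable_EFinP; apply: measurableT_comp => //.
      by apply: measurable_funB => //; exact: measurable_funM.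
    rewrite -(integral_normal_pdf t 1); apply: eq_integral => x _.
    rewrite -EFinM; congr EFin; rewrite !normal_pdfE ?oner_eq0// mulrCA; congr (_ * _).
    by rewrite /normal_fun -expRD; congr expR; field.
  have ie : (normal_prob 0 1).-integrable [set: R] (fun x => (expR (t * x - t ^+ 2 / 2))%:E).
    apply/integrableP; split.
      apply/measurable_EFinP; apply: measurableT_comp => //.
      by apply: measurable_funB => //; exact: measurable_funM.
    under eq_integral do rewrite gee0_abs ?lee_fin ?expR_ge0//.
    by rewrite h ltry.
  have i1 : (normal_prob 0 1).-integrable [set: R] (fun x => (1 - t ^+ 2 / 2)%:E).
    exact: finite_measure_integrable_cst.
  have i2 : (normal_prob 0 1).-integrable [set: R] (EFin \o (fun x => t * x)).
    exact: integrableZl_fin integrable_id_normal.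
  have : \int[normal_prob 0 1]_(x in [set: R]) (t * x + (1 - t ^+ 2 / 2))
    <= \int[normal_prob 0 1]_(x in [set: R]) (expR (t * x - t ^+ 2 / 2)).
    apply: le_Rintegral => //; first exact: integrableD_fin.
    move=> x _; apply: le_trans (expR_ge1Dx _).
    by rewrite addrCA addrA.
  rewrite RintegralD// RintegralZl//; last exact: integrable_id_normal.
  rewrite Rintegral_probability_cst {2}/Rintegral h /=.
  by move=> ?; lra.
set m := (X in X = 0) in bound *.
(* At t = m the bound reads m^2 <= m^2 / 2. *)
have /= := bound m; rewrite -expr2 => h.
by apply/eqP; rewrite -sqrf_eq0 eq_le sqr_ge0 andbT; lra.
Qed.

End gaussian.

(** * Smooth test functions *)

Section smooth_functions.
Context {R : realType}.
Implicit Types (u : R -> R) (C : R).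

Lemma lipschitz_continuous (f : R -> R) (K : R) :
  (forall x h, `|f (x + h) - f x| <= K * `|h|) -> continuous f.
Proof.
move=> fK x; apply/cvgrPdist_le => e e0.
have K0 : 0 <= K by have := fK x 1; rewrite normr1 mulr1; apply: le_trans.
near=> t.
rewrite distrC -[t](subrKC x); apply: (le_trans (fK _ _)).
rewrite (@le_trans _ _ ((K + 1) * `|t - x|))//.
  by rewrite ler_wpM2r// lerDl.
rewrite mulrC -ler_pdivlMr ?ltr_wpDl// distrC.
near: t; apply/nbhs_ballP; exists (e / (K + 1)) => /=; first by rewrite divr_gt0// ltr_wpDl.
by move=> t /ltW.
Unshelve. all: by end_near. Qed.

(** [u1] and [u2] play the role of u' and u'' but enter only through estimates, so the class is
    stable under averaging without differentiating an integral. The truncated remainder is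
    integrable against any law with a second moment. *)
Record smooth C u u1 u2 : Prop := Smooth {
  smooth_le0 : forall x, `|u x| <= C ;
  smooth_le1 : forall x, `|u1 x| <= C ;
  smooth_le2 : forall x, `|u2 x| <= C ;
  smooth_lip1 : forall x h, `|u1 (x + h) - u1 x| <= C * `|h| ;
  smooth_lip2 : forall x h, `|u2 (x + h) - u2 x| <= C * `|h| ;
  smooth_taylor : forall x h,
    `|u (x + h) - u x - h * u1 x - h ^+ 2 / 2 * u2 x| <=
      C * (h ^+ 2 * Num.min 1 `|h|) }.

Lemma smooth_C_ge0 C u u1 u2 : smooth C u u1 u2 -> 0 <= C.
Proof. by move=> /smooth_le0/(_ 0); apply: le_trans. Qed.

(** For |h| <= 1 each of the three terms of the Taylor estimate is at most C |h|; for larger h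
    boundedness of [u] suffices. *)
Lemma smooth_lip0 C u u1 u2 : smooth C u u1 u2 ->
  forall x h, `|u (x + h) - u x| <= 3 * C * `|h|.
Proof.
move=> su x h; have C0 := smooth_C_ge0 su.
have [h1|/ltW h1] := leP `|h| 1; last first.
  rewrite (le_trans (ler_normB _ _))//.
  rewrite (le_trans (lerD (smooth_le0 su _) (smooth_le0 su _)))//.
  by have := ler_wpM2l C0 h1; nra.
have := smooth_taylor su x h; set t := (X in `|X| <= _) => ht.
have -> : u (x + h) - u x = t + h * u1 x + h ^+ 2 / 2 * u2 x by rewrite /t; ring.
rewrite (le_trans (ler_normD _ _))// (le_trans (lerD (ler_normD _ _) (lexx _)))//.
rewrite [`|h * u1 x|]normrM [`|h ^+ 2 / 2 * u2 x|]normrM.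
have a0 : 0 <= `|h| by [].
have m1 : Num.min 1 `|h| <= 1 by rewrite ge_min lexx.
have m0 : 0 <= Num.min 1 `|h| by rewrite le_min ler01/=.
have h2 : `|h ^+ 2 / 2| = `|h| ^+ 2 / 2 by rewrite normrM normrX [`|2^-1|]ger0_norm.
have h2' : h ^+ 2 = `|h| ^+ 2 by rewrite real_normK ?num_real.
rewrite h2; rewrite h2' in ht.
have := smooth_le1 su x; have := smooth_le2 su x.
set A := `|u1 x|; set B := `|u2 x|; set m := Num.min _ _ in ht m0 m1 *.
set a := `|h| in a0 h1 ht m0 m1 *.
move=> BC AC.
have haa : a ^+ 2 <= a by rewrite expr2; nra.
have e1 : C * (a ^+ 2 * m) <= C * a.
  by rewrite ler_wpM2l// (le_trans _ haa)// ler_piMr// sqr_ge0.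
have e2 : a * A <= C * a by rewrite mulrC ler_wpM2r.
have e3 : a ^+ 2 / 2 * B <= C * a.
  have : a ^+ 2 * B <= a * C by rewrite ler_pM// ?sqr_ge0// normr_ge0.
  by have := mulr_ge0 a0 C0; lra.
lra.
Qed.

Lemma smooth_continuous0 C u u1 u2 : smooth C u u1 u2 -> continuous u.
Proof. by move=> /smooth_lip0; exact: lipschitz_continuous. Qed.

Lemma smooth_continuous1 C u u1 u2 : smooth C u u1 u2 -> continuous u1.
Proof. by move=> /smooth_lip1; exact: lipschitz_continuous. Qed.

Lemma smooth_continuous2 C u u1 u2 : smooth C u u1 u2 -> continuous u2.
Proof. by move=> /smooth_lip2; exact: lipschitz_continuous. Qed.

(** * Averages of test functions over a random translation *)

Section average.
Context d (T : measurableType d) (P : probability T R) (Y : T -> R).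
Hypothesis mY : measurable_fun setT Y.

Let avg u x := \int[P]_(w in [set: T]) u (x + Y w).

Lemma measurable_translate u x : continuous u ->
  measurable_fun setT (fun w => u (x + Y w)).
Proof.
move=> cu; apply: measurableT_comp; first exact: continuous_measurable_fun.
exact: measurable_funD.
Qed.

Lemma integrable_translate C u x : continuous u -> (forall x, `|u x| <= C) ->
  P.-integrable setT (EFin \o (fun w => u (x + Y w))).
Proof.
move=> cu uC; apply: (@integrable_bounded _ _ _ _ _ C) => //.
exact: measurable_translate.
Qed.

Lemma avg_le C u x : continuous u -> (forall x, `|u x| <= C) -> `|avg u x| <= C.
Proof.
by move=> cu uC; apply: norm_Rintegral_le_cst => //; exact: measurable_translate.
Qed.

Lemma avg_lip C K u x h : continuous u -> (forall x, `|u x| <= C) ->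
  (forall x h, `|u (x + h) - u x| <= K * `|h|) ->
  `|avg u (x + h) - avg u x| <= K * `|h|.
Proof.
move=> cu uC uK; have iu y := integrable_translate y cu uC.
rewrite /avg -RintegralB//.
apply: norm_Rintegral_le_cst => [|w]; last by rewrite [x + h + _]addrAC uK.
by apply: measurable_funB; exact: measurable_translate.
Qed.

(** Each estimate is linear in the three functions and uniform in x, so averaging under a
    probability keeps the constant C. This makes the error bounds uniform over n Gaussian steps. *)
Lemma smooth_average C u u1 u2 : smooth C u u1 u2 ->
  smooth C (avg u) (avg u1) (avg u2).
Proof.
move=> su.
have c0 := smooth_continuous0 su; have c1 := smooth_continuous1 su.
have c2 := smooth_continuous2 su.
split.
- by move=> x; exact: avg_le (smooth_le0 su).
- by move=> x; exact: avg_le (smooth_le1 su).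
- by move=> x; exact: avg_le (smooth_le2 su).
- by move=> x h; exact: (avg_lip x h c1 (smooth_le1 su) (smooth_lip1 su)).
- by move=> x h; exact: (avg_lip x h c2 (smooth_le2 su) (smooth_lip2 su)).
move=> x h.
have i0 y := integrable_translate y c0 (smooth_le0 su).
have i1 := integrableZl_fin h (integrable_translate x c1 (smooth_le1 su)).
have i2 := integrableZl_fin (h ^+ 2 / 2) (integrable_translate x c2 (smooth_le2 su)).
have -> : avg u (x + h) - avg u x - h * avg u1 x - h ^+ 2 / 2 * avg u2 x =
    \int[P]_(w in [set: T]) (u (x + h + Y w) - u (x + Y w) - h * u1 (x + Y w)
      - h ^+ 2 / 2 * u2 (x + Y w)).
  rewrite RintegralB//; last by do 2 apply: integrableB_fin => //.
  rewrite RintegralB//; last exact: integrableB_fin.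
  rewrite RintegralB// !RintegralZl//.
    exact: integrable_translate (smooth_le2 su).
  exact: integrable_translate (smooth_le1 su).
apply: norm_Rintegral_le_cst => [|w]; last first.
  by rewrite [x + h + _]addrAC; exact: smooth_taylor.
apply: measurable_funB; last by apply: measurable_funM => //; exact: measurable_translate.
apply: measurable_funB; last by apply: measurable_funM => //; exact: measurable_translate.
by apply: measurable_funB; exact: measurable_translate.
Qed.

Hypothesis Y2 : P.-integrable setT (EFin \o (fun w => Y w ^+ 2)).

(** The quantity of the Lindeberg condition: the mean of h^2 min(1, |h|) at h = s Y, divided by
    s^2. *)
Definition trunc2 (s : R) := \int[P]_(w in [set: T]) (Y w ^+ 2 * Num.min 1 (s * `|Y w|)).

Let mtrunc s : measurable_fun setT (fun w => Y w ^+ 2 * Num.min 1 (s * `|Y w|)).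
Proof.
apply: measurable_funM; first exact: measurable_funX.
apply: measurable_minr => //; apply: measurable_funM => //.
exact: measurableT_comp.
Qed.

Let trunc_le s w : 0 <= s -> `|Y w ^+ 2 * Num.min 1 (s * `|Y w|)| <= Y w ^+ 2.
Proof.
move=> s0; rewrite normrM ger0_norm ?sqr_ge0// ler_piMr ?sqr_ge0//.
by rewrite ger0_norm ?ge_min ?lexx// le_min ler01/= mulr_ge0.
Qed.

Lemma trunc2_cvg0 (s_ : nat -> R) : (forall n, 0 <= s_ n) -> s_ @ \oo --> 0 ->
  (fun n => trunc2 (s_ n)) @ \oo --> 0.
Proof.
move=> s0 sc.
have -> : 0 = \int[P]_(w in [set: T]) (0 : R) by rewrite Rintegral_probability_cst.
apply: (@Rintegral_cvg_dominated _ _ _ _ _ _ (fun w => Y w ^+ 2)) => //.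
- move=> w; apply: (@squeeze_cvgr _ _ _ _ (fun=> 0) (fun n => Y w ^+ 2 * (s_ n * `|Y w|))).
  + apply: nearW => n; rewrite mulr_ge0 ?sqr_ge0 ?le_min ?ler01 ?mulr_ge0//=.
    by rewrite ler_wpM2l ?sqr_ge0// ge_min lexx orbT.
  + exact: cvg_cst.
  + rewrite -[X in _ --> X](_ : Y w ^+ 2 * (0 * `|Y w|) = 0); last by rewrite mul0r mulr0.
    by apply: cvgM; [exact: cvg_cst|apply: cvgM => //; exact: cvg_cst].
- by move=> n w; exact: trunc_le.
Qed.

Lemma smooth_expansion C u u1 u2 s x : smooth C u u1 u2 -> 0 <= s ->
  \int[P]_(w in [set: T]) Y w = 0 ->
  `|\int[P]_(w in [set: T]) u (x + s * Y w) - u x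
     - s ^+ 2 / 2 * u2 x * \int[P]_(w in [set: T]) (Y w ^+ 2)|
    <= s ^+ 2 * (C * trunc2 s).
Proof.
move=> su s0 EY.
have c0 := smooth_continuous0 su.
have iY := integrable_sqrW mY Y2.
have msu : measurable_fun setT (fun w => u (x + s * Y w)).
  apply: measurableT_comp; first exact: continuous_measurable_fun.
  by apply: measurable_funD => //; exact: measurable_funM.
have isu : P.-integrable setT (EFin \o (fun w => u (x + s * Y w))).
  by apply: (@integrable_bounded _ _ _ _ _ C) => // w; exact: smooth_le0 su _.
have i1 := integrableZl_fin (s * u1 x) iY.
have i2 := integrableZl_fin (s ^+ 2 / 2 * u2 x) Y2.
have ic := integrable_cst_fin P (u x).
have -> : \int[P]_(w in [set: T]) u (x + s * Y w) - u x
     - s ^+ 2 / 2 * u2 x * \int[P]_(w in [set: T]) (Y w ^+ 2) =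
   \int[P]_(w in [set: T]) (u (x + s * Y w) - u x - s * u1 x * Y w
      - s ^+ 2 / 2 * u2 x * Y w ^+ 2).
  rewrite RintegralB//; last by do 2 apply: integrableB_fin => //.
  rewrite RintegralB//; last exact: integrableB_fin.
  by rewrite RintegralB// !RintegralZl// EY mulr0 subr0 Rintegral_probability_cst.
have it : P.-integrable setT (EFin \o (fun w => Y w ^+ 2 * Num.min 1 (s * `|Y w|))).
  by apply: (integrable_le _ _ Y2) => // w; exact: trunc_le.
rewrite mulrA /trunc2 -RintegralZl//.
apply: norm_Rintegral_le; last exact: integrableZl_fin.
- apply: measurable_funB; last by apply: measurable_funM => //; exact: measurable_funX.
  by apply: measurable_funB; [exact: measurable_funB|exact: measurable_funM].
- move=> w; have := smooth_taylor su x (s * Y w).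
  rewrite normrM (ger0_norm s0) exprMn.
  set l := (X in `|X| <= _); set l' := (X in _ -> `|X| <= _).
  have -> : l' = l by rewrite /l /l'; field.
  by move=> h; rewrite (le_trans h)// le_eqVlt; apply/orP; left; apply/eqP; ring.
Qed.

End average.

(** * Cubic spline steps *)

Definition ramp (x : R) : R := Num.max x 0.

Lemma ramp_lip x h : `|ramp (x + h) - ramp x| <= `|h|.
Proof.
rewrite /ramp; have [a|a] := leP (x + h) 0; have [b|b] := leP x 0;
have [c|c] := leP 0 h; rewrite ?(ger0_norm c) ?(ltr0_norm c) ler_norml; apply/andP; split; lra.
Qed.

Lemma ramp2_taylor x h : `|ramp (x + h) ^+ 2 - ramp x ^+ 2 - 2 * h * ramp x| <= h ^+ 2.
Proof.
by rewrite /ramp; have [a|a] := leP (x + h) 0; have [b|b] := leP x 0;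
rewrite ler_norml; apply/andP; split; nra.
Qed.

(** [step] is a fixed combination of translates of the truncated cube, so it inherits this
    third-order estimate. *)
Lemma ramp3_taylor x h :
  `|ramp (x + h) ^+ 3 - ramp x ^+ 3 - 3 * h * ramp x ^+ 2 - 3 * h ^+ 2 * ramp x| <= `|h| ^+ 3.
Proof.
rewrite /ramp; have [a|a] := leP (x + h) 0; have [b|b] := leP x 0.
- by rewrite !expr0n/= !mulr0 !subr0 normr0 exprn_ge0.
- have h0 : h <= 0 by lra.
  rewrite (ler0_norm h0) (_ : _ - _ = h ^+ 3 - (x + h) ^+ 3); last by ring.
  have A : 0 <= - (x + h) ^+ 3 by rewrite exprS mulrC -mulrN mulr_ge0 ?sqr_ge0//; lra.
  have B : (- h) ^+ 3 - (- (x + h)) ^+ 3 >= 0.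
    by rewrite subr_ge0 lerXn2r ?nnegrE//; lra.
  by rewrite ler_norml; apply/andP; split; move: A B; rewrite !exprS !expr0; lra.
- have h0 : 0 <= h by lra.
  rewrite (ger0_norm h0) expr0n/= !mulr0 !subr0 expr0n/= mulr0 subr0.
  by rewrite ger0_norm ?exprn_ge0 ?lerXn2r ?nnegrE//; lra.
- by rewrite (_ : _ - _ = h ^+ 3); [rewrite normrX|ring].
Qed.

(* The quadratic-derivative cubic B-spline primitive: 0 on (-oo,0], 1 on [3,+oo). *)
Definition step (x : R) : R :=
  (ramp x ^+ 3 - 3 * ramp (x - 1) ^+ 3 + 3 * ramp (x - 2) ^+ 3 - ramp (x - 3) ^+ 3) / 6.
Definition step1 (x : R) : R :=
  (ramp x ^+ 2 - 3 * ramp (x - 1) ^+ 2 + 3 * ramp (x - 2) ^+ 2 - ramp (x - 3) ^+ 2) / 2.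
Definition step2 (x : R) : R :=
  ramp x - 3 * ramp (x - 1) + 3 * ramp (x - 2) - ramp (x - 3).

Lemma step_eq0 x : x <= 0 -> step x = 0.
Proof.
by move=> x0; rewrite /step /ramp !max_r ?expr0n/=; try lra; ring.
Qed.

Lemma step_eq1 x : 3 <= x -> step x = 1.
Proof. by move=> x3; rewrite /step /ramp !max_l; try lra; field. Qed.

Lemma step_bounds x :
  [/\ 0 <= step x <= 1, `|step1 x| <= 1 & `|step2 x| <= 1].
Proof.
rewrite /step /step1 /step2 /ramp.
have [x0|x0] := leP x 0.
  rewrite !max_r; try lra; rewrite !expr0n/= !mulr0 !subr0 !addr0 !mul0r normr0.
  by split; rewrite ?ler01 ?lexx.
have [x1|x1] := leP x 1.
  rewrite !(@max_r _ _ (x - _)); try lra; rewrite !expr0n/= !mulr0 !subr0 !addr0.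
  by split; rewrite ?ler_norml; apply/andP; split; nra.
have [x2|x2] := leP x 2.
  rewrite (@max_l _ _ (x - 1)) ?(@max_r _ _ (x - _)); try lra.
  rewrite !expr0n/= !mulr0 !subr0 !addr0.
  (* Certificate for the upper bound on this piece: 6 (1 - [step] x) = (2 - x)^2 (2 x - 1) + (7 - 3
     x). *)
  have := mulr_ge0 (sqr_ge0 (2 - x)) (_ : 0 <= 2 * x - 1); rewrite !expr2 => k.
  have {}k := k ltac:(lra).
  have k2 : 0 <= (x - 1) * (2 - x) by apply: mulr_ge0; lra.
  split; rewrite ?ler_norml; apply/andP; split; rewrite ?exprS ?expr0 ?mulr1; nra.
have [x3|x3] := leP x 3.
  rewrite (@max_l _ _ (x - 1)) ?(@max_l _ _ (x - 2)) ?(@max_r _ _ (x - 3)); try lra.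
  rewrite !expr0n/= !subr0.
  have -> : (x ^+ 3 - 3 * (x - 1) ^+ 3 + 3 * (x - 2) ^+ 3) / 6 = 1 - (3 - x) ^+ 3 / 6 by field.
  have -> : (x ^+ 2 - 3 * (x - 1) ^+ 2 + 3 * (x - 2) ^+ 2) / 2 = (3 - x) ^+ 2 / 2 by field.
  have y0 : 0 <= (3 - x) ^+ 3 by apply: exprn_ge0; lra.
  have y1 : (3 - x) ^+ 3 <= 1 by apply: exprn_ile1; lra.
  have z0 : 0 <= (3 - x) ^+ 2 by exact: sqr_ge0.
  have z1 : (3 - x) ^+ 2 <= 1 by apply: exprn_ile1; lra.
  by split; rewrite ?ler_norml; apply/andP; split; lra.
rewrite !max_l; try lra.
have -> : (x ^+ 3 - 3 * (x - 1) ^+ 3 + 3 * (x - 2) ^+ 3 - (x - 3) ^+ 3) / 6 = 1 by field.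
have -> : (x ^+ 2 - 3 * (x - 1) ^+ 2 + 3 * (x - 2) ^+ 2 - (x - 3) ^+ 2) / 2 = 0 by field.
by split; rewrite ?ler_norml; apply/andP; split; lra.
Qed.

(** The constant 8 = 1 + 3 + 3 + 1 is the sum of the absolute weights of the four knots. Where a
    Taylor expansion is too weak for large |h|, the bounds of [step_bounds] are used. *)
Lemma step_smooth : smooth 8 step step1 step2.
Proof.
have tri4 (a b c e A B C E : R) : `|a| <= A -> `|b| <= B -> `|c| <= C -> `|e| <= E ->
    `|a - 3 * b + 3 * c - e| <= A + 3 * B + 3 * C + E.
  rewrite !ler_norml => /andP[? ?] /andP[? ?] /andP[? ?] /andP[? ?].
  by apply/andP; split; lra.
have lip1 x h : `|step1 (x + h) - step1 x| <= 8 * `|h|.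
  have [h1|h1] := leP `|h| 1; last first.
    have [_ a _] := step_bounds (x + h); have [_ b _] := step_bounds x.
    by rewrite (le_trans (ler_normB _ _))//; lra.
  have T := tri4 _ _ _ _ _ _ _ _ (ramp2_taylor x h) (ramp2_taylor (x - 1) h)
    (ramp2_taylor (x - 2) h) (ramp2_taylor (x - 3) h).
  have [_ _ b] := step_bounds x.
  have E : step1 (x + h) - step1 x = h * step2 x +
    (ramp (x + h) ^+ 2 - ramp x ^+ 2 - 2 * h * ramp x -
     3 * (ramp (x - 1 + h) ^+ 2 - ramp (x - 1) ^+ 2 - 2 * h * ramp (x - 1)) +
     3 * (ramp (x - 2 + h) ^+ 2 - ramp (x - 2) ^+ 2 - 2 * h * ramp (x - 2)) -
     (ramp (x - 3 + h) ^+ 2 - ramp (x - 3) ^+ 2 - 2 * h * ramp (x - 3))) / 2.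
    by rewrite /step1 /step2 ![x + h - _]addrAC; field.
  rewrite E (le_trans (ler_normD _ _))// !normrM (ger0_norm (x := 2^-1)) ?invr_ge0//.
  have h2 : h ^+ 2 <= `|h| by rewrite -real_normK ?num_real// expr2 ler_piMr.
  have hb : `|h| * `|step2 x| <= `|h| by rewrite ler_piMr.
  by rewrite (le_trans (lerD hb (ler_wpM2r _ T)))// ?invr_ge0//; have := normr_ge0 h; lra.
have lip2 x h : `|step2 (x + h) - step2 x| <= 8 * `|h|.
  have T := tri4 _ _ _ _ _ _ _ _ (ramp_lip x h) (ramp_lip (x - 1) h)
    (ramp_lip (x - 2) h) (ramp_lip (x - 3) h).
  rewrite (_ : step2 (x + h) - step2 x = ramp (x + h) - ramp x - 3 * (ramp (x - 1 + h) - ramp (x - 1))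
    + 3 * (ramp (x - 2 + h) - ramp (x - 2)) - (ramp (x - 3 + h) - ramp (x - 3))).
    by rewrite (le_trans T)//; lra.
  by rewrite /step2 ![x + h - _]addrAC; ring.
split => //.
- by move=> x; have [/andP[a b] _ _] := step_bounds x; rewrite ger0_norm//; lra.
- by move=> x; have [_ a _] := step_bounds x; lra.
- by move=> x; have [_ _ a] := step_bounds x; lra.
move=> x h; have [h1|h1] := leP 1 `|h|.
  rewrite mulr1; have h2 : `|h| <= h ^+ 2 by rewrite -real_normK ?num_real// expr2 ler_peMr.
  have [/andP[a b] b1 b2] := step_bounds x; have [/andP[c e] _ _] := step_bounds (x + h).
  have k1 : `|h * step1 x| <= h ^+ 2.
    by rewrite normrM (le_trans _ h2)// ler_piMr.
  have k2 : `|h ^+ 2 / 2 * step2 x| <= h ^+ 2.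
    rewrite normrM ger0_norm ?divr_ge0 ?sqr_ge0//.
    by have := ler_piMr (sqr_ge0 h) b2; have := sqr_ge0 h; lra.
  move: k1 k2; rewrite !ler_norml => /andP[? ?] /andP[? ?].
  by apply/andP; split; lra.
have T := tri4 _ _ _ _ _ _ _ _ (ramp3_taylor x h) (ramp3_taylor (x - 1) h)
    (ramp3_taylor (x - 2) h) (ramp3_taylor (x - 3) h).
have E : step (x + h) - step x - h * step1 x - h ^+ 2 / 2 * step2 x =
  (ramp (x + h) ^+ 3 - ramp x ^+ 3 - 3 * h * ramp x ^+ 2 - 3 * h ^+ 2 * ramp x -
   3 * (ramp (x - 1 + h) ^+ 3 - ramp (x - 1) ^+ 3 - 3 * h * ramp (x - 1) ^+ 2 - 3 * h ^+ 2 * ramp (x - 1)) +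
   3 * (ramp (x - 2 + h) ^+ 3 - ramp (x - 2) ^+ 3 - 3 * h * ramp (x - 2) ^+ 2 - 3 * h ^+ 2 * ramp (x - 2)) -
   (ramp (x - 3 + h) ^+ 3 - ramp (x - 3) ^+ 3 - 3 * h * ramp (x - 3) ^+ 2 - 3 * h ^+ 2 * ramp (x - 3))) / 6.
  by rewrite /step /step1 /step2 ![x + h - _]addrAC; field.
rewrite E normrM (ger0_norm (x := 6^-1)) ?invr_ge0//.
have -> : h ^+ 2 * `|h| = `|h| ^+ 3 by rewrite -real_normK ?num_real// exprS mulrC.
rewrite (le_trans (ler_wpM2r _ T))// ?invr_ge0//.
by have := exprn_ge0 3 (normr_ge0 h); lra.
Qed.

(** For b >= 1 all chain-rule factors are at most b^3, the third-order one. The truncated remainder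
    obeys the same factor because min(1, |b h|) <= b min(1, |h|). *)
Lemma step_scaled_smooth (a b : R) : 1 <= b ->
  smooth (8 * b ^+ 3) (fun x => step (b * x - a)) (fun x => b * step1 (b * x - a))
    (fun x => b ^+ 2 * step2 (b * x - a)).
Proof.
move=> b1; have b0 : 0 <= b by lra.
have bb : b <= b ^+ 2 by rewrite expr2 ler_peMr.
have bbb : b ^+ 2 <= b ^+ 3 by rewrite [leRHS]exprSr ler_peMr ?sqr_ge0.
have shift x h : b * (x + h) - a = b * x - a + b * h by ring.
split.
- move=> x; have [/andP[c e] _ _] := step_bounds (b * x - a).
  by rewrite ger0_norm//; lra.
- move=> x; have [_ c _] := step_bounds (b * x - a).
  by rewrite normrM ger0_norm//; have := ler_piMr b0 c; lra.
- move=> x; have [_ _ c] := step_bounds (b * x - a).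
  by rewrite normrM ger0_norm ?sqr_ge0//; have := ler_piMr (sqr_ge0 b) c; lra.
- move=> x h; rewrite -mulrBr normrM ger0_norm// shift.
  rewrite (le_trans (ler_wpM2l b0 (smooth_lip1 step_smooth _ _)))//.
  rewrite normrM (ger0_norm b0) !mulrA ler_wpM2r// (_ : b * 8 * b = 8 * b ^+ 2); last by ring.
  by lra.
- move=> x h; rewrite -mulrBr normrM (ger0_norm (sqr_ge0 b)) shift.
  rewrite (le_trans (ler_wpM2l (sqr_ge0 b) (smooth_lip2 step_smooth _ _)))//.
  by rewrite normrM (ger0_norm b0) le_eqVlt; apply/orP; left; apply/eqP; ring.
- move=> x h; rewrite shift.
  have := smooth_taylor step_smooth (b * x - a) (b * h).
  rewrite (_ : b * h * step1 _ = h * (b * step1 (b * x - a))); last by ring.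
  rewrite (_ : (b * h) ^+ 2 / 2 * _ = h ^+ 2 / 2 * (b ^+ 2 * step2 (b * x - a))); last by field.
  move=> /le_trans; apply.
  have m : Num.min 1 `|b * h| <= b * Num.min 1 `|h|.
    rewrite normrM (ger0_norm b0) minr_pMr// mulr1 le_min.
    by rewrite !ge_min lexx b1 orbT.
  rewrite exprMn (_ : 8 * b ^+ 3 * _ = 8 * (b ^+ 2 * h ^+ 2 * (b * Num.min 1 `|h|))); last by ring.
  by rewrite !ler_wpM2l// mulr_ge0// sqr_ge0.
Qed.

End smooth_functions.

(** * Regenerative cycles and the Lindeberg method *)

Section restriction.
Context d (T : measurableType d) (R : realType).
Variables (P : probability T R) (D : set T) (mD : measurable D).

(** A separate name for [mrestr], to carry the subprobability structure with which pushforwards and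
    products are formed below. *)
Definition prestr := mrestr P mD.

HB.instance Definition _ := Measure.on prestr.

Let prestr_le1 : (prestr [set: T] <= 1)%E.
Proof. by rewrite /prestr /mrestr probability_le1//; exact: measurableI. Qed.

HB.instance Definition _ := Measure_isSubProbability.Build _ _ _ prestr prestr_le1.

Lemma ge0_integral_prestr (f : T -> \bar R) :
  measurable_fun setT f -> (forall x, 0 <= f x)%E ->
  (\int[prestr]_x f x = \int[P]_(x in D) f x)%E.
Proof.
move=> mf f0; rewrite (@ge0_negligible_integral _ _ _ prestr setT (~` D))//=.
- rewrite setTD setCK; apply: eq_measure_integral => A mA AD.
  by rewrite /= /prestr /mrestr setIidl.
- exact: measurableC.
- by rewrite /prestr /mrestr setICl measure0.
Qed.

End restriction.

Section independence.
Context d d1 d2 (T : measurableType d) (T1 : measurableType d1) (T2 : measurableType d2)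
  (R : realType).
Variables (P Q : probability T R) (D : set T) (mD : measurable D).
Variables (X : T -> T1) (Y : T -> T2) (V : T -> T2).
Hypotheses (mX : measurable_fun setT X) (mY : measurable_fun setT Y)
  (mV : measurable_fun setT V).
Hypothesis XY : forall A B, measurable A -> measurable B ->
  (P (D `&` X @^-1` A `&` Y @^-1` B) = P (D `&` X @^-1` A) * Q (V @^-1` B))%E.

(** [XY] says that on rectangles the joint law of X and Y on D is that of X on D times the law of V
    under Q. Uniqueness of product measures extends this to all sets, and Tonelli splits the
    integral. *)
Lemma ge0_integral_indep (f : T1 * T2 -> \bar R) :
  measurable_fun setT f -> (forall z, 0 <= f z)%E ->
  (\int[P]_(w in D) f (X w, Y w) = \int[P]_(w in D) \int[Q]_v f (X w, V v))%E.
Proof.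
move=> mf f0.
pose phi w := (X w, Y w).
have mphi : measurable_fun setT phi by exact/measurable_fun_pairP.
pose m1 := giry_map mX (prestr P mD).
pose m2 := giry_map mV Q.
have mF : measurable_fun setT (fun x => \int[m2]_y f (x, y))%E.
  exact: measurable_fun_fubini_tonelli_F.
rewrite -(@ge0_integral_prestr _ _ _ P D mD (fun w => f (X w, Y w))); first last.
- by [].
- exact: (measurableT_comp mf mphi).
transitivity (\int[m1 \x m2]_z f z)%E.
  rewrite -[LHS](@ge0_integral_pushforward _ _ _ _ _ phi mphi (prestr P mD) setT f)//.
  apply: eq_measure_integral => A mA _; apply/esym.
  apply: (@product_measure_unique _ _ _ _ _ m1 m2) => // B C mB mC.
  rewrite /= /pushforward /prestr /mrestr /= [X in P X = _](_ : _ = D `&` X @^-1` B `&` Y @^-1` C).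
    by rewrite XY// [X @^-1` B `&` D]setIC.
  by apply/seteqP; split => [w [[? ?] ?]|w [[? ?] ?]].
rewrite fubini_tonelli1//.
rewrite [LHS](@ge0_integral_pushforward _ _ _ _ _ X mX (prestr P mD) setT (fun x => \int[m2]_y f (x, y))%E)//; last first.
  by move=> x _; exact: integral_ge0.
rewrite preimage_setT ge0_integral_prestr; first last.
- by move=> x; exact: integral_ge0.
- exact: (measurableT_comp mF mX).
apply: eq_integral => w _ /=.
rewrite [LHS](@ge0_integral_pushforward _ _ _ _ _ V mV Q setT (fun y => f (X w, y)))//.
by apply: measurableT_comp => //; exact: measurable_pair1.
Qed.

End independence.

(** * Conditioning on the first cycle *)

Section regeneration.
Context d (T : measurableType d) (R : realType) (I : finType).
Variables (Pr : I -> probability T R) (E : I -> set T) (theta : T -> T) (Z : T -> R).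
Hypotheses (mE : forall i, measurable (E i)) (mtheta : measurable_fun setT theta)
  (mZ : measurable_fun setT Z).
Hypothesis Edisj : forall i j w, E i w -> E j w -> i = j.

(* Under [P] the cycle [Z] and the future [theta] are conditionally independent
   given the state [i] in which the next cycle starts, whose law is then [Pr i]. *)
Definition regenerative (P : probability T R) : Prop :=
  P (\bigcup_(i in [set: I]) E i) = 1%E /\
  forall i A B, measurable A -> measurable B ->
    (P (E i `&` Z @^-1` A `&` theta @^-1` B) = P (E i `&` Z @^-1` A) * Pr i B)%E.

(** The recursion splits off the first cycle, which is where regeneration applies. *)
Fixpoint cycle_sum (n : nat) (w : T) : R :=
  if n is n'.+1 then Z w + cycle_sum n' (theta w) else 0.

Lemma measurable_cycle_sum n : measurable_fun setT (cycle_sum n).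
Proof.
elim: n => [|n IH]; first exact: measurable_cst.
by apply: measurable_funD => //; exact: measurableT_comp.
Qed.

Lemma measurable_bounded_indicM i (f : T -> R) : measurable_fun setT f ->
  measurable_fun setT (fun w => \1_(E i) w * f w).
Proof. by move=> mf; apply: measurable_funM => //; exact: measurable_indic. Qed.

Lemma indicM_le i (f : T -> R) (M : R) : (forall w, `|f w| <= M) ->
  forall w, `|\1_(E i) w * f w| <= M.
Proof.
move=> fM w; rewrite indicE; case: (w \in E i); rewrite ?mul1r// mul0r normr0.
exact: le_trans (fM w).
Qed.

Lemma Rintegral_partition (P : probability T R) (f : T -> R) (M : R) :
  regenerative P -> measurable_fun setT f -> (forall w, `|f w| <= M) ->
  \int[P]_(w in [set: T]) f w = \sum_(i : I) \int[P]_(w in [set: T]) (\1_(E i) w * f w).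
Proof.
move=> [PE _] mf fM.
have mfi i := measurable_bounded_indicM i mf.
have ifi i := integrable_bounded P (mfi i) (@indicM_le i _ _ fM).
rewrite -Rintegral_sum_fin//.
congr fine; apply: ae_eq_integral => //.
- exact/measurable_EFinP.
- by apply/measurable_EFinP; apply: measurable_sum.
have mU : measurable (\bigcup_(i in [set: I]) E i).
  by apply: fin_bigcup_measurable.
exists (~` \bigcup_(i in [set: I]) E i); split.
- exact: measurableC.
- by have := probability_setC P mU; rewrite PE subee.
- move=> w /= H [i _ Ei]; apply: H => _; congr EFin.
  rewrite (bigD1 i)//= indicE mem_set// mul1r big1 ?addr0// => j ji.
  rewrite indicE memNset ?mul0r// => Ej.
  by move: ji; rewrite (Edisj Ei Ej) eqxx.
Qed.

(** Conditional independence of cycle and future in integrated form. Positivity gives Tonelli; the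
    bound M keeps the inner integral finite, since [Rintegral] would turn +oo into 0. *)
Lemma regenerative_ge0_integral (P : probability T R) (V : T -> R) i (f : R * R -> R) (M : R) :
  regenerative P -> measurable_fun setT V -> measurable_fun setT f ->
  (forall z, 0 <= f z <= M) ->
  \int[P]_(w in [set: T]) (\1_(E i) w * f (Z w, V (theta w))) =
  \int[P]_(w in [set: T]) (\1_(E i) w * \int[Pr i]_(v in [set: T]) f (Z w, V v)).
Proof.
move=> [_ PM] mV mf f0; congr fine.
have mEf : measurable_fun setT (EFin \o f) by exact/measurable_EFinP.
have XY A B : measurable A -> measurable B ->
  (P (E i `&` Z @^-1` A `&` (V \o theta) @^-1` B) = P (E i `&` Z @^-1` A) * Pr i (V @^-1` B))%E.
  by move=> mA mB; rewrite -PM// -[_ @^-1` B]setTI; exact: mV.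
have mVt : measurable_fun setT (V \o theta) by exact: measurableT_comp.
have := ge0_integral_indep (mE i) mZ mVt mV XY mEf.
move=> /(_ (fun z => _)) H; have {}H := H (fun z => ltac:(by have /andP[] := f0 z)).
transitivity (\int[P]_(w in E i) (EFin \o f) (Z w, (V \o theta) w))%E.
  rewrite [RHS]integral_mkcond; apply: eq_integral => w _.
  by rewrite patchE indicE; case: (w \in E i); rewrite ?mul1r ?mul0r.
rewrite H [LHS]integral_mkcond; apply: eq_integral => w _.
rewrite patchE indicE; case: (w \in E i); rewrite ?mul1r ?mul0r//=.
apply: Rintegral_fin; apply: (@integrable_bounded _ _ _ _ _ M) => [|v].
  by apply: (measurableT_comp mf); apply: measurableT_comp => //; exact: measurable_pair1.
by have /andP[a b] := f0 (Z w, V v); rewrite ger0_norm.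
Qed.

End regeneration.

(** * Gaussian averages as a semigroup *)

Section gaussian_semigroup.
Context {R : realType}.
Local Notation N := (normal_prob (0 : R) 1).
Implicit Types (u v : R -> R) (s h C M K x y z : R) (n : nat).

Definition gauss_avg (h : R) (u : R -> R) (y : R) : R :=
  \int[N]_(z in [set: R]) u (y + h * z).

Let mh (h : R) : measurable_fun setT (fun z : R => h * z).
Proof. exact: measurable_funM. Qed.

Lemma gauss_avg_smooth h C u u1 u2 : smooth C u u1 u2 ->
  smooth C (gauss_avg h u) (gauss_avg h u1) (gauss_avg h u2).
Proof. exact: (smooth_average N (mh h)). Qed.

Lemma iter_gauss_avg_smooth h C n u u1 u2 : smooth C u u1 u2 ->
  smooth C (iter n (gauss_avg h) u) (iter n (gauss_avg h) u1) (iter n (gauss_avg h) u2).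
Proof. by move=> su; elim: n => //= n IH; exact: gauss_avg_smooth. Qed.

Lemma gauss_avg0 u y : gauss_avg 0 u y = u y.
Proof.
rewrite /gauss_avg; under eq_Rintegral do rewrite mul0r addr0.
exact: Rintegral_probability_cst.
Qed.

Lemma iter_gauss_avgE h C n u y : 0 <= h -> continuous u -> (forall x, 0 <= u x <= C) ->
  iter n (gauss_avg h) u y = gauss_avg (h * Num.sqrt n%:R) u y.
Proof.
move=> h0 cu uC; have u0 x : 0 <= u x by have /andP[] := uC x.
have uC' x : `|u x| <= C by have /andP[? ?] := uC x; rewrite ger0_norm.
elim: n y => [|n IH] y; first by rewrite sqrtr0 mulr0 gauss_avg0.
rewrite iterS; have -> : iter n (gauss_avg h) u = gauss_avg (h * Num.sqrt n%:R) u.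
  by apply/funext.
(* The convolution identity needs positive deviations, so h = 0 and n = 0 are treated apart. *)
have [->|hn0] := eqVneq h 0.
  by rewrite !mul0r !gauss_avg0.
case: n {IH} => [|n].
  rewrite sqrtr0 mulr0 sqrtr1 mulr1 (_ : gauss_avg 0 u = u)//.
  by apply/funext => x; rewrite gauss_avg0.
have hp : 0 < h by rewrite lt_neqAle eq_sym hn0.
have sp : 0 < h * Num.sqrt n.+1%:R by rewrite mulr_gt0// sqrtr_gt0 ltr0n.
have := normal_convolution y hp sp cu u0.
rewrite exprMn sqr_sqrtr// (_ : h ^+ 2 + _ = h ^+ 2 * n.+2%:R); last first.
  by rewrite -[in RHS]natr1; ring.
rewrite sqrtrM ?sqr_ge0// sqrtr_sqr (ger0_norm h0).
move=> /(congr1 fine); rewrite /gauss_avg /Rintegral => <-; congr fine.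
apply: eq_integral => x _.
rewrite -/(Rintegral _ _ _) -Rintegral_fin//.
exact: (integrable_translate N (mh _) _ cu uC').
Qed.

End gaussian_semigroup.

(** * Replacing cycles by Gaussian steps *)

Section lindeberg.
Context d (T : measurableType d) (R : realType) (I : finType).
Variables (Pr : I -> probability T R) (E : I -> set T) (theta : T -> T) (Z : T -> R).
Hypotheses (mE : forall i, measurable (E i)) (mtheta : measurable_fun setT theta)
  (mZ : measurable_fun setT Z).
Hypothesis Edisj : forall i j w, E i w -> E j w -> i = j.
Hypothesis PrE : forall i, regenerative Pr E theta Z (Pr i).
Hypothesis Z2 : forall i, (Pr i).-integrable setT (EFin \o (fun w => Z w ^+ 2)).
Hypothesis EZ : forall i, \int[Pr i]_(w in [set: T]) Z w = 0.
Variables (g : I -> R) (sigma : R).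
Hypothesis sigma_ge0 : 0 <= sigma.
Local Notation N := (normal_prob (0 : R) 1).
Implicit Types (u v : R -> R) (s h C M K x y z : R) (n : nat).

Definition cycle_law (P : probability T R) j : R := \int[P]_(w in [set: T]) \1_(E j) w.

Definition cycle_trans i j : R := cycle_law (Pr i) j.

Hypothesis poisson : forall i, g i - \sum_j cycle_trans i j * g j =
  \int[Pr i]_(w in [set: T]) (Z w ^+ 2) - sigma ^+ 2.

(** [W j x] is the expected outcome when the next cycle starts in state j with accumulated sum x. *)
Definition cycle_avg (P : probability T R) (s : R) (W : I -> R -> R) (y : R) : R :=
  \sum_j \int[P]_(w in [set: T]) (\1_(E j) w * W j (y + s * Z w)).

Definition cycle_op (s : R) (W : I -> R -> R) (i : I) (y : R) : R :=
  cycle_avg (Pr i) s W y.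

Let msZ s y : measurable_fun setT (fun w => y + s * Z w).
Proof. by apply: measurable_funD => //; exact: measurable_funM. Qed.

Let mcont s y (u : R -> R) : continuous u -> measurable_fun setT (fun w => u (y + s * Z w)).
Proof. by move=> cu; apply: measurableT_comp => //; exact: continuous_measurable_fun. Qed.

Let icont s y (u : R -> R) j (P : probability T R) M : continuous u -> (forall x, `|u x| <= M) ->
  P.-integrable setT (EFin \o (fun w => \1_(E j) w * u (y + s * Z w))).
Proof.
move=> cu uM; apply: (@integrable_bounded _ _ _ _ _ M).
  by apply: measurable_bounded_indicM => //; exact: mcont.
by apply: indicM_le => w; exact: uM.
Qed.

Lemma cycle_law_sum (P : probability T R) : regenerative Pr E theta Z P ->
  \sum_j cycle_law P j = 1.
Proof.
move=> PP; rewrite -[RHS](Rintegral_probability_cst P).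
rewrite (Rintegral_partition mE Edisj PP (M := 1))//; last by move=> w; rewrite normr1.
by apply: eq_bigr => j _; apply: eq_Rintegral => w _; rewrite mulr1.
Qed.

Lemma integrable_indic_cycle (P : probability T R) j :
  P.-integrable setT (EFin \o (\1_(E j) : T -> R)).
Proof.
apply: (@integrable_bounded _ _ _ _ _ 1); first exact: measurable_indic.
by move=> w; rewrite indicE; case: (_ \in _); rewrite ?normr1 ?normr0.
Qed.

(** Qualitative regularity: it secures measurability and integrability along the iteration, while
    the size of errors is tracked by uniform distances. *)
Definition lip_bounded (M K : R) (W : I -> R -> R) := forall j,
  (forall y, `|W j y| <= M) /\ (forall y h, `|W j (y + h) - W j y| <= K * `|h|).

Lemma lip_bounded_cont M K W j : lip_bounded M K W -> continuous (W j).
Proof. by move=> /(_ j)[_]; exact: lipschitz_continuous. Qed.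

(** The weights [cycle_law P j] sum to 1, so the averaging is a contraction for the uniform
    distance. *)
Lemma cycle_avg_dist (P : probability T R) s M K M' K' W W' (e : R) y :
  regenerative Pr E theta Z P ->
  lip_bounded M K W -> lip_bounded M' K' W' ->
  (forall j x, `|W j x - W' j x| <= e) ->
  `|cycle_avg P s W y - cycle_avg P s W' y| <= e.
Proof.
move=> PP bW bW' We; rewrite /cycle_avg -sumrB.
have iW j := icont s y j P (lip_bounded_cont (j := j) bW) (proj1 (bW j)).
have iW' j := icont s y j P (lip_bounded_cont (j := j) bW') (proj1 (bW' j)).
rewrite -[leRHS]mul1r -(cycle_law_sum PP) mulr_suml.
rewrite (le_trans (ler_norm_sum _ _ _))//; apply: ler_sum => j _.
rewrite -RintegralB// /cycle_law mulrC -RintegralZl//; last exact: integrable_indic_cycle.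
apply: norm_Rintegral_le; last exact: integrableZl_fin (integrable_indic_cycle _ _).
- apply: measurable_funB; apply: measurable_bounded_indicM => //; apply: mcont.
    exact: lip_bounded_cont bW.
  exact: lip_bounded_cont bW'.
- move=> w; rewrite -mulrBr normrM mulrC [`|\1_(E j) w|]ger0_norm; last by rewrite indicE.
  by rewrite ler_wpM2r// indicE.
Qed.

Lemma cycle_op_dist s M K M' K' W W' (e : R) i y :
  lip_bounded M K W -> lip_bounded M' K' W' ->
  (forall j x, `|W j x - W' j x| <= e) ->
  `|cycle_op s W i y - cycle_op s W' i y| <= e.
Proof. exact: cycle_avg_dist. Qed.

(** Both bounds are instances of the contraction property: W is compared with 0, then its translate
    by h with W. *)
Lemma cycle_op_lip_bounded s M K W : lip_bounded M K W -> lip_bounded M K (cycle_op s W).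
Proof.
move=> bW i.
have b0 (e : R) : lip_bounded 0 0 (fun (_ : I) (_ : R) => 0 : R).
  by move=> j; split => *; rewrite ?subrr normr0 ?mul0r.
have c0 y : cycle_op s (fun=> fun=> 0) i y = 0.
  rewrite /cycle_op /cycle_avg big1// => j _; under eq_Rintegral do rewrite mulr0.
  exact: Rintegral_probability_cst.
split=> [y|y h].
  rewrite -[cycle_op _ _ _ _]subr0 -(c0 y).
  by apply: (cycle_op_dist _ _ _ bW (b0 0)) => j x; rewrite subr0; have [] := bW j.
have bWh : lip_bounded M K (fun j y => W j (y + h)).
  move=> j; split=> [x|x k]; first by have [] := bW j.
  by rewrite addrAC; have [_] := bW j; exact.
have -> : cycle_op s W i (y + h) = cycle_op s (fun j x => W j (x + h)) i y.
  by apply: eq_bigr => j _; apply: eq_Rintegral => w _; rewrite addrAC.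
by apply: (cycle_op_dist _ _ _ bWh bW) => j x; have [_] := bW j; exact.
Qed.

Lemma iter_cycle_op_lip_bounded s M K W n :
  lip_bounded M K W -> lip_bounded M K (iter n (cycle_op s) W).
Proof. by move=> bW; elim: n => //= n; exact: cycle_op_lip_bounded. Qed.

Lemma iter_cycle_op_dist s M K M' K' W W' (e : R) n i y :
  lip_bounded M K W -> lip_bounded M' K' W' ->
  (forall j x, `|W j x - W' j x| <= e) ->
  `|iter n (cycle_op s) W i y - iter n (cycle_op s) W' i y| <= e.
Proof.
move=> bW bW' We; elim: n i y => [|n IH] i y /=; first exact: We.
by apply: cycle_op_dist IH; exact: iter_cycle_op_lip_bounded.
Qed.

(* The Poisson-equation corrector makes the second-order term of [cycle_op]
   independent of the state. *)
Definition corrected (s : R) (u u2 : R -> R) (i : I) (y : R) : R :=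
  u y + s ^+ 2 / 2 * (g i * u2 y).

Definition gnorm : R := \sum_j `|g j|.

Lemma gnorm_ge i : `|g i| <= gnorm.
Proof. by rewrite /gnorm (bigD1 i)//= lerDl sumr_ge0. Qed.

Lemma corrected_lip_bounded s C u u1 u2 : smooth C u u1 u2 ->
  exists M K, lip_bounded M K (corrected s u u2).
Proof.
move=> su; have C0 := smooth_C_ge0 su.
exists (C + s ^+ 2 / 2 * (gnorm * C)), (3 * C + s ^+ 2 / 2 * (gnorm * C)) => i; split.
- move=> y; rewrite (le_trans (ler_normD _ _))// lerD ?(smooth_le0 su)//.
  rewrite normrM ger0_norm ?divr_ge0 ?sqr_ge0// ler_wpM2l ?divr_ge0 ?sqr_ge0//.
  by rewrite normrM ler_pM ?gnorm_ge ?(smooth_le2 su).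
- move=> y h; rewrite /corrected opprD addrACA -mulrBr -mulrBr.
  rewrite (le_trans (ler_normD _ _))// [leRHS]mulrDl lerD ?(smooth_lip0 su)//.
  rewrite normrM ger0_norm ?divr_ge0 ?sqr_ge0// -mulrA ler_wpM2l ?divr_ge0 ?sqr_ge0//.
  by rewrite normrM -mulrA ler_pM ?gnorm_ge ?(smooth_lip2 su).
Qed.

Lemma smooth_lip_bounded C u u1 u2 : smooth C u u1 u2 -> lip_bounded C (3 * C) (fun=> u).
Proof. by move=> su j; split; [exact: smooth_le0 su|exact: smooth_lip0 su]. Qed.

Definition mabs (i : I) := \int[Pr i]_(w in [set: T]) `|Z w|.
Definition mabsN := \int[N]_(z in [set: R]) `|sigma * z|.

(** The error of one replacement in state i, divided by C s^2: the Taylor remainders of the cycle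
    and of the Gaussian step, then the variation of [u2] inside the corrector. *)
Definition modulus1 (s : R) (i : I) : R :=
  trunc2 (Pr i) Z s + trunc2 N (fun z => sigma * z) s + s / 2 * (gnorm * (mabs i + mabsN)).

Definition modulus (s : R) : R := \sum_i modulus1 s i.

Let mN : measurable_fun setT (fun z : R => sigma * z).
Proof. exact: measurable_funM. Qed.

Let N2 : N.-integrable setT (EFin \o (fun z => (sigma * z) ^+ 2)).
Proof.
under eq_fun do rewrite exprMn.
exact: integrableZl_fin integrable_sqr_normal.
Qed.

Let trunc2_ge0 d' (T' : measurableType d') (P : probability T' R) (Y : T' -> R) s :
  0 <= s -> 0 <= trunc2 P Y s.
Proof.
move=> s0; apply: Rintegral_ge0 => w _.
by rewrite mulr_ge0 ?sqr_ge0// le_min ler01 mulr_ge0.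
Qed.

Let mabs_ge0 i : 0 <= mabs i. Proof. exact: Rintegral_ge0. Qed.
Let mabsN_ge0 : 0 <= mabsN. Proof. exact: Rintegral_ge0. Qed.
Let gnorm_ge0 : 0 <= gnorm. Proof. exact: sumr_ge0. Qed.

Lemma modulus1_ge0 s i : 0 <= s -> 0 <= modulus1 s i.
Proof. by move=> s0; rewrite !addr_ge0 ?trunc2_ge0// mulr_ge0 ?divr_ge0// mulr_ge0// addr_ge0. Qed.

Lemma modulus1_le s i : 0 <= s -> modulus1 s i <= modulus s.
Proof.
move=> s0; rewrite /modulus (bigD1 i)//= lerDl sumr_ge0// => j _; exact: modulus1_ge0.
Qed.

Lemma modulus_cvg0 (s_ : nat -> R) : (forall n, 0 <= s_ n) -> s_ @ \oo --> 0 ->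
  (fun n => modulus (s_ n)) @ \oo --> 0.
Proof.
move=> s0 sc; rewrite /modulus -[X in _ --> X](_ : \sum_(i : I) 0 = 0); last by rewrite big1.
apply: cvg_sumR => i; rewrite /modulus1 -[X in _ --> X](_ : 0 + 0 + 0 / 2 * (gnorm * (mabs i + mabsN)) = 0); last first.
  by rewrite mul0r mul0r !addr0.
apply: cvgD; first by apply: cvgD; apply: trunc2_cvg0.
by apply: cvgMr_tmp; apply: cvgMr_tmp.
Qed.

Lemma gauss_avg_expansion C u u1 u2 s y : smooth C u u1 u2 -> 0 <= s ->
  `|gauss_avg (s * sigma) u y - u y - s ^+ 2 / 2 * u2 y * sigma ^+ 2|
    <= s ^+ 2 * (C * trunc2 N (fun z => sigma * z) s).
Proof.
move=> su s0; have := smooth_expansion (P := N) mN N2 y su s0.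
rewrite RintegralZl ?Rintegral_id_normal ?mulr0//; last exact: integrable_id_normal.
move=> /(_ erefl).
have -> : \int[N]_(w in [set: R]) ((sigma * w) ^+ 2) = sigma ^+ 2.
  under eq_Rintegral do rewrite exprMn.
  rewrite RintegralZl//; last exact: integrable_sqr_normal.
  by rewrite /Rintegral integral_sqr_normal /= mulr1.
have -> : gauss_avg (s * sigma) u y = \int[N]_(z in [set: R]) u (y + s * (sigma * z)).
  by apply: eq_Rintegral => z _; rewrite mulrA.
by [].
Qed.

Lemma gauss_avg_dist C u u1 u2 s y : smooth C u u1 u2 -> 0 <= s ->
  `|gauss_avg (s * sigma) u2 y - u2 y| <= C * s * mabsN.
Proof.
move=> su s0; have c2 := smooth_continuous2 su.
have iN := integrable_sqrW (P := N) mN N2.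
have iNa : N.-integrable setT (EFin \o (fun z => `|sigma * z|)) by exact: integrable_abse iN.
rewrite -[u2 y in X in `|X|](Rintegral_probability_cst N) /gauss_avg.
have mt : measurable_fun [set: R] (fun z => u2 (y + s * sigma * z)).
  by apply: (measurable_translate _ y c2); exact: measurable_funM.
rewrite -RintegralB//; first last.
- exact: integrable_cst_fin.
- by apply: (@integrable_bounded _ _ _ _ _ C) => // z; exact: smooth_le2 su _.
rewrite /mabsN -RintegralZl//.
apply: norm_Rintegral_le; [exact: measurable_funB| |exact: integrableZl_fin].
move=> z; rewrite (le_trans (smooth_lip2 su _ _))// -mulrA normrM (ger0_norm s0).
by rewrite mulrA.
Qed.

(** Up to the factor (s^2/2) [u2] y, the second-order term is E_i(Z^2) + sum_j Q_ij g_j for the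
    cycle and sigma^2 + g_i for the Gaussian step. The Poisson equation equates them. *)
Lemma cycle_op_corrected C u u1 u2 s i y : smooth C u u1 u2 -> 0 <= s ->
  `|cycle_op s (corrected s u u2) i y -
    corrected s (gauss_avg (s * sigma) u) (gauss_avg (s * sigma) u2) i y|
  <= s ^+ 2 * (C * modulus s).
Proof.
move=> su s0; have C0 := smooth_C_ge0 su.
have c0 := smooth_continuous0 su; have c2 := smooth_continuous2 su.
have iZ := integrable_sqrW mZ (Z2 i).
have iZa : (Pr i).-integrable setT (EFin \o (fun w => `|Z w|)) by exact: integrable_abse iZ.
have i0 j := icont s y j (Pr i) c0 (smooth_le0 su).
have i2 j := icont s y j (Pr i) c2 (smooth_le2 su).
pose B j := \int[Pr i]_(w in [set: T]) (\1_(E j) w * u2 (y + s * Z w)).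
have opE : cycle_op s (corrected s u u2) i y =
    \int[Pr i]_(w in [set: T]) u (y + s * Z w) + s ^+ 2 / 2 * \sum_j g j * B j.
  rewrite (Rintegral_partition mE Edisj (PrE i) (mcont s y c0) (fun w => smooth_le0 su _)).
  rewrite mulr_sumr -big_split /=; apply: eq_bigr => j _.
  rewrite /B -RintegralZl// -RintegralZl//; last exact: integrableZl_fin.
  rewrite -RintegralD//; last by do 2 apply: integrableZl_fin.
  by apply: eq_Rintegral => w _; rewrite /corrected; ring.
have HA := smooth_expansion mZ (Z2 i) y su s0 (EZ i).
have HC := gauss_avg_expansion y su s0.
have HD := gauss_avg_dist y su s0.
(* Freezing the Lipschitz function [u2] at y costs at most C s |Z| inside the integral. *)
have HB j : `|B j - cycle_trans i j * u2 y| <= C * s * mabs i.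
  rewrite /B /cycle_trans mulrC -RintegralZl//; last exact: integrable_indic_cycle.
  have iu := integrableZl_fin (u2 y) (integrable_indic_cycle (Pr i) j).
  rewrite -RintegralB//.
  rewrite /mabs -RintegralZl//.
  apply: norm_Rintegral_le; last exact: integrableZl_fin.
    apply: measurable_funB; first by apply: measurable_bounded_indicM => //; exact: mcont.
    by apply: measurable_funM => //; exact: measurable_indic.
  move=> w; rewrite [u2 y * _]mulrC -mulrBr normrM -[leRHS]mul1r ler_pM//.
    by rewrite indicE; case: (_ \in _); rewrite ?normr1 ?normr0.
  rewrite (le_trans (smooth_lip2 su _ _))// normrM (ger0_norm s0).
  by rewrite mulrA.
move: HA HC HD; rewrite opE /corrected.
set A := \int[Pr i]_w u _; set c := \int[Pr i]_w (Z w ^+ 2).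
set V := gauss_avg _ u y; set V2 := gauss_avg _ u2 y.
move=> HA HC HD.
have P := poisson i; rewrite -/c in P.
have -> : A + s ^+ 2 / 2 * \sum_j g j * B j - (V + s ^+ 2 / 2 * (g i * V2)) =
  (A - u y - s ^+ 2 / 2 * u2 y * c) - (V - u y - s ^+ 2 / 2 * u2 y * sigma ^+ 2)
  + s ^+ 2 / 2 * (\sum_j g j * (B j - cycle_trans i j * u2 y) - g i * (V2 - u2 y)).
  have -> : \sum_j g j * (B j - cycle_trans i j * u2 y) =
     \sum_j g j * B j - (\sum_j cycle_trans i j * g j) * u2 y.
    rewrite mulr_suml -sumrB; apply: eq_bigr => j _; ring.
  have -> : c = g i - \sum_j cycle_trans i j * g j + sigma ^+ 2 by rewrite P subrK.
  by field.
have HE : `|\sum_j g j * (B j - cycle_trans i j * u2 y)| <= gnorm * (C * s * mabs i).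
  rewrite (le_trans (ler_norm_sum _ _ _))// /gnorm mulr_suml; apply: ler_sum => j _.
  by rewrite normrM ler_wpM2l.
have HF : `|g i * (V2 - u2 y)| <= gnorm * (C * s * mabsN).
  by rewrite normrM ler_pM// gnorm_ge.
have m1 := modulus1_le i s0.
apply: (@le_trans _ _ (s ^+ 2 * (C * modulus1 s i))); last first.
  by rewrite ler_wpM2l ?sqr_ge0// ler_wpM2l.
rewrite (le_trans (ler_normD _ _))// (le_trans (lerD (ler_normB _ _) (lexx _)))//.
rewrite normrM (ger0_norm (x := s ^+ 2 / 2)) ?divr_ge0 ?sqr_ge0//.
have HG : s ^+ 2 / 2 * `|\sum_j g j * (B j - cycle_trans i j * u2 y) - g i * (V2 - u2 y)| <=
    s ^+ 2 / 2 * (gnorm * (C * s * mabs i) + gnorm * (C * s * mabsN)).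
  by rewrite ler_wpM2l ?divr_ge0 ?sqr_ge0// (le_trans (ler_normB _ _))// lerD.
rewrite (le_trans (lerD (lerD HA HC) HG))// le_eqVlt; apply/orP; left; apply/eqP.
by rewrite /modulus1; field.
Qed.

(** Errors add without amplification: [cycle_op] is a contraction, and Gaussian averaging keeps the
    constant C. *)
Lemma iter_cycle_op_corrected C u u1 u2 s n i y : smooth C u u1 u2 -> 0 <= s ->
  `|iter n (cycle_op s) (corrected s u u2) i y -
    corrected s (iter n (gauss_avg (s * sigma)) u) (iter n (gauss_avg (s * sigma)) u2) i y|
  <= n%:R * (s ^+ 2 * (C * modulus s)).
Proof.
move=> su s0; elim: n i y => [|n IH] i y.
  by rewrite /= subrr normr0 mul0r.
have sn := iter_gauss_avg_smooth (s * sigma) n su.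
have [M [K bW]] := corrected_lip_bounded s su.
have [M' [K' bW']] := corrected_lip_bounded s sn.
have D1 := cycle_op_dist s i y (iter_cycle_op_lip_bounded s n bW) bW' IH.
have D2 := cycle_op_corrected i y sn s0.
rewrite !iterS -natr1 mulrDl mul1r.
by rewrite -[X in `|X|](subrKA (cycle_op s (corrected s (iter n (gauss_avg (s * sigma)) u)
  (iter n (gauss_avg (s * sigma)) u2)) i y)) (le_trans (ler_normD _ _))// lerD.
Qed.

(** The corrector is inserted before the n replacements and removed after them, each time at a cost
    of (s^2/2) [gnorm] C. *)
Lemma iter_cycle_op_smooth C u u1 u2 s n i y : smooth C u u1 u2 -> 0 <= s ->
  `|iter n (cycle_op s) (fun=> u) i y - iter n (gauss_avg (s * sigma)) u y|
  <= n%:R * (s ^+ 2 * (C * modulus s)) + s ^+ 2 * (gnorm * C).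
Proof.
move=> su s0; have [M [K bW]] := corrected_lip_bounded s su.
have sn := iter_gauss_avg_smooth (s * sigma) n su.
have cd (v v1 v2 : R -> R) j x : smooth C v v1 v2 ->
    `|v x - corrected s v v2 j x| <= s ^+ 2 / 2 * (gnorm * C).
  move=> sv; rewrite /corrected opprD addNKr normrN.
  rewrite normrM ger0_norm ?divr_ge0 ?sqr_ge0// ler_wpM2l ?divr_ge0 ?sqr_ge0//.
  by rewrite normrM ler_pM ?gnorm_ge ?(smooth_le2 sv).
have D1 := iter_cycle_op_dist s n i y (smooth_lip_bounded su) bW (fun j x => cd _ _ _ j x su).
have D2 := iter_cycle_op_corrected n i y su s0.
have D3 := cd _ _ _ i y sn.
move: D1 D2 D3.
set a := iter n _ _ i y; set b := iter n _ _ i y; set c := corrected _ _ _ _ _; set e := iter n _ u y.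
rewrite [`|e - c|]distrC => D1 D2 D3.
have -> : a - e = (a - b) + (b - c) + (c - e) by ring.
rewrite (le_trans (ler_normD _ _))// (le_trans (lerD (ler_normD _ _) (lexx _)))//.
by lra.
Qed.

Lemma measurable_cycle_sum_comp s u y n : continuous u ->
  measurable_fun setT (fun w => u (y + s * cycle_sum theta Z n w)).
Proof.
move=> cu; apply: measurableT_comp; first exact: continuous_measurable_fun.
apply: measurable_funD => //; apply: measurable_funM => //.
exact: measurable_cycle_sum.
Qed.

(** [P] is any regenerative law, as the first cycle may start outside the states of I; all later
    ones start in a state. *)
Lemma cycle_sum_step (P : probability T R) s u C n y :
  regenerative Pr E theta Z P -> continuous u -> (forall x, 0 <= u x <= C) ->
  \int[P]_(w in [set: T]) u (y + s * cycle_sum theta Z n.+1 w) =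
  cycle_avg P s (fun j x => \int[Pr j]_(w in [set: T]) u (x + s * cycle_sum theta Z n w)) y.
Proof.
move=> PP cu uC; have uC' x : `|u x| <= C by have /andP[? ?] := uC x; rewrite ger0_norm.
have mS := measurable_cycle_sum mtheta mZ.
pose f (z : R * R) := u (y + s * (z.1 + z.2)).
have mf : measurable_fun setT f.
  apply: measurableT_comp; first exact: continuous_measurable_fun.
  by apply: measurable_funD => //; apply: measurable_funM => //; exact: measurable_funD.
rewrite (Rintegral_partition mE Edisj PP (M := C)); first last.
- by move=> w; exact: uC'.
- exact: measurable_cycle_sum_comp.
apply: eq_bigr => j _.
rewrite (regenerative_ge0_integral mE mtheta mZ j PP (mS n) mf (M := C)); last by move=> z; exact: uC.
apply: eq_Rintegral => w _; congr (_ * _); apply: eq_Rintegral => v _.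
by rewrite /f /= mulrDr addrA.
Qed.

Lemma cycle_sum_cycle_op s u C n i y : continuous u -> (forall x, 0 <= u x <= C) ->
  \int[Pr i]_(w in [set: T]) u (y + s * cycle_sum theta Z n w) =
  iter n (cycle_op s) (fun=> u) i y.
Proof.
move=> cu uC; elim: n i y => [|n IH] i y.
  by rewrite /=; under eq_Rintegral do rewrite mulr0 addr0; exact: Rintegral_probability_cst.
rewrite (cycle_sum_step _ _ _ (PrE i) cu uC) iterS /cycle_op; congr (cycle_avg _ _ _ _).
by apply/funext => j; apply/funext => x; exact: IH.
Qed.

Lemma cvg_inv_sqrt : (fun n => (Num.sqrt n.+1%:R)^-1 : R) @ \oo --> (0 : R).
Proof.
have := @cvg_harmonic R; rewrite /harmonic => h.
have -> : (fun n => (Num.sqrt n.+1%:R)^-1 : R) = (fun n => Num.sqrt (harmonic n)).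
  by apply/funext => n; rewrite -sqrtrV ?ler0n.
by rewrite -[X in _ --> X]sqrtr0; apply: (cvg_comp _ _ h); exact: sqrt_continuous.
Qed.

(** Once the first of n + 1 cycles is split off, n Gaussian steps of size (n + 1)^(-1/2) remain. *)
Lemma cvg_ratio_sqrt : (fun n => (Num.sqrt n.+1%:R)^-1 * Num.sqrt n%:R : R) @ \oo --> (1 : R).
Proof.
have h := @cvg_harmonic R.
have h1 : (fun n => 1 - harmonic n : R) @ \oo --> (1 : R).
  by rewrite -[X in _ --> X]subr0; apply: cvgB => //; exact: cvg_cst.
have -> : (fun n => (Num.sqrt n.+1%:R)^-1 * Num.sqrt n%:R : R) = (fun n => Num.sqrt (1 - harmonic n)).
  apply/funext => n; rewrite -sqrtrV ?ler0n// -sqrtrM ?invr_ge0 ?ler0n//; congr Num.sqrt.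
  rewrite /harmonic /=; have n0 : n.+1%:R != 0 :> R by rewrite pnatr_eq0.
  by apply: (mulfI n0); rewrite mulrA mulfV// mul1r mulrBr mulr1 mulfV// -natr1 addrK.
by rewrite -[X in _ --> X]sqrtr1; apply: (cvg_comp _ _ h1); exact: sqrt_continuous.
Qed.

Theorem smooth_clt (P : probability T R) C u u1 u2 :
  regenerative Pr E theta Z P -> smooth C u u1 u2 -> (forall x, 0 <= u x <= C) ->
  (fun n => \int[P]_(w in [set: T]) u ((Num.sqrt n%:R)^-1 * cycle_sum theta Z n w)) @ \oo
    --> \int[N]_(z in [set: R]) u (sigma * z).
Proof.
(* The index moves to n + 1 so that there is a first cycle to split off. *)
move=> PP su uC; rewrite -(cvg_shiftS _).
have cu := smooth_continuous0 su; have C0 := smooth_C_ge0 su.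
pose s n : R := (Num.sqrt n.+1%:R)^-1.
have s0 n : 0 <= s n by rewrite invr_ge0 sqrtr_ge0.
have s_cvg : s @ \oo --> 0 by exact: cvg_inv_sqrt.
have s2 n : s n ^+ 2 = n.+1%:R^-1 by rewrite exprVn sqr_sqrtr// ler0n.
pose Phi n := gauss_avg (s n * sigma * Num.sqrt n%:R) u.
(* In [b] the first cycle is kept and the n later ones are already Gaussian. Contraction bounds the
   distance to the true mean by [e], whatever the law of Z under P. *)
pose b n := \int[P]_(w in [set: T]) Phi n (s n * Z w).
pose e n := C * modulus (s n) + s n ^+ 2 * (gnorm * C).
have sPhi n : smooth C (Phi n) _ _ := gauss_avg_smooth _ su.
apply: (@cvg_dist_squeeze _ _ b e).
- move=> n; pose F j x := \int[Pr j]_(w in [set: T]) u (x + s n * cycle_sum theta Z n w).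
  have FE : F = iter n (cycle_op (s n)) (fun=> u).
    by apply/funext => j; apply/funext => x; exact: cycle_sum_cycle_op.
  have lF : lip_bounded C (3 * C) F.
    by rewrite FE; apply: iter_cycle_op_lip_bounded; exact: smooth_lip_bounded su.
  have bE : b n = cycle_avg P (s n) (fun=> Phi n) 0.
    rewrite /b (Rintegral_partition mE Edisj PP (M := C)); first last.
    + by move=> w; exact: smooth_le0 (sPhi n) _.
    + apply: measurableT_comp; last exact: measurable_funM.
      by apply: continuous_measurable_fun; exact: smooth_continuous0 (sPhi n).
    by apply: eq_bigr => j _; apply: eq_Rintegral => w _; rewrite add0r.
  rewrite bE [X in X - _](_ : _ = cycle_avg P (s n) F 0); last first.
    rewrite /= -(cycle_sum_step _ _ _ PP cu uC).
    by apply: eq_Rintegral => w _; rewrite add0r.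
  apply: (cycle_avg_dist _ _ PP lF (smooth_lip_bounded (sPhi n))) => j x.
  rewrite FE /Phi -(iter_gauss_avgE n x _ cu uC) ?mulr_ge0//.
  apply: (le_trans (iter_cycle_op_smooth n j x su (s0 n))).
  rewrite lerD2r mulrA ler_piMl//.
    by rewrite mulr_ge0// sumr_ge0// => i _; exact: modulus1_ge0.
  by rewrite s2 ler_pdivrMr ?ltr0n// mul1r ler_nat.
- rewrite -[X in _ --> X](_ : C * 0 + 0 * 0 * (gnorm * C) = 0); last by rewrite mulr0 !mul0r addr0.
  apply: cvgD; first by apply: cvgM; [exact: cvg_cst|exact: modulus_cvg0].
  apply: cvgM; last exact: cvg_cst.
  by under eq_fun do rewrite expr2; exact: cvgM.
rewrite -(Rintegral_probability_cst P (\int[N]_(z in [set: R]) u (sigma * z))).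
apply: (@Rintegral_cvg_dominated _ _ _ _ _ _ (fun=> C)).
- move=> n; apply: measurableT_comp; last exact: measurable_funM.
  by apply: continuous_measurable_fun; exact: smooth_continuous0 (sPhi n).
- exact: measurable_cst.
- move=> w; rewrite /Phi /gauss_avg.
  apply: (@Rintegral_cvg_dominated _ _ _ N _ _ (fun=> C)).
  + move=> n; apply: (measurable_translate _ _ cu); exact: measurable_funM.
  + by apply: measurableT_comp; [exact: continuous_measurable_fun|exact: measurable_funM].
  + move=> z.
    have h : (fun n => s n * Z w + s n * sigma * Num.sqrt n%:R * z) @ \oo --> sigma * z.
      rewrite -[X in _ --> X](_ : 0 * Z w + 1 * (sigma * z) = sigma * z); last by rewrite mul0r add0r mul1r.
      apply: cvgD; first by apply: cvgM => //; exact: cvg_cst.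
      have -> : (fun n => s n * sigma * Num.sqrt n%:R * z) = (fun n => s n * Num.sqrt n%:R * (sigma * z)).
        by apply/funext => n; ring.
      by apply: cvgM; [exact: cvg_ratio_sqrt|exact: cvg_cst].
    exact: (cvg_comp _ _ h (cu _)).
  + exact: integrable_cst_fin.
  + by move=> n z; exact: smooth_le0 su _.
- exact: integrable_cst_fin.
- by move=> n w; exact: smooth_le0 (sPhi n) _.
Qed.

End lindeberg.

(** * From splines to bounded continuous functions *)

Section portmanteau.
Context {R : realType}.
Implicit Types (f : R -> R) (x y t a b e M K : R).

Lemma step_continuous a b : continuous (fun x => step (b * x - a)).
Proof.
have cs : continuous (@step R) := smooth_continuous0 step_smooth.
move=> x; apply: (@continuous_comp _ _ _ (fun x : R => b * x - a) step); last exact: cs.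
apply: (@continuousB R R R^o (fun x => b * x) (fun=> a)); last exact: cst_continuous.
exact: mulrl_continuous.
Qed.

(** These increments are the bumps of a spline partition of unity; only 1 < t < 3 needs a
    computation. *)
Lemma step_incr_ge0 t : 0 <= step t - step (t - 1).
Proof.
have [t0|t0] := leP t 0; first by rewrite !step_eq0// ?subrr//; lra.
have [t3|t3] := leP 3 t.
  by rewrite step_eq1//; have [/andP[_ h] _ _] := step_bounds (t - 1); lra.
have [t1|t1] := leP t 1.
  by rewrite (step_eq0 (x := t - 1)) ?subr0; [have [/andP[]] := step_bounds t|lra].
rewrite /step /ramp (@max_l _ _ t) ?(@max_l _ _ (t - 1))  ?(@max_r _ _ (t - 3)) ?(@max_r _ _ (t - 1 - 3))
  ?(@max_r _ _ (t - 1 - 2)); try lra.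
rewrite (_ : t - 1 - 1 = t - 2); last by ring.
rewrite !expr0n/= !mulr0 !subr0 !addr0.
have [t2|t2] := leP t 2.
  rewrite !(@max_r _ _ (t - 2)); try lra.
  rewrite expr0n/= !mulr0 !addr0 subr0 -mulrBl mulr_ge0//.
  have v0 : 0 <= t - 1 by lra.
  have v1 : t - 1 <= 1 by lra.
  rewrite (_ : t = t - 1 + 1); last by ring.
  set v := t - 1 in v0 v1 *.
  have -> : (v + 1) ^+ 3 - 3 * (v + 1 - 1) ^+ 3 - (v + 1 - 1) ^+ 3 =
    1 + 3 * v + 3 * (v ^+ 2 * (1 - v)) by ring.
  by rewrite !addr_ge0// !mulr_ge0 ?sqr_ge0//; lra.
rewrite !(@max_l _ _ (t - 2)); try lra.
rewrite -mulrBl mulr_ge0//.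
have v0 : 0 <= t - 2 by lra.
have v1 : t - 2 <= 1 by lra.
have -> : t ^+ 3 - 3 * (t - 1) ^+ 3 + 3 * (t - 2) ^+ 3 - ((t - 1) ^+ 3 - 3 * (t - 2) ^+ 3) =
  4 - 6 * (t - 2) ^+ 2 + 3 * (t - 2) ^+ 3 by ring.
have : (t - 2) ^+ 2 <= 1 by apply: exprn_ile1.
set v := t - 2 in v0 v1 *; rewrite !exprS !expr0 !mulr1; nra.
Qed.

Definition window b (L : nat) x : R := step (b * x + L%:R) - step (b * x - L%:R).

(** Quasi-interpolation of f at mesh 1/b. The bump at a node y is supported on [y, y + 4/b], and the
    bumps add up to [window b L]. Being a finite combination of scaled steps, it has integrals whose
    convergence is known. *)
Definition spline f b (L : nat) x : R :=
  \sum_(i < L + L) f ((i%:R - L%:R) / b) *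
    (step (b * x - (i%:R - L%:R)) - step (b * x - (i%:R - L%:R) - 1)).

Lemma windowE b L x : window b L x =
  \sum_(i < L + L) (step (b * x - (i%:R - L%:R)) - step (b * x - (i%:R - L%:R) - 1)).
Proof.
pose G (i : nat) := step (b * x - (i%:R - L%:R)).
rewrite (eq_bigr (fun i : 'I__ => G i - G i.+1)); last first.
  by move=> i _; rewrite /G -natr1; congr (_ - step _); ring.
rewrite -(big_mkord xpredT (fun i => G i - G i.+1)).
rewrite (@telescope_sumr_eq _ 0 (L + L) (fun i => - G i))//; last first.
  by move=> k _; rewrite opprK addrC.
by rewrite /window /G opprK natrD addrK sub0r opprK addrC.
Qed.

Lemma window_bounds b L x : 0 <= window b L x <= 1.
Proof.
apply/andP; split; first by rewrite windowE; apply: sumr_ge0 => i _; exact: step_incr_ge0.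
have [/andP[_ h] _ _] := step_bounds (b * x + L%:R).
by have [/andP[h' _] _ _] := step_bounds (b * x - L%:R); rewrite /window; lra.
Qed.

Lemma window_eq1 b L x : b * `|x| + 3 <= L%:R -> 0 <= b -> window b L x = 1.
Proof.
move=> h b0; have h1 : b * x <= b * `|x| by rewrite ler_wpM2l ?ler_norm.
have h2 : - (b * `|x|) <= b * x by rewrite -mulrN ler_wpM2l// lerNl ler_normr lexx orbT.
by rewrite /window step_eq1 ?step_eq0 ?subr0//; lra.
Qed.

(** The bumps miss the mass 1 - [window], where f is bounded by M; on the support of each bump f
    oscillates by at most e around its value at the node. *)
Lemma spline_dist f b L M e : 0 < b -> (forall x, `|f x| <= M) ->
  (forall x y, `|y| <= L%:R / b -> y <= x <= y + 4 / b -> `|f x - f y| <= e) ->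
  forall x, `|f x - spline f b L x| <= M * (1 - window b L x) + e.
Proof.
move=> b0 fM fe x.
have e0 : 0 <= e.
  have := fe 0 0; rewrite normr0 divr_ge0 ?ler0n ?(ltW b0)// => /(_ erefl).
  by rewrite lexx add0r divr_ge0 ?(ltW b0)//= => /(_ erefl); exact: le_trans.
have /andP[w0 w1] := window_bounds b L x.
have -> : f x - spline f b L x = f x * (1 - window b L x) +
  \sum_(i < L + L) (f x - f ((i%:R - L%:R) / b)) *
    (step (b * x - (i%:R - L%:R)) - step (b * x - (i%:R - L%:R) - 1)).
  rewrite mulrBr mulr1 -addrA; congr (_ + _).
  rewrite /spline windowE mulr_sumr -!sumrN -big_split /=; apply: eq_bigr => i _; ring.
rewrite (le_trans (ler_normD _ _))// lerD//.
  by rewrite normrM (ger0_norm (x := 1 - _)) ?subr_ge0// ler_wpM2r ?subr_ge0.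
rewrite (@le_trans _ _ (e * window b L x))//; last by rewrite ler_piMr.
rewrite windowE mulr_sumr (le_trans (ler_norm_sum _ _ _))//; apply: ler_sum => i _.
set j := i%:R - L%:R; have g0 := step_incr_ge0 (b * x - j).
rewrite normrM (ger0_norm g0).
have [h1|h1] := leP (b * x - j) 0.
  by rewrite !step_eq0 ?subrr ?mulr0//; lra.
have [h2|h2] := leP 4 (b * x - j).
  by rewrite !step_eq1 ?subrr ?mulr0//; lra.
rewrite ler_wpM2r// fe//.
  rewrite normrM (ger0_norm (x := b^-1)) ?invr_ge0 ?(ltW b0)// ler_wpM2r ?invr_ge0 ?(ltW b0)//.
  have := ltn_ord i; rewrite -(ltr_nat R) natrD => iL; have := ler0n R i.
  by rewrite /j ler_norml => i0; apply/andP; split; lra.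
rewrite ler_pdivrMr// mulrC -mulrDl ler_pdivlMr// mulrC.
by apply/andP; split; lra.
Qed.

(** Uniform continuity from compactness of [-K, K]; only y is confined to it, while x may pass K. *)
Lemma uniform_modulus f K e : continuous f -> 0 < e ->
  exists2 n : nat, (0 < n)%N & forall x y, `|y| <= K -> y <= x <= y + 4 / n%:R -> `|f x - f y| <= e.
Proof.
move=> cf e0.
have /compact_near_coveringP cK := @segment_compact R (- K) K.
pose Q (n : nat) (y : R) := forall x, y <= x <= y + 4 / n.+1%:R -> `|f x - f y| <= e.
have aux (u v x q r : R) : `|u - v| < r / 2 -> q < r / 2 -> v <= x -> x <= v + q -> `|u - x| < r.
  by rewrite !ltr_norml => /andP[? ?] ? ? ?; apply/andP; split; lra.
have : \forall n \near \oo, `[- K, K]%classic `<=` Q n.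
  apply: cK => y _.
  have e2 : 0 < e / 2 by rewrite divr_gt0.
  have /cvgrPdist_le/(_ _ e2)/nbhs_ballP[r /= r0 fr] := cf y.
  have r2 : 0 < r / 2 by rewrite divr_gt0.
  have nr : \forall n \near \oo, 4 / n.+1%:R < r / 2.
    near=> n; rewrite ltr_pdivrMr ?ltr0n// mulrC -ltr_pdivrMr//.
    rewrite (@lt_trans _ _ n%:R)// ?ltr_nat//.
    by near: n; exact: nbhs_infty_gtr.
  exists (ball y (r / 2), [set n | 4 / n.+1%:R < r / 2]).
    by split => //=; exact: nbhsx_ballx.
  move=> [y' n] [/= yy' nn] x /andP[x1 x2].
  rewrite /ball /= in yy'.
  have fx : `|f y - f x| <= e / 2.
    by apply: fr; exact: aux yy' nn x1 x2.
  have fy : `|f y - f y'| <= e / 2.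
    by apply: fr; rewrite /ball /= (lt_le_trans yy')//; lra.
  move: fx fy; rewrite !ler_norml => /andP[? ?] /andP[? ?].
  by apply/andP; split; lra.
move=> [n _ H]; exists n.+1 => // x y yK; apply: (H n) => //=.
by rewrite in_itv /= -ler_norml.
Unshelve. all: by end_near. Qed.

(** * Weak convergence tested on spline steps *)

Section convergence.
Context d (T : measurableType d) (P : probability T R) (X : nat -> T -> R).
Context d' (T' : measurableType d') (Q : probability T' R) (Y : T' -> R).
Hypotheses (mX : forall n, measurable_fun setT (X n)) (mY : measurable_fun setT Y).
Hypothesis XY : forall a b, 1 <= b ->
  (fun n => \int[P]_(w in [set: T]) step (b * X n w - a)) @ \oo -->
    \int[Q]_(w in [set: T']) step (b * Y w - a).

Let mstep d0 (S : measurableType d0) (V : S -> R) a b : measurable_fun setT V ->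
  measurable_fun setT (fun w => step (b * V w - a)).
Proof.
move=> mV.
exact: (measurableT_comp (continuous_measurable_fun (@step_continuous a b)) mV).
Qed.

Let istep d0 (S : measurableType d0) (U : probability S R) (V : S -> R) a b :
  measurable_fun setT V -> U.-integrable setT (EFin \o (fun w => step (b * V w - a))).
Proof.
move=> mV; apply: (@integrable_bounded _ _ _ _ _ 1); first exact: mstep.
by move=> w; have [/andP[? ?] _ _] := step_bounds (b * V w - a); rewrite ger0_norm.
Qed.

Let windowsE b L x : window b L x = step (b * x - (- L%:R)) - step (b * x - L%:R).
Proof. by rewrite opprK. Qed.

Let iwindow d0 (S : measurableType d0) (U : probability S R) (V : S -> R) b L :
  measurable_fun setT V -> U.-integrable setT (EFin \o (fun w => window b L (V w))).
Proof.
by move=> mV; under eq_fun do rewrite windowsE; apply: integrableB_fin; exact: istep.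
Qed.

Let ispline d0 (S : measurableType d0) (U : probability S R) (V : S -> R) f b L :
  measurable_fun setT V -> U.-integrable setT (EFin \o (fun w => spline f b L (V w))).
Proof.
move=> mV; apply: integrable_sum_fin => i; apply: integrableZl_fin.
by apply: integrableB_fin; [exact: istep|under eq_fun do rewrite -addrA -opprD; exact: istep].
Qed.

Lemma window_cvg b L : 1 <= b ->
  (fun n => \int[P]_(w in [set: T]) window b L (X n w)) @ \oo -->
    \int[Q]_(w in [set: T']) window b L (Y w).
Proof.
move=> b1; under eq_Rintegral do rewrite windowsE.
rewrite RintegralB//; try exact: istep.
have -> : (fun n => \int[P]_(w in [set: T]) window b L (X n w)) =
  (fun n => \int[P]_(w in [set: T]) step (b * X n w - (- L%:R)) -
    \int[P]_(w in [set: T]) step (b * X n w - L%:R)).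
  apply/funext => n; under eq_Rintegral do rewrite windowsE.
  by rewrite RintegralB//; exact: istep.
by apply: cvgB; exact: XY.
Qed.

Let Espline d0 (S : measurableType d0) (U : probability S R) (V : S -> R) f b L :
  measurable_fun setT V -> \int[U]_(w in [set: S]) spline f b L (V w) =
  \sum_(i < L + L) f ((i%:R - L%:R) / b) *
    (\int[U]_(w in [set: S]) step (b * V w - (i%:R - L%:R)) -
     \int[U]_(w in [set: S]) step (b * V w - (i%:R - L%:R + 1))).
Proof.
move=> mV; rewrite Rintegral_sum_fin; last first.
  move=> i; apply: integrableZl_fin.
  by apply: integrableB_fin; [exact: istep|under eq_fun do rewrite -addrA -opprD; exact: istep].
apply: eq_bigr => i _; under eq_Rintegral do rewrite -[_ - _ - 1]addrA -opprD.
rewrite RintegralZl//; last by apply: integrableB_fin; exact: istep.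
by rewrite RintegralB//; exact: istep.
Qed.

Lemma spline_cvg f b L : 1 <= b ->
  (fun n => \int[P]_(w in [set: T]) spline f b L (X n w)) @ \oo -->
    \int[Q]_(w in [set: T']) spline f b L (Y w).
Proof.
move=> b1; rewrite Espline//.
under eq_fun do rewrite Espline//.
apply: cvg_sumR => i; apply: cvgM; first exact: cvg_cst.
by apply: cvgB; exact: XY.
Qed.

(** Tightness is proved for the limit law alone; convergence of the window integrals transfers it to
    [X n]. *)
Lemma tight e : 0 < e -> exists K : nat, forall b L, 0 <= b -> b * K%:R + 3 <= L%:R ->
  1 - e <= \int[Q]_(w in [set: T']) window b L (Y w).
Proof.
move=> e0.
(* [c n x] is 1 for |x| <= n and 0 for |x| >= n + 3. *)
pose c (n : nat) x : R := step (1 * (- `|x|) - (- (n%:R + 3))).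
have mc n : measurable_fun setT (fun w => c n (Y w)).
  by apply: mstep; apply: measurableT_comp => //; exact: measurableT_comp.
have c_cvg : (fun n => \int[Q]_(w in [set: T']) c n (Y w)) @ \oo --> \int[Q]_(w in [set: T']) (1 : R).
  apply: (@Rintegral_cvg_dominated _ _ _ _ _ _ (fun=> 1)) => //.
  - move=> w; apply: cvg_near_cst; near=> n.
    rewrite /c step_eq1// mul1r opprK addrA lerDr addrC subr_ge0.
    by near: n; exact: nbhs_infty_ger.
  - exact: integrable_cst_fin.
  - by move=> n w; rewrite /c; have [/andP[? ?] _ _] := step_bounds (1 * (- `|Y w|) - (- (n%:R + 3))); rewrite ger0_norm.
rewrite Rintegral_probability_cst in c_cvg.
move/cvgrPdist_le : c_cvg => /(_ _ e0)[n _ /(_ n (leqnn n))] /= cn.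
exists (n + 3)%N => b L b0 bL.
have h : 1 - e <= \int[Q]_(w in [set: T']) c n (Y w).
  by move: cn; rewrite ler_norml => /andP[_]; rewrite lerBlDr lerBlDl addrC.
apply: (le_trans h); apply: le_Rintegral => //.
- apply: (@integrable_bounded _ _ _ _ _ 1) => // w.
  by rewrite /c; have [/andP[? ?] _ _] := step_bounds (1 * (- `|Y w|) - (- (n%:R + 3))); rewrite ger0_norm.
- exact: iwindow.
- move=> w _; have [h1|h1] := leP `|Y w| (n%:R + 3).
    rewrite window_eq1//; last by apply: le_trans bL; rewrite lerD2r ler_wpM2l// natrD.
    by rewrite /c; have [/andP[]] := step_bounds (1 * (- `|Y w|) - (- (n%:R + 3))).
  rewrite /c step_eq0; first by have /andP[] := window_bounds b L (Y w).
  by rewrite mul1r opprK; lra.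
Unshelve. all: by end_near. Qed.

Theorem cvg_bounded_continuous f : continuous f -> (exists M, forall x, `|f x| <= M) ->
  (fun n => \int[P]_(w in [set: T]) f (X n w)) @ \oo --> \int[Q]_(w in [set: T']) f (Y w).
Proof.
move=> cf [M fM]; have M0 : 0 <= M := le_trans (normr_ge0 _) (fM 0).
have mf := continuous_measurable_fun cf.
have fX n : P.-integrable setT (EFin \o (fun w => f (X n w))).
  by apply: (@integrable_bounded _ _ _ _ _ M) => [|w]; [exact: measurableT_comp|exact: fM].
have fY : Q.-integrable setT (EFin \o (fun w => f (Y w))).
  by apply: (@integrable_bounded _ _ _ _ _ M) => [|w]; [exact: measurableT_comp|exact: fM].
apply/cvgrPdist_le => e e0.
(* The spline errors are at most M e1 + e1 for Q and 2 M e1 + e1 for P, and the spline integrals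
   differ by e1, so the total stays below (4 M + 4) e1. *)
pose e1 := e / (4 * M + 3 + 1).
have k0 : 0 < 4 * M + 3 + 1 by lra.
have e10 : 0 < e1 by rewrite divr_gt0.
have e1E : e1 * (4 * M + 3 + 1) = e by rewrite divfK// gt_eqF.
have [K HK] := tight e10.
have [n n0 Hn] := uniform_modulus (K%:R + 3) cf e10.
(* This makes L / b = K + 3, the range on which [n] controls the oscillation of f, and leaves room
   for the condition of [tight]. *)
pose b : R := n%:R; pose L := (n * (K + 3))%N.
have b1 : 1 <= b by rewrite ler1n.
have b0 : 0 < b by lra.
have bL : b * K%:R + 3 <= L%:R.
  by rewrite /L natrM natrD -/b mulrDr lerD2l ler_peMl.
have Lb : L%:R / b = K%:R + 3 by rewrite /L natrM -/b natrD mulrC mulKf// gt_eqF.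
have sd x : `|f x - spline f b L x| <= M * (1 - window b L x) + e1.
  by apply: spline_dist => // x' y; rewrite Lb; exact: Hn.
have dist d0 (S : measurableType d0) (U : probability S R) (V : S -> R) : measurable_fun setT V ->
    `|\int[U]_(w in [set: S]) f (V w) - \int[U]_(w in [set: S]) spline f b L (V w)| <=
    M * (1 - \int[U]_(w in [set: S]) window b L (V w)) + e1.
  move=> mV.
  have iV : U.-integrable setT (EFin \o (fun w => f (V w))).
    by apply: (@integrable_bounded _ _ _ _ _ M) => [|w]; [exact: measurableT_comp|exact: fM].
  have iS := ispline U f b L mV; have iW := iwindow U b L mV.
  have i1 := integrable_cst_fin U 1; have ie := integrable_cst_fin U e1.
  rewrite -RintegralB//.
  have -> : M * (1 - \int[U]_(w in [set: S]) window b L (V w)) + e1 =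
      \int[U]_(w in [set: S]) (M * (1 - window b L (V w)) + e1).
    have iB := integrableB_fin i1 iW.
    have iM := integrableZl_fin M iB.
    by rewrite (RintegralD measurableT iM ie) (RintegralZl _ measurableT iB) (RintegralB measurableT i1 iW) !Rintegral_probability_cst.
  apply: norm_Rintegral_le => [|w|]; last 2 first.
  - exact: sd.
  - by apply: integrableD_fin => //; apply: integrableZl_fin; exact: integrableB_fin.
  have /integrableP[/measurable_EFinP h _] := integrableB_fin iV iS; exact: h.
have wQ := HK b L (ltW b0) bL.
near=> m.
have D1 := dist _ _ P (X m) (mX m); have D2 := dist _ _ Q Y mY.
have D3 : `|\int[Q]_(w in [set: T']) window b L (Y w) - \int[P]_(w in [set: T]) window b L (X m w)| <= e1.
  by near: m; have /cvgrPdist_le := @window_cvg b L b1; exact.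
have D4 : `|\int[Q]_(w in [set: T']) spline f b L (Y w) - \int[P]_(w in [set: T]) spline f b L (X m w)| <= e1.
  by near: m; have /cvgrPdist_le := @spline_cvg f b L b1; exact.
move: D1 D2 D3 D4 wQ.
set fQ := \int[Q]_w f (Y w); set fP := \int[P]_w f (X m w).
set sQ := \int[Q]_w spline _ _ _ _; set sP := \int[P]_w spline _ _ _ _.
set wiQ := \int[Q]_w window _ _ _; set wiP := \int[P]_w window _ _ _.
move=> D1 D2 D3 D4 wQ.
have W1 : M * (1 - wiQ) <= M * e1 by rewrite ler_wpM2l//; lra.
have W2 : M * (1 - wiP) <= M * (2 * e1).
  by rewrite ler_wpM2l//; move: D3; rewrite ler_norml => /andP[? ?]; lra.
have Me : 0 <= M * e1 by rewrite mulr_ge0// ltW.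
rewrite -e1E; move: D1 D2 D4; rewrite !ler_norml => /andP[? ?] /andP[? ?] /andP[? ?].
by apply/andP; split; lra.
Unshelve. all: by end_near. Qed.

End convergence.

End portmanteau.

(** * The Poisson equation *)

Section poisson_equation.
Context {F : fieldType} {n : nat}.

(* If the only harmonic vectors of [Q] are the constants, then [1 - Q] has
   corank one, so its range is the hyperplane orthogonal to [p]. *)
Lemma poisson_solution (Q : 'M[F]_n) (p : 'rV[F]_n) (b : 'cV[F]_n) :
  (forall v : 'cV[F]_n, Q *m v = v -> forall i j, v i 0 = v j 0) ->
  p != 0 -> p *m Q = p -> p *m b = 0 ->
  exists g : 'cV[F]_n, g - Q *m g = b.
Proof.
move=> harm p0 pQ pb.
(* Transposed because [kermx] and matrix inclusion speak of row spaces. *)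
pose A := (1%:M - Q)^T.
have AT : A^T = 1%:M - Q by rewrite /A trmxK.
have rkA : (n <= (\rank A).+1)%N.
  have kA : (kermx A <= (const_mx 1 : 'rV[F]_n))%MS.
    apply/row_subP => i; set v := row i (kermx A).
    have vA : v *m A = 0 by rewrite /v -row_mul mulmx_ker row0.
    have hv : Q *m v^T = v^T.
      apply/eqP; rewrite eq_sym -subr_eq0 -{1}(mul1mx v^T) -mulmxBl -AT -trmx_mul vA trmx0//.
    have cv := harm _ hv.
    apply/sub_rVP; exists (v 0 i); apply/rowP => j.
    by have := cv j i; rewrite ![v^T _ _]mxE => ->; rewrite [RHS]mxE [X in _ * X]mxE mulr1.
  have := mxrankS kA; rewrite mxrank_ker => h.
  have h1 := rank_leq_row (const_mx 1%R : 'rV[F]_n).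
  by have := leq_trans h h1; rewrite leq_subLR addn1.
have Ap : A *m p^T = 0.
  by rewrite -[A]trmxK AT -trmx_mul mulmxBr mulmx1 pQ subrr trmx0.
have AK : (A <= kermx p^T)%MS by apply/sub_kermxP.
have rkK : \rank (kermx p^T) = n.-1.
  rewrite mxrank_ker mxrank_tr; have : \rank p = 1%N.
    by apply/eqP; rewrite eqn_leq rank_leq_row lt0n mxrank_eq0.
  by move=> ->; rewrite subn1.
have KA : (kermx p^T <= A)%MS.
  have := mxrank_leqif_sup AK => /leqifP; case: ifP => // _.
  rewrite rkK => h; have : (n <= n.-1)%N := leq_trans rkA h.
  case: n p p0 {pQ pb Ap AK rkK h harm b Q A AT rkA} => [p p0|m _ _]; last by rewrite /= ltnn.
  by move: p0; rewrite thinmx0 eqxx.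
have : (b^T <= kermx p^T)%MS.
  by apply/sub_kermxP; rewrite -trmx_mul pb trmx0.
move=> /submx_trans/(_ KA)/submxP[g gE]; exists g^T.
by rewrite -[b]trmxK gE trmx_mul AT mulmxBl mul1mx.
Qed.

End poisson_equation.

(** * Paths and hitting times *)

Section paths.
Context {R : realType} {k : state_space}.
Local Notation Om := (Omega R k).
Implicit Types (w : Om) (D : seq R) (r s t u c : R).

Lemma path_continuous w : continuous (pval w).
Proof. by case: (pvalP w). Qed.

Lemma path_eq0 w t : t <= 0 -> pval w t = pval w 0.
Proof. by case: (pvalP w) => _ + _; exact. Qed.

Lemma path_eqP w w' : (forall t, pval w t = pval w' t) -> w = w'.
Proof.
move: w w' => [w pw] [w' pw'] /= ww'.
have e : w = w' by apply/funext.
by move: pw pw'; rewrite e => pw pw'; congr Path; exact: Prop_irrelevance.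
Qed.

Lemma closed_mem_seq D : closed [set x | x \in D].
Proof.
elim: D => [|a D IH].
  by rewrite (_ : [set x | _] = set0); [exact: closed0|apply/seteqP; split].
rewrite (_ : [set x | _] = [set a] `|` [set x | x \in D]); last first.
  apply/seteqP; split => x /=; rewrite inE; first by case/orP => [/eqP|]; [left|right].
  by case=> [->|->]; rewrite ?eqxx ?orbT.
by apply: closedU => //; exact: closed_eq.
Qed.

Lemma closed_hit_set D r w : closed [set t | r <= t /\ pval w t \in D].
Proof.
rewrite (_ : [set t | _] = [set t | r <= t] `&` (pval w @^-1` [set x | x \in D])).
  apply: closedI; first exact: closed_ge.
  by apply: preimage_closed => [x _|]; [exact: path_continuous|exact: closed_mem_seq].
by apply/seteqP; split => t.
Qed.

(** The hitting set is closed, as the path is continuous and D is finite, so a finite infimum is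
    attained. *)
Lemma hit_attained D r w : let h := ereal_inf (EFin @` [set t | r <= t /\ pval w t \in D]) in
  (exists s, [/\ h = s%:E, r <= s, pval w s \in D &
      forall t, r <= t -> pval w t \in D -> s <= t]) \/
  (h = +oo%E /\ forall t, r <= t -> pval w t \notin D).
Proof.
set A := [set t | r <= t /\ pval w t \in D]; move=> h.
have lA : lbound A r by move=> t [].
have hA : has_lbound A by exists r.
have [A0|A0] := pselect (A !=set0).
  left; exists (inf A); have hE : h = (inf A)%:E by exact: ereal_inf_EFin.
  have : A (inf A).
    apply: (@closed_hit_set D r w) => B /nbhs_ballP[e /= e0 eB].
    have [t At te] := inf_adherent e0 (conj A0 hA).
    exists t; split => //; apply: eB; rewrite /ball /= distrC ger0_norm ?subr_ge0 ?ge_inf//.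
    by rewrite ltrBlDl.
  by move=> [rA DA]; split => // t rt Dt; exact: ge_inf.
right; have A00 : A = set0 by apply/eqP/negPn/negP => /set0P.
split; first by rewrite /h A00 image_set0 ereal_inf0.
by move=> t rt; apply/negP => Dt; apply: A0; exists t.
Qed.

Lemma first_hitP D w :
  (exists s, [/\ first_hit D w = s%:E, 0 <= s, pval w s \in D &
      forall t, 0 <= t -> pval w t \in D -> s <= t]) \/
  (first_hit D w = +oo%E /\ forall t, 0 <= t -> pval w t \notin D).
Proof. exact: hit_attained. Qed.

Lemma next_hitP D r w :
  (exists s, [/\ next_hit D r%:E w = s%:E, r <= s, pval w s \in D /\ pval w s != pval w r &
      forall t, r <= t -> pval w t \in D -> pval w t != pval w r -> s <= t]) \/
  (next_hit D r%:E w = +oo%E /\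
    forall t, r <= t -> pval w t \in D -> pval w t = pval w r).
Proof.
pose D' := [seq x <- D | x != pval w r].
have -> : next_hit D r%:E w = ereal_inf (EFin @` [set t | r <= t /\ pval w t \in D']).
  rewrite /next_hit; congr (ereal_inf (EFin @` _)); apply/seteqP; split => t /=.
    by move=> [+ [Dt wt]]; rewrite lee_fin mem_filter wt.
  by move=> [rt]; rewrite mem_filter lee_fin => /andP[wt Dt].
have [[s [hs rs Ds smin]]|[h0 hN]] := hit_attained D' r w.
  left; exists s; split => //.
    by move: Ds; rewrite mem_filter => /andP[].
  by move=> t rt Dt wt; apply: smin => //; rewrite mem_filter wt.
right; split => // t rt Dt; apply/eqP/negPn/negP => wt.
by have := hN _ rt; rewrite mem_filter wt Dt.
Qed.

Lemma next_hit_pinfty D w : next_hit D +oo%E w = +oo%E.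
Proof.
rewrite /next_hit (_ : [set t | _] = set0) ?image_set0 ?ereal_inf0//.
by apply/seteqP; split => t //= [].
Qed.

Lemma tau_aux_cases D n w :
  (exists2 r, 0 <= r & tau_aux D n w = r%:E /\ pval w r \in D) \/ tau_aux D n w = +oo%E.
Proof.
elim: n => [|n [[r r0 [rE rD]]|IH]] /=.
- by have [[s [hs s0 Ds _]]|[h0 _]] := first_hitP D w; [left; exists s|right].
- rewrite rE; have [[s [hs rs [Ds _] _]]|[h0 _]] := next_hitP D r w; last by right.
  by left; exists s => //; exact: le_trans rs.
- by right; rewrite IH next_hit_pinfty.
Qed.

Lemma tau_ge0 D n w : (0 <= tau D n w)%E.
Proof. by rewrite /tau; have [[r r0 [-> _]]|->] := tau_aux_cases D n.-1 w; rewrite ?lee_fin// leey. Qed.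

Lemma tau_finP D n w : (tau D n w < +oo)%E ->
  exists2 r, 0 <= r & tau D n w = r%:E /\ pval w r \in D.
Proof. by rewrite /tau; have [//|->] := tau_aux_cases D n.-1 w; rewrite ltxx. Qed.

Lemma first_hit_start D w : pval w 0 \in D -> first_hit D w = 0%E.
Proof.
move=> w0; have [[s [-> s0 _ /(_ 0 (lexx _) w0) s0']]|[_ /(_ 0 (lexx _))]] := first_hitP D w.
  by congr EFin; apply/eqP; rewrite eq_le s0' s0.
by rewrite w0.
Qed.

(** A criterion free of tau_1: two different points of D visited by time t. It reduces the stopping
    property to hits of fixed points, and it bounds tau_2 from above whenever two such visits are
    exhibited. *)
Lemma tau2_leP D w t : 0 <= t ->
  (tau D 2 w <= t%:E)%E <->
  exists s s', [/\ 0 <= s <= t, 0 <= s' <= t, pval w s \in D, pval w s' \in D &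
    pval w s != pval w s'].
Proof.
move=> t0; rewrite /tau /=; split.
  have [[r [-> r0 Dr _]]|[-> _]] := first_hitP D w; last by rewrite next_hit_pinfty.
  have [[s [-> rs [Ds ws] _]]|[-> _//]] := next_hitP D r w.
  rewrite lee_fin => st; exists r, s; split => //.
  - by rewrite r0 (le_trans rs).
  - by rewrite st (le_trans r0).
  - by rewrite eq_sym.
move=> [s [s' [/andP[s0 st] /andP[s0' st'] Ds Ds' ss']]].
have [[r [-> r0 Dr rmin]]|[_ /(_ _ s0)]] := first_hitP D w; last by rewrite Ds.
have [[q [-> rq [Dq wq] qmin]]|[_ H]] := next_hitP D r w; last first.
  by move: ss'; rewrite (H s (rmin s s0 Ds) Ds) (H s' (rmin s' s0' Ds') Ds') eqxx.
rewrite lee_fin; have [e|ne] := eqVneq (pval w s) (pval w r).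
  by apply: (le_trans (qmin s' _ _ _)); rewrite ?rmin// -e eq_sym.
by apply: (le_trans (qmin s _ _ _)); rewrite ?rmin.
Qed.

Lemma tau2_start_neq D w r : pval w 0 \in D -> tau D 2 w = r%:E -> pval w r != pval w 0.
Proof.
move=> w0; rewrite /tau /= first_hit_start//.
by have [[s [-> _ [_ ws] _]] [<-]//|[-> //]] := next_hitP D 0 w.
Qed.

Lemma path_shiftE r w u : 0 <= r -> 0 <= u -> pval (path_shift r w) u = pval w (r + u).
Proof. by move=> r0 u0; rewrite /path_shift /= !max_l. Qed.

Lemma path_shift0 w : path_shift 0 w = w.
Proof.
apply: path_eqP => t; rewrite /path_shift /= max_l// add0r.
by have [t0|t0] := leP 0 t => //; rewrite (path_eq0 w (ltW t0)).
Qed.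

Lemma path_shiftD r s w : 0 <= r -> 0 <= s ->
  path_shift (r + s) w = path_shift s (path_shift r w).
Proof.
move=> r0 s0; apply: path_eqP => t; rewrite /path_shift /=.
have m0 : 0 <= Num.max t 0 by rewrite le_max lexx orbT.
by rewrite (max_l (addr_ge0 r0 s0)) (max_l r0) (max_l s0) (max_l (addr_ge0 s0 m0)) addrA.
Qed.

Lemma next_hit_shift D r s w : 0 <= r -> 0 <= s ->
  next_hit D (r + s)%:E w = (r%:E + next_hit D s%:E (path_shift r w))%E.
Proof.
move=> r0 s0; have shE u : s <= u -> pval (path_shift r w) u = pval w (r + u).
  by move=> su; rewrite path_shiftE// (le_trans s0).
have [[q [qE sq [Dq wq] qmin]]|[qE H]] := next_hitP D s (path_shift r w);
have [[q' [qE' sq' [Dq' wq'] qmin']]|[qE' H']] := next_hitP D (r + s) w; rewrite qE qE' //.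
- rewrite -EFinD; congr EFin; apply/eqP; rewrite eq_le; apply/andP; split.
    apply: qmin'; first by rewrite lerD2l.
      by rewrite -shE.
    by move: wq; rewrite (shE q sq) (shE s (lexx s)).
  rewrite -lerBrDl; apply: qmin; first by rewrite lerBrDl.
    by rewrite shE ?lerBrDl// subrKC.
  by rewrite !shE ?lerBrDl// subrKC.
- by move: wq; rewrite !shE// H' ?eqxx// ?lerD2l// -shE.
- have sq2 : s <= q' - r by rewrite lerBrDl.
  have := H _ sq2; rewrite (shE _ sq2) (shE s (lexx s)) subrKC => /(_ Dq') e.
  by move: wq'; rewrite e eqxx.
Qed.

(** The path shifted by tau_2 starts in D, so its own tau_1 is 0; hence the numbering drops by
    one. *)
Lemma tau_shift D r w n : tau D 2 w = r%:E ->
  tau D n.+2 w = (r%:E + tau D n.+1 (path_shift r w))%E.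
Proof.
move=> rE; have [r' r0 [rE' Dr]] : exists2 r', 0 <= r' & tau D 2 w = r'%:E /\ pval w r' \in D.
  by apply: tau_finP; rewrite rE ltry.
have {}rE' : r' = r by move: rE'; rewrite rE => -[].
subst r'; have w0 : pval (path_shift r w) 0 \in D by rewrite path_shiftE// addr0.
elim: n => [|n IH]; first by rewrite rE /tau /= first_hit_start// adde0.
rewrite {1}/tau [tau_aux _ _ _]/= -[X in next_hit D X w]/(tau D n.+2 w) IH.
rewrite [in RHS]/tau [in RHS]/=.
rewrite -[X in next_hit D X (path_shift r w)]/(tau D n.+1 (path_shift r w)).
have := tau_ge0 D n.+1 (path_shift r w).
case: (tau D n.+1 _) => [s|//|//] s0; last by rewrite addey// !next_hit_pinfty addey.
by rewrite -next_hit_shift.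
Qed.

Lemma tau_pinfty D w n : tau D 2 w = +oo%E -> tau D n.+2 w = +oo%E.
Proof.
move=> E; elim: n => // n IH.
by rewrite /tau [tau_aux _ _ _]/= -[X in next_hit D X w]/(tau D n.+2 w) IH next_hit_pinfty.
Qed.

(** [fine] sends infinite times to 0 and the shift by 0 is the identity, so one formula covers the
    default case too. *)
Lemma shift_atE (s : Om -> \bar R) w u :
  pval (shift_at s w) u = pval w (Num.max (fine (s w)) 0 + Num.max u 0).
Proof.
rewrite /shift_at; case: (s w) => //=; rewrite max_l// add0r.
  by have [u0|u0] := leP 0 u => //; rewrite (path_eq0 w (ltW u0)).
by have [u0|u0] := leP 0 u => //; rewrite (path_eq0 w (ltW u0)).
Qed.

Lemma XatE (s : \bar R) w : Xat s w = pval w (fine s).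
Proof. by case: s. Qed.

Lemma shift_at_start (s : Om -> \bar R) w : pval (shift_at s w) 0 = Xat (s w) w.
Proof.
rewrite shift_atE XatE maxxx addr0.
by have [s0|s0] := leP 0 (fine (s w)) => //; rewrite (path_eq0 w (ltW s0)).
Qed.

End paths.

(** * Measurability on path space *)

Section path_measurability.
Context {R : realType} {k : state_space}.
Local Notation Om := (Omega R k).

Lemma coord_gen_measurable (T : \bar R) (u : R) (B : set R) : 0 <= u -> (u%:E <= T)%E ->
  measurable B -> <<s @coord_gen R k T >> (coord u @^-1` B).
Proof. by move=> u0 uT mB; apply: sub_sigma_algebra; exists u, B. Qed.

(* Approximating a hitting time of [d] by rational times. *)
Lemma hit_before_measurable (T : \bar R) (t d : R) : 0 <= t -> (t%:E <= T)%E ->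
  <<s @coord_gen R k T >> [set w : @path R k | exists s : R, 0 <= s <= t /\ pval w s = d].
Proof.
move=> t0 tT.
pose G := g_sigma_algebraType (@coord_gen R k T).
pose F (m : nat) (q : rat) : set G := [set w | (0 : R) <= ratr q <= t /\ `|pval w (ratr q) - d| < m.+1%:R^-1].
have mF m q : measurable (F m q).
  have [/andP[q0 qt]|qN] := boolP ((0 : R) <= ratr q <= t); last first.
    rewrite (_ : F m q = set0)//; apply/seteqP; split => // w [] /=.
    by rewrite (negbTE qN).
  rewrite (_ : F m q = coord (ratr q) @^-1` [set x | `|x - d| < m.+1%:R^-1]); last first.
    by apply/seteqP; split => w /=; [case|move=> h; rewrite /F /= q0 qt].
  apply: coord_gen_measurable => //; first by rewrite (le_trans _ tT)// lee_fin.
  rewrite (_ : [set x | _] = ball d m.+1%:R^-1); first exact: measurable_ball.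
  by apply/seteqP; split => x; rewrite /ball /= distrC.
rewrite (_ : [set w | _] = \bigcap_m \bigcup_q F m q); last first.
  apply/seteqP; split => w /=.
    move=> [s [/andP[s0 st] ws]] m _.
    (* For t = 0 there is no open interval of times to choose a rational from, but s = 0 is
       rational. *)
    have [t00|t00] := eqVneq t 0.
      exists 0 => //; rewrite /F /= raddf0 lexx t0; split => //.
      have -> : 0 = s by apply/eqP; rewrite eq_le s0 -{1}t00.
      by rewrite ws subrr normr0 invr_gt0 ltr0n.
    have tp : 0 < t by rewrite lt_neqAle eq_sym t00.
    have m0 : 0 < m.+1%:R^-1 :> R by rewrite invr_gt0 ltr0n.
    have /cvgrPdist_lt/(_ _ m0)/nbhs_ballP[e /= e0 eB] := @path_continuous R k w s.
    have lt : Num.max 0 (s - e) < Num.min t (s + e).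
      by rewrite gt_max !lt_min; apply/andP; split; apply/andP; split; lra.
    have [q] := rat_in_itvoo lt; rewrite in_itv /= gt_max lt_min => /andP[/andP[q0 q1] /andP[q2 q3]].
    exists q => //; rewrite /F /= (ltW q0) (ltW q2); split => //.
    rewrite distrC -ws; apply: eB.
    by rewrite /ball /= ltr_norml; apply/andP; split; lra.
  move=> H.
  (* Conversely, the distance to d attains its minimum on [0, t]; a positive minimum would exceed
     some 1/(m + 1). *)
  have cf : {within `[0, t], continuous (fun s => `|pval w s - d|)}.
    apply: continuous_subspaceT => x; apply: cvg_norm.
    by apply: cvgB; [exact: path_continuous|exact: cvg_cst].
  have [c cI cmin] := EVT_min t0 cf.
  exists c; split; first by move: cI; rewrite in_itv.
  apply/eqP; rewrite -subr_eq0 -normr_le0 leNgt; apply/negP => c0.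
  have [m mc] : exists m : nat, m.+1%:R^-1 < `|pval w c - d|.
    exists (Num.truncn (`|pval w c - d|^-1)).
    by rewrite invf_plt ?posrE ?ltr0n//; exact: truncnS_gt.
  have [q _ [qt wq]] := H m I.
  have := cmin (ratr q); rewrite in_itv /= qt => /(_ isT).
  by rewrite leNgt (lt_trans wq).
apply: (@bigcapT_measurable _ G) => m.
exact: bigcupT_measurable_rat.
Qed.

Lemma tau2_stopping (D : seq R) : stopping_time (tau D 2 : Om -> \bar R).
Proof.
split; first by move=> w; exact: tau_ge0.
move=> t t0; pose G := g_sigma_algebraType (@coord_gen R k t%:E).
pose H d : set G := [set w | exists s : R, 0 <= s <= t /\ pval w s = d].
rewrite /filtr (_ : [set w | _] = \big[setU/set0]_(z <- [seq (a, b) | a <- D, b <- D] | z.1 != z.2) (H z.1 `&` H z.2)).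
  apply: (@bigsetU_measurable _ G) => z _.
  by apply: (@measurableI _ G); apply: hit_before_measurable.
apply/seteqP; split => w /=.
  move=> /tau2_leP -/(_ t0)[s [s' [st st' Ds Ds' ss']]].
  rewrite -bigcup_seq_cond; exists (pval w s, pval w s') => /=.
    by apply/andP; split => //; apply/allpairsP; exists (pval w s, pval w s').
  by split; [exists s|exists s'].
rewrite -bigcup_seq_cond => -[[a b] /= /andP[/allpairsP[[a' b'] /= [aD bD [-> ->]]] ab]].
move=> [[s [st sa]] [s' [st' sb]]].
by apply/tau2_leP => //; exists s, s'; rewrite sa sb.
Qed.

Lemma coord_measurable (u : R) : measurable_fun setT (coord u : Om -> R).
Proof.
move=> _ B mB; rewrite setTI; have [u0|u0] := leP 0 u.
  by apply: coord_gen_measurable => //; exact: leey.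
rewrite (_ : coord u = coord 0); first by apply: coord_gen_measurable => //; exact: leey.
by apply/funext => w; exact: path_eq0 (ltW u0).
Qed.

(** By continuity the value is the limit of the values at the grid times floor((n + 1) r) / (n + 1),
    each of which has countably many outcomes. *)
Lemma path_at_measurable (r : Om -> R) : measurable_fun setT r -> (forall w, 0 <= r w) ->
  measurable_fun setT (fun w : Om => pval w (r w)).
Proof.
move=> mr r0.
pose j (n : nat) (w : Om) := Num.truncn (r w * n.+1%:R).
have j0 n w : 0 <= r w * n.+1%:R by rewrite mulr_ge0.
apply: (@measurable_fun_cvg _ Om R setT (fun n (w : Om) => pval w ((j n w)%:R / n.+1%:R)) (fun w : Om => pval w (r w))).
  move=> n _ B mB; rewrite setTI.
  rewrite (_ : _ @^-1` B = \bigcup_i ([set w | i%:R <= r w * n.+1%:R < i.+1%:R] `&` coord (i%:R / n.+1%:R) @^-1` B)).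
    apply: bigcupT_measurable => i; apply: measurableI.
      have mrn : measurable_fun setT (fun w => r w * n.+1%:R) by exact: measurable_funM.
      have := mrn measurableT _ (measurable_itv `[i%:R : R, i.+1%:R[); rewrite setTI.
      by congr measurable; apply/seteqP; split => w /=; rewrite in_itv.
    by rewrite -[X in measurable X]setTI; exact: coord_measurable.
  apply/seteqP; split => w /=.
    by move=> Bw; exists (j n w) => //; split => //=; exact: truncn_itv.
  by move=> [i _ [/= ri Bi]]; rewrite /j (truncn_def ri).
move=> w _.
have h : (fun n => (j n w)%:R / n.+1%:R) @ \oo --> r w.
  apply: (@cvg_dist_squeeze _ _ (fun=> r w) (fun n => n.+1%:R^-1)).
  - move=> n; have /andP[a b] := truncn_itv (j0 n w); rewrite -/(j n w) in a b.
    have n0 : 0 < n.+1%:R :> R by rewrite ltr0n.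
    have n1 : n.+1%:R != 0 :> R by rewrite gt_eqF.
    rewrite -[r w](mulfK n1) -mulrBl normrM (ger0_norm (x := n.+1%:R^-1)) ?invr_ge0//.
    rewrite ler_piMl ?invr_ge0// ler_norml; apply/andP; split; last by lra.
    by move: b; rewrite -natr1; lra.
  - exact: cvg_harmonic.
  - exact: cvg_cst.
exact: (cvg_comp _ _ h (@path_continuous R k w _)).
Qed.

Lemma shift_at_measurable (s : Om -> \bar R) : measurable_fun setT s ->
  measurable_fun setT (shift_at s : Om -> Om).
Proof.
move=> ms.
apply: (@measurability _ _ Om Om setT _ (@coord_gen R k +oo%E)) => // _ [_ [u [B [u0 _ mB ->]]] <-].
have mr : measurable_fun setT (fun w => Num.max (fine (s w)) 0 + u).
  by apply: measurable_funD => //; apply: measurable_maxr => //; exact: measurableT_comp.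
have := path_at_measurable mr; rewrite /= => /(_ _)/(_ measurableT B mB).
have r0 w : 0 <= Num.max (fine (s w)) 0 + u by rewrite addr_ge0// le_max lexx orbT.
move=> /(_ r0); congr measurable; congr (_ `&` _); apply/seteqP; split => w; rewrite /coord /= shift_atE (max_l u0)//.
Qed.

Lemma Xat_measurable (s : Om -> \bar R) : measurable_fun setT s ->
  measurable_fun setT (fun w : Om => Xat (s w) w).
Proof.
move=> ms; under eq_fun do rewrite -shift_at_start.
exact: (measurableT_comp (coord_measurable 0) (shift_at_measurable ms)).
Qed.

Lemma stopping_time_measurable (s : Om -> \bar R) : stopping_time s -> measurable_fun setT s.
Proof.
move=> [s0 sF]; apply: (measurability _ (ErealGenOInfty.measurableE R)).
move=> _ [_ [a ->]] <-; rewrite setTI preimage_itvoy.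
rewrite (_ : [set x | _] = ~` [set w | (s w <= a%:E)%E]); last first.
  by apply/seteqP; split => w /=; rewrite ltNge => /negP.
apply: measurableC; have [a0|a0] := leP 0 a; last first.
  rewrite (_ : [set w | _] = set0)//; apply/seteqP; split => // w /= sa.
  by have := le_trans (s0 w) sa; rewrite lee_fin leNgt a0.
have sub : <<s @coord_gen R k a%:E >> `<=` <<s @coord_gen R k +oo%E >>.
  by apply: sub_sigma_algebra2 => _ [u [B [u0 ua mB ->]]]; exists u, B; rewrite leey.
exact: sub (sF a a0).
Qed.

Lemma tau2_measurable (D : seq R) : measurable_fun setT (tau D 2 : Om -> \bar R).
Proof. exact: stopping_time_measurable (tau2_stopping D). Qed.

Lemma tau_add (D : seq R) n (w : Om) :
  tau D n.+2 w = (tau D 2 w + tau D n.+1 (shift_at (tau D 2) w))%E.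
Proof.
have := tau_ge0 D 2 w; rewrite /shift_at; case E : (tau D 2 w) => [r|//|//] _.
  exact: tau_shift.
by rewrite tau_pinfty// addye// gt_eqF// (lt_le_trans _ (tau_ge0 _ _ _))// ltNy0.
Qed.

Lemma tau_measurable (D : seq R) n : measurable_fun setT (tau D n.+2 : Om -> \bar R).
Proof.
elim: n => [|n IH]; first exact: tau2_measurable.
rewrite (_ : tau D n.+3 = fun w : Om => tau D 2 w + tau D n.+2 (shift_at (tau D 2) w))%E; last first.
  by apply/funext => w; exact: tau_add.
apply: emeasurable_funD; first exact: tau2_measurable.
exact: (measurableT_comp IH (shift_at_measurable (tau2_measurable D))).
Qed.

End path_measurability.

(** * The cycles of a recurrent diffusion *)

Section negligible.
Context d (T : measurableType d) (R : realType) (P : probability T R).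

Lemma negligible_setC (A : set T) : measurable A -> P A = 1%E -> P.-negligible (~` A).
Proof.
move=> mA PA; apply/negligibleP; first exact: measurableC.
by have := probability_setC P mA; rewrite PA subee.
Qed.

Lemma probability_negligibleC (A : set T) : measurable A -> P.-negligible (~` A) -> P A = 1%E.
Proof.
move=> mA /negligibleP H; have := probability_setC P mA.
rewrite H; last exact: measurableC.
have [r ->] : exists r, P A = r%:E by exists (fine (P A)); rewrite fineK// fin_num_measure.
by rewrite -EFinB => -[/eqP]; rewrite eq_sym subr_eq0 => /eqP <-.
Qed.

Lemma negligible_big (I : finType) (F : I -> set T) :
  (forall i, P.-negligible (F i)) -> P.-negligible (\bigcup_i F i).
Proof.
move=> NF; rewrite (_ : \bigcup_i F i = \big[setU/set0]_(i <- enum I) F i); last first.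
  rewrite -bigcup_seq; apply/seteqP; split => w [i _ Fi]; exists i => //=.
  by rewrite mem_enum.
elim/big_ind : _ => //; first exact: negligible_set0.
exact: negligibleU.
Qed.

Lemma probability1I (A B : set T) : measurable A -> measurable B ->
  P A = 1%E -> P B = 1%E -> P (A `&` B) = 1%E.
Proof.
move=> mA mB PA PB; apply: probability_negligibleC; first exact: measurableI.
by rewrite setCI; apply: negligibleU; exact: negligible_setC.
Qed.

Lemma probability1S (A B : set T) : measurable A -> measurable B -> A `<=` B ->
  P A = 1%E -> P B = 1%E.
Proof.
move=> mA mB AB PA; apply/eqP; rewrite eq_le probability_le1//= -PA.
by rewrite le_measure ?inE.
Qed.

Lemma probability1_setIr (A B : set T) : measurable A -> measurable B ->
  P B = 1%E -> P (A `&` B) = P A.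
Proof.
move=> mA mB PB; have mBc := measurableC mB.
have N0 : P (A `&` ~` B) = 0%E.
  apply: measure_negligible; first exact: measurableI.
  by apply: negligibleS (negligible_setC mB PB) => w [].
by rewrite -[in RHS](setIT A) -(setUv B) setIUr measureU0//; exact: measurableI.
Qed.

End negligible.

(** * Strong Markov property at the end of a cycle *)

Section diffusion.
Context {R : realType} {k : state_space}.
Local Notation Om := (Omega R k).
Variables (P : R -> probability Om R) (D : seq R).
Hypotheses (Pdiff : recurrent_diffusion P) (uD : uniq D) (sD : (2 <= size D)%N)
  (DS : forall d, d \in D -> Sset k d).

Local Notation I := 'I_(size D).

Definition site (i : I) : R := nth 0 D i.
Definition next_site (i : I) : set Om := [set w | Xat (tau D 2 w) w = site i].
Definition next_cycle : Om -> Om := shift_at (tau D 2).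

Lemma site_in i : site i \in D. Proof. exact: mem_nth. Qed.

Lemma siteP x : x \in D -> exists i, x = site i.
Proof.
move=> xD; have xs : (index x D < size D)%N by rewrite index_mem.
by exists (Ordinal xs); rewrite /site /= nth_index.
Qed.

Lemma site_inj : injective site.
Proof. by move=> i j /eqP; rewrite /site nth_uniq// => /eqP/val_inj. Qed.

Lemma next_site_measurable i : measurable (next_site i).
Proof.
have := Xat_measurable (tau2_measurable (k := k) D) measurableT (measurable_set1 (site i)).
by rewrite setTI.
Qed.

Lemma next_site_disj i j w : next_site i w -> next_site j w -> i = j.
Proof. by rewrite /next_site /= => -> /site_inj. Qed.

Lemma next_cycle_measurable : measurable_fun setT next_cycle.
Proof. exact: shift_at_measurable (tau2_measurable D). Qed.

Lemma next_cycle_start i w : next_site i w -> pval (next_cycle w) 0 = site i.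
Proof. by rewrite /next_cycle shift_at_start. Qed.

Lemma hit_measurable (y : R) : measurable [set w : Om | exists t : R, 0 <= t /\ pval w t = y].
Proof.
rewrite (_ : [set w | _] = \bigcup_n [set w : Om | exists s : R, 0 <= s <= n%:R /\ pval w s = y]).
  by apply: bigcupT_measurable => n; apply: hit_before_measurable; rewrite ?leey.
apply/seteqP; split => w /=.
  move=> [t [t0 wt]]; exists (Num.truncn t).+1 => //; exists t; split => //.
  by rewrite t0 ltW//; exact: truncnS_gt.
by move=> [n _ [t [/andP[t0 _] wt]]]; exists t.
Qed.

Lemma tau2_lt_measurable : measurable [set w : Om | (tau D 2 w < +oo)%E].
Proof.
have := emeasurable_fun_infty_o measurableT (tau2_measurable (k := k) D) +oo%E.
by rewrite setTI.
Qed.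

(** Recurrence makes the path visit two different points of D in finite time. *)
Lemma tau2_finite x : Sset k x -> P x [set w | (tau D 2 w < +oo)%E] = 1%E.
Proof.
move=> Sx; have [_ _ _ rec] := Pdiff.
pose d0 := nth 0 D 0; pose d1 := nth 0 D 1.
have D0 : d0 \in D by apply: mem_nth; exact: leq_trans sD.
have D1 : d1 \in D by exact: mem_nth.
have d01 : d0 != d1 by rewrite nth_uniq// (leq_trans _ sD).
apply: (probability1S _ _ _ (probability1I _ _ (rec x d0 Sx (DS D0)) (rec x d1 Sx (DS D1)))).
- by apply: measurableI; exact: hit_measurable.
- exact: tau2_lt_measurable.
- move=> w /= [[t [t0 wt]] [t' [t0' wt']]].
  have m0 : 0 <= Num.max t t' by rewrite le_max t0.
  apply: (@le_lt_trans _ _ (Num.max t t')%:E); last exact: ltry.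
  apply/tau2_leP => //; exists t, t'; rewrite wt wt'; split => //.
  + by rewrite t0 le_max lexx.
  + by rewrite t0' le_max lexx orbT.
- exact: hit_measurable.
- exact: hit_measurable.
Qed.

Lemma next_site_cover (w : Om) : (tau D 2 w < +oo)%E -> (\bigcup_i next_site i) w.
Proof.
move=> /tau_finP[r r0 [rE /siteP[i wi]]]; exists i => //.
by rewrite /next_site /= rE.
Qed.

Lemma start_measurable (y : R) : measurable [set w : Om | pval w 0 = y].
Proof. by have := @coord_measurable R k 0 measurableT _ (measurable_set1 y); rewrite setTI. Qed.

Lemma start_eq i j (C : set Om) : measurable C ->
  P (site i) (C `&` [set w : Om | pval w 0 = site j]) = ((i == j)%:R%:E * P (site j) C)%E.
Proof.
move=> mC; have [start _ _ _] := Pdiff.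
have [->|ij] := eqVneq i j; rewrite ?mul1e ?mul0e.
  apply: probability1_setIr => //; first exact: start_measurable.
  by apply: start; exact/DS/site_in.
apply: measure_negligible; first by apply: measurableI => //; exact: start_measurable.
apply: negligibleS (negligible_setC (start_measurable (site i)) (start _ (DS (site_in i)))) => w [_ /= ->].
by move=> /site_inj ji; move: ij; rewrite ji eqxx.
Qed.

(** When tau_2 is finite, [next_site i] says that the shifted path starts at [site i]. It can thus
    be moved into the future event, which spares proving that it belongs to the past of tau_2; under
    the law started from [site j] it then has probability 1 or 0. *)
Lemma strong_markov x i (A C : set Om) : Sset k x -> F_tau (tau D 2) A -> measurable C ->
  P x (next_site i `&` A `&` next_cycle @^-1` C) = (P x (next_site i `&` A) * P (site i) C)%E.
Proof.
move=> Sx FA mC; have [start _ SM _] := Pdiff.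
pose tf := [set w : Om | (tau D 2 w < +oo)%E].
have mtf : measurable tf := tau2_lt_measurable.
have mA : measurable A := FA.1.
have mE := next_site_measurable i.
have mt : measurable (next_cycle @^-1` C).
  by rewrite -[X in measurable X]setTI; exact: next_cycle_measurable.
have mCS : measurable (C `&` [set w : Om | pval w 0 = site i]).
  by apply: measurableI => //; exact: start_measurable.
have sm := SM x Sx _ (tau2_stopping D) A FA _ mCS.
transitivity (P x (A `&` tf `&` shift_at (tau D 2) @^-1` (C `&` [set w : Om | pval w 0 = site i]))).
  rewrite -(probability1_setIr _ mtf (tau2_finite Sx)); last first.
    by apply: measurableI => //; exact: measurableI.
  congr (P x _); apply/seteqP; split => w /=.
    move=> [[[Ei Aw] Cw] tw]; split => //; split => //.
    by rewrite -/(next_cycle w) (next_cycle_start Ei).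
  move=> [[Aw tw] [Cw]]; rewrite -/(next_cycle w) /next_cycle shift_at_start => Ei.
  by split => //; split.
rewrite sm; transitivity (\int[P x]_(w in A `&` tf) ((\1_(next_site i) w)%:E * P (site i) C))%E.
  apply: eq_integral => w; rewrite inE => -[_ tw].
  have [j _ Ej] := next_site_cover tw; rewrite [X in P X]Ej start_eq//; congr (_%:E * _)%E.
  rewrite indicE; have [ji|ji] := eqVneq j i; first by rewrite mem_set// -ji.
  rewrite memNset// => Ei; by move: ji; rewrite (next_site_disj Ej Ei) eqxx.
have mAt : measurable (A `&` tf) by exact: measurableI.
rewrite ge0_integralZr//; first last.
- by apply/measurable_EFinP/measurable_funTS; exact: measurable_indic.
rewrite integral_indic// setIA; congr (_ * _)%E.
by apply: probability1_setIr => //; [exact: (measurableI _ _ mE mA)|exact: tau2_finite].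
Qed.

Lemma F_tauT : F_tau (tau D 2) (setT : set Om).
Proof.
split; first exact: measurableT.
by move=> t t0; rewrite setTI; have [_] := tau2_stopping (k := k) D; exact.
Qed.

Lemma cover_measurable : measurable (\bigcup_i next_site i).
Proof.
by apply: fin_bigcup_measurable => // i _; exact: next_site_measurable.
Qed.

Lemma cover_prob1 x : Sset k x -> P x (\bigcup_i next_site i) = 1%E.
Proof.
move=> Sx; apply: (probability1S tau2_lt_measurable cover_measurable _ (tau2_finite Sx)).
by move=> w; exact: next_site_cover.
Qed.

Lemma negligible_next_cycle x (N : set Om) : Sset k x -> measurable N ->
  (forall j, P x (next_site j) = 0%E \/ P (site j) N = 0%E) ->
  (P x).-negligible (next_cycle @^-1` N).
Proof.
move=> Sx mN H.
have mt : measurable (next_cycle @^-1` N).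
  by rewrite -[X in measurable X]setTI; exact: next_cycle_measurable.
apply: (@negligibleS _ _ _ _ ((~` \bigcup_i next_site i) `|` \bigcup_i (next_site i `&` next_cycle @^-1` N))).
  move=> w Nw; have [[i _ Ei]|] := pselect ((\bigcup_i next_site i) w); last by left.
  by right; exists i.
apply: negligibleU; first by apply: negligible_setC (cover_prob1 Sx); exact: cover_measurable.
apply: negligible_big => i; apply/negligibleP.
  by apply: measurableI => //; exact: next_site_measurable.
have h := strong_markov i Sx F_tauT mN; rewrite !setIT in h; apply: (etrans h).
by case: (H i) => ->; rewrite ?mul0e ?mule0.
Qed.

Section cycles.
Variable Z : Om -> R.
Hypothesis ZF : forall B : set R, measurable B -> F_tau (tau D 2) (Z @^-1` B).

Lemma cycle_value_measurable : measurable_fun setT Z.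
Proof. by move=> _ B mB; rewrite setTI; exact: (ZF mB).1. Qed.

Theorem regenerative_diffusion x : Sset k x ->
  regenerative (fun i => P (site i)) next_site next_cycle Z (P x).
Proof.
move=> Sx; split; first exact: cover_prob1.
by move=> i A B mA mB; apply: strong_markov => //; exact: ZF.
Qed.

Lemma iter_next_cycle_measurable n : measurable_fun setT (iter n next_cycle).
Proof.
elim: n => [|n IH] /=; first exact: measurable_id.
exact: (measurableT_comp next_cycle_measurable IH).
Qed.

Lemma negligible_iter_infinite x n : Sset k x ->
  (P x).-negligible (iter n next_cycle @^-1` ~` [set w : Om | (tau D 2 w < +oo)%E]).
Proof.
have mN m : measurable (iter m next_cycle @^-1` ~` [set w : Om | (tau D 2 w < +oo)%E]).
  rewrite -[X in measurable X]setTI; apply: iter_next_cycle_measurable => //.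
  by apply: measurableC; exact: tau2_lt_measurable.
elim: n x => [|n IH] x Sx; first exact: negligible_setC tau2_lt_measurable (tau2_finite Sx).
rewrite (_ : _ @^-1` _ = next_cycle @^-1` (iter n next_cycle @^-1` ~` [set w : Om | (tau D 2 w < +oo)%E])); last first.
  by apply/seteqP; split => w /=; rewrite -iterS iterSr.
apply: negligible_next_cycle => // j; right.
by apply/negligibleP => //; apply: IH; exact/DS/site_in.
Qed.

Definition all_cycles_finite : set Om := [set w | forall n, (tau D 2 (iter n next_cycle w) < +oo)%E].

Lemma negligible_cycles x : Sset k x -> (P x).-negligible (~` all_cycles_finite).
Proof.
move=> Sx; apply: negligibleS (negligible_bigcup (fun n => negligible_iter_infinite n Sx)) => w /=.
by move=> /existsNP[n Hn]; exists n.
Qed.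

Lemma all_cycles_finite_next w : all_cycles_finite w -> all_cycles_finite (next_cycle w).
Proof. by move=> H n; rewrite -iterSr; exact: H. Qed.

Lemma tau_lt_pinfty w n : all_cycles_finite w -> (tau D n.+2 w < +oo)%E.
Proof.
elim: n w => [|n IH] w H; first exact: (H 0).
by rewrite tau_add lte_add_pinfty ?(H 0)// IH//; exact: all_cycles_finite_next.
Qed.

Lemma shift_at_tau w n : all_cycles_finite w -> shift_at (tau D n.+2) w = iter n.+1 next_cycle w.
Proof.
elim: n w => [//|n IH] w H; rewrite iterSr -IH; last exact: all_cycles_finite_next.
have [r r0 [rE _]] := tau_finP (H 0).
have [s s0 [sE _]] := tau_finP (tau_lt_pinfty n (all_cycles_finite_next H)).
have := tau_add D n.+1 w; rewrite -/(next_cycle w) sE /= rE => tE.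
rewrite {1}/shift_at tE -EFinD path_shiftD//.
rewrite [in RHS]/shift_at sE; congr path_shift.
by rewrite /next_cycle /shift_at rE.
Qed.

Lemma cycle_sumE n w : cycle_sum next_cycle Z n w = \sum_(0 <= j < n) Z (iter j next_cycle w).
Proof.
elim: n w => [|n IH] w; first by rewrite big_geq.
rewrite /= big_nat_recl// IH; congr (_ + _).
by apply: eq_big_nat => j _; rewrite -iterSr.
Qed.

(** Index shift: term j + 1 reads Z after j cycles, and the first term is Z on the unshifted path.
    Composing shifts requires finite cycles, hence the restriction on w. *)
Lemma sum_ZseqE n w : all_cycles_finite w ->
  \sum_(1 <= j < n.+1) Zseq D Z j w = cycle_sum next_cycle Z n w.
Proof.
move=> H; rewrite cycle_sumE big_add1; apply: eq_big_nat => -[|j] _ //.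
by rewrite /Zseq /= shift_at_tau.
Qed.

Lemma Zseq_measurable n : measurable_fun setT (Zseq D Z n).
Proof.
have mZ := cycle_value_measurable.
case: n => [|[|n]]; [exact: mZ|exact: mZ|].
by apply: (measurableT_comp mZ); apply: shift_at_measurable; exact: tau_measurable.
Qed.

End cycles.

(** * Closed classes and harmonic functions *)

Fixpoint cycle_time (n : nat) (w : Om) : R :=
  if n is m.+1 then cycle_time m w + fine (tau D 2 (iter m next_cycle w)) else 0.

Lemma cycle_time_ge0 n w : 0 <= cycle_time n w.
Proof.
by elim: n => //= n IH; rewrite addr_ge0// fine_ge0// tau_ge0.
Qed.

Lemma iter_next_cycleE n w : all_cycles_finite w ->
  iter n next_cycle w = path_shift (cycle_time n w) w.
Proof.
move=> H; elim: n => [|n IH]; first by rewrite path_shift0.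
have [r r0 [rE _]] := tau_finP (H n).
rewrite [LHS]/= /next_cycle /shift_at rE [cycle_time _ _]/= rE /= path_shiftD ?cycle_time_ge0//.
by rewrite -IH.
Qed.

Lemma iter_next_cycle_start n w : all_cycles_finite w ->
  pval (iter n next_cycle w) 0 = pval w (cycle_time n w).
Proof. by move=> H; rewrite iter_next_cycleE// path_shiftE ?cycle_time_ge0// addr0. Qed.

Lemma finite_gap (s : seq R) : exists2 e : R, 0 < e &
  forall x y, x \in s -> y \in s -> x != y -> e <= `|x - y|.
Proof.
have [e e0 He] : exists2 e : R, 0 < e &
    forall z, z \in [seq z.1 - z.2 | z <- [seq (a, b) | a <- s, b <- s]] -> z != 0 -> e <= `|z|.
  elim: [seq z.1 - z.2 | z <- _] => [|a l [e e0 He]]; first by exists 1.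
  have [a0|a0] := eqVneq a 0.
    exists e => // z; rewrite inE => /orP[/eqP ->|/He//]; by rewrite a0 eqxx.
  exists (Num.min e `|a|); first by rewrite lt_min e0 normr_gt0.
  move=> z; rewrite inE ge_min => /orP[/eqP -> _|/He H /H ->//].
  by rewrite lexx orbT.
exists e => // x y xs ys xy; apply: He; last by rewrite subr_eq0.
by apply/mapP; exists (x, y) => //; apply/allpairsP; exists (x, y).
Qed.

(* The cycle times would stay below [t], hence converge, yet consecutive values
   at these times are distinct points of [D], which contradicts continuity. *)
Lemma no_escape (A : set R) w t : A `<=` [set x | x \in D] ->
  all_cycles_finite w -> (forall n, A (pval (iter n next_cycle w) 0)) ->
  0 <= t -> pval w t \in D -> A (pval w t).
Proof.
move=> AD fin inA t0 bD; apply: contrapT => nAb.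
have inA' n : A (pval w (cycle_time n w)) by rewrite -iter_next_cycle_start.
(* At time t the path sits at a point of D outside A, different from the start of the current cycle,
   so this cycle has ended by t. *)
have Tt n : cycle_time n w <= t.
  elim: n => // n IH /=; have [r r0 [rE _]] := tau_finP (fin n).
  rewrite -lerBrDl -lee_fin fineK ?rE//; rewrite -rE.
  have d0 : 0 <= t - cycle_time n w by rewrite subr_ge0.
  apply/tau2_leP => //; exists 0, (t - cycle_time n w).
  rewrite iter_next_cycle_start// iter_next_cycleE// path_shiftE ?cycle_time_ge0//.
  rewrite addrCA subrr addr0 !lexx d0; split => //; first exact: (AD _ (inA' n)).
  by apply/eqP => e; apply: nAb; rewrite -e.
have T_nd : nondecreasing_seq (cycle_time ^~ w).
  by apply/nondecreasing_seqP => n /=; rewrite lerDl fine_ge0// tau_ge0.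
have /cvg_ex[l Tl] : cvgn (cycle_time ^~ w).
  by apply: nondecreasing_is_cvgn => //; exists t => _ [n _ <-].
have wl : pval w (cycle_time n w) @[n --> \oo] --> pval w l.
  by apply: continuous_cvg => //; exact: path_continuous.
have wl1 : pval w (cycle_time n.+1 w) @[n --> \oo] --> pval w l.
  by have := wl; rewrite -(cvg_shiftS (fun n => pval w (cycle_time n w))).
have [e e0 gap] := finite_gap D.
have : pval w (cycle_time n.+1 w) - pval w (cycle_time n w) @[n --> \oo] --> 0.
  by rewrite -(subrr (pval w l)); exact: cvgB.
move=> /cvgr0Pnorm_lt /(_ _ e0) [n _ /(_ n (leqnn n))]; apply/negP; rewrite -leNgt.
apply: gap; [exact: (AD _ (inA' _))|exact: (AD _ (inA' _))|].
have [r r0 [rE _]] := tau_finP (fin n).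
have := @tau2_start_neq _ _ D (iter n next_cycle w) r.
rewrite iter_next_cycle_start// iter_next_cycleE// path_shiftE ?cycle_time_ge0//.
rewrite -iter_next_cycleE// rE [cycle_time n.+1 w]/= rE; apply => //; exact: (AD _ (inA' n)).
Qed.

Lemma closed_class_full (A : pred I) (i0 : I) : A i0 ->
  (forall i j, A i -> ~~ A j -> P (site i) (next_site j) = 0%E) -> forall j, A j.
Proof.
move=> Ai0 Acl j; apply: contrapT => /negP nAj.
have [start _ _ rec] := Pdiff.
pose SA := [set x | exists2 i, A i & x = site i].
have SAD : SA `<=` [set x | x \in D] by move=> _ [i _ ->]; exact: site_in.
have mSA : measurable SA.
  rewrite (_ : SA = \bigcup_(i in [set i | A i]) [set site i]).
    by apply: fin_bigcup_measurable => // i _; exact: measurable_set1.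
  by apply/seteqP; split => x [i Ai xi]; exists i.
pose V : set Om := [set w | SA (pval w 0)].
have mV : measurable V.
  by have := @coord_measurable R k 0 measurableT _ mSA; rewrite setTI.
have mI n : measurable (iter n next_cycle @^-1` (~` V)).
  by rewrite -[X in measurable X]setTI; apply: iter_next_cycle_measurable => //; exact: measurableC.
have NV n i : A i -> (P (site i)).-negligible (iter n next_cycle @^-1` (~` V)).
  elim: n i => [|n IH] i Ai.
    apply: negligibleS (negligible_setC (start_measurable (site i)) (start _ (DS (site_in i)))).
    by move=> w /= nV wi; apply: nV; exists i.
  rewrite (_ : _ @^-1` _ = next_cycle @^-1` (iter n next_cycle @^-1` ~` V)); last first.
    by apply/seteqP; split => w; rewrite /preimage /= -iterS iterSr.
  apply: negligible_next_cycle => //; first exact/DS/site_in.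
  move=> l; have [Al|nAl] := boolP (A l); [right|left; exact: Acl].
  exact: measure_negligible (mI n) (IH _ Al).
pose i := i0; have Si : Sset k (site i) by exact/DS/site_in.
have Sj : Sset k (site j) by exact/DS/site_in.
(* Three null sets: some cycle is infinite, [site j] is never hit, some cycle starts outside A. By
   [no_escape] they cover the whole space, which has probability 1. *)
have := negligibleU (negligibleU (negligible_cycles Si) (negligible_setC (hit_measurable (site j)) (rec _ _ Si Sj)))
  (negligible_bigcup (fun n => NV n i Ai0)).
set N := (X in _.-negligible X) => HN.
have NT : N = setT.
  apply/seteqP; split => // w _; apply: contrapT => /not_orP[/not_orP[/contrapT w1 /contrapT[t [t0 wt]]] w2].
  have : SA (pval w t).
    apply: no_escape => //; last by rewrite wt; exact: site_in.
    by move=> n; apply: contrapT => nV; apply: w2; exists n.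
  by rewrite wt => -[l Al /site_inj jl]; move: nAj; rewrite jl Al.
have : P (site i) setT = 0%E by apply: measure_negligible => //; rewrite -NT.
by rewrite probability_setT => -[/eqP]; rewrite oner_eq0.
Qed.

Definition trans_matrix : 'M[R]_(size D) := \matrix_(i, j) trans_mx P D (site i) (site j).

Lemma trans_matrixE i j : P (site i) (next_site j) = (trans_matrix i j)%:E.
Proof. by rewrite mxE /trans_mx fineK// fin_num_measure//; exact: next_site_measurable. Qed.

Lemma trans_matrix_ge0 i j : 0 <= trans_matrix i j.
Proof. by rewrite -lee_fin -trans_matrixE. Qed.

Lemma trans_matrix_sum i : \sum_j trans_matrix i j = 1.
Proof.
apply: EFin_inj; rewrite -sumEFin -(cover_prob1 (DS (site_in i))).
rewrite (_ : \bigcup_j next_site j = \big[setU/set0]_(j < size D) next_site j); last first.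
  rewrite -bigcup_seq; apply/seteqP; split => w [j _ Ej]; exists j => //=.
  by rewrite mem_index_enum.
transitivity (\sum_(j < size D) P (site i) (next_site j))%E.
  by apply: eq_bigr => j _; rewrite trans_matrixE.
apply/esym/measure_bigsetU_ord.
- exact: next_site_measurable.
- by apply/trivIsetP => j l _ _ jl; apply/seteqP; split => // w [/next_site_disj H /H e]; move: jl; rewrite e eqxx.
Qed.

Lemma harmonic_constant (v : 'cV[R]_(size D)) : trans_matrix *m v = v ->
  forall i j, v i 0 = v j 0.
Proof.
move=> Qv; suff H i0 : forall j, v j 0 = v [arg max_(i > i0) v i 0]%O 0.
  by move=> i j; rewrite (H i i) (H i j).
case: arg_maxP => // m _ vm j.
apply/eqP/(@closed_class_full (fun j => v j 0 == v m 0) m) => // i l /eqP im nl.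
rewrite trans_matrixE; congr _%:E.
(* At a maximum, harmonicity is a vanishing sum of nonnegative terms, so every transition to a
   smaller value has probability 0. *)
have : \sum_j trans_matrix i j * (v m 0 - v j 0) = 0.
  under eq_bigr do rewrite mulrBr; rewrite sumrB -mulr_suml trans_matrix_sum mul1r.
  by have := congr1 (fun u : 'cV_ _ => u i 0) Qv; rewrite mxE im => ->; rewrite subrr.
move=> /psumr_eq0P H; have H' : trans_matrix i l * (v m 0 - v l 0) = 0.
  by apply: H => // h _; rewrite mulr_ge0 ?trans_matrix_ge0// subr_ge0; exact: vm.
move/eqP: H'; by rewrite mulf_eq0 subr_eq0 [v m 0 == _]eq_sym (negbTE nl) orbF => /eqP.
Qed.

End diffusion.

(** * Mixing over the initial law *)

Lemma Sset_measurable {R : realType} k : measurable (@Sset R k).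
Proof.
case: k => /=; first exact: measurableT.
- rewrite (_ : [set x | _] = `[0, +oo[%classic); first exact: measurable_itv.
  by apply/seteqP; split => x /=; rewrite in_itv/= andbT.
- rewrite (_ : [set x | _] = `]0, +oo[%classic); first exact: measurable_itv.
  by apply/seteqP; split => x /=; rewrite in_itv/= andbT.
Qed.

Section mixture.
Context d d' (X : measurableType d) (Y : measurableType d') (R : realType).
Variables (P : X -> probability Y R) (S : set X).
Hypotheses (mS : measurable S)
  (mP : forall B, measurable B -> measurable_fun S (fun x => P x B)).

(** Integration is measurable in the measure for nonnegative integrands, so h is raised by M and the
    constant is subtracted afterwards. *)
Lemma measurable_Rintegral_family (h : Y -> R) (M : R) : measurable_fun setT h ->
  (forall y, `|h y| <= M) -> measurable_fun S (fun x => \int[P x]_y (h y)%:E)%E.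
Proof.
move=> mh hM; pose Pg (x : X) : giry Y R := P x.
have mPg : measurable_fun S Pg by apply: measurable_giry_codensity.
have mhM : measurable_fun setT (fun y => (h y + M)%:E).
  by apply/measurable_EFinP; exact: measurable_funD.
have hM0 y : (0 <= (h y + M)%:E)%E.
  by rewrite lee_fin; have := hM y; rewrite ler_norml => /andP[]; lra.
have m1 : measurable_fun S (fun x => giry_int (Pg x) (fun y => (h y + M)%:E)).
  exact: (measurable_comp measurableT (@subsetT _ _) (measurable_giry_int mhM hM0) mPg).
apply: (eq_measurable_fun (fun x => giry_int (Pg x) (fun y => (h y + M)%:E) - M%:E)%E); last first.
  by apply: emeasurable_funB => //; exact: measurable_cst.
move=> x _; rewrite /giry_int /Pg.
have ih : (P x).-integrable setT (EFin \o h) by exact: integrable_bounded hM.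
rewrite (Rintegral_fin ih) (_ : (\int[P x]_y (h y + M)%:E = (\int[P x]_(y in setT) h y)%R%:E + M%:E)%E).
  by rewrite addeK.
under eq_integral do rewrite EFinD.
rewrite integralD//; last exact: integrable_cst_fin.
congr (_ + _)%E; first exact: (Rintegral_fin ih).
rewrite (@integral_cst _ _ _ (P x) setT measurableT M%:E).
rewrite -[RHS]mule1; congr (_ * _)%E; exact: probability_setT.
Qed.

Lemma cvg_integral_mixture (mu : probability X R) (h : nat -> Y -> R) (M l : R) :
  mu S = 1%E -> (forall n, measurable_fun setT (h n)) -> (forall n y, `|h n y| <= M) ->
  (forall x, S x -> (fun n => \int[P x]_(y in setT) h n y) @ \oo --> l) ->
  (fun n => \int[mu]_(x in S) \int[P x]_y (h n y)%:E)%E @ \oo --> l%:E.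
Proof.
move=> muS mh hM hl.
have ih n x : (P x).-integrable setT (EFin \o h n) by exact: integrable_bounded (hM n).
suff [_ _] : [/\ mu.-integrable S (fun=> l%:E),
    [sequence \int[mu]_(x in S) `|\int[P x]_y (h n y)%:E - l%:E|]_n @ \oo --> 0 &
    [sequence \int[mu]_(x in S) \int[P x]_y (h n y)%:E]_n @ \oo --> \int[mu]_(x in S) l%:E]%E.
  by rewrite integral_cst//= muS mule1.
apply: (@dominated_convergence _ X R mu S mS (fun n x => \int[P x]_y (h n y)%:E)%E (fun=> l%:E) (fun=> M%:E)).
- by move=> n; exact: measurable_Rintegral_family (mh n) (hM n).
- exact: measurable_cst.
- apply: aeW => x Sx; rewrite (_ : (fun n => _) = fun n => (\int[P x]_(y in setT) h n y)%:E).
    by apply: cvg_EFin; [exact: nearW|exact: hl].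
  by apply/funext => n; exact: Rintegral_fin.
- by apply: finite_measure_integrable_cst.
- apply: aeW => x n _; rewrite (Rintegral_fin (ih n x)) lee_fin.
  exact: norm_Rintegral_le_cst.
Qed.

End mixture.

Theorem theoremA2 (R : realType) (k : state_space)
    (P : R -> probability (Omega R k) R) (D : seq R)
    (Z : Omega R k -> R) (p : R -> R) :
  recurrent_diffusion P ->
  uniq D -> (2 <= size D)%N -> (forall d, d \in D -> Sset k d) ->
  (* Z is F_{tau_2}-measurable *)
  (forall B : set R, measurable B -> F_tau (tau D 2) (Z @^-1` B)) ->
  (* Z is bounded below *)
  (exists c : R, forall w, c <= Z w) ->
  (* Z in L^2(P_d) and E_d(Z) = 0 for all d in D *)
  (forall d, d \in D ->
     (P d).-integrable setT (fun w => (Z w ^+ 2)%:E)) ->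
  (forall d, d \in D -> (\int[P d]_w (Z w)%:E = 0)%E) ->
  (* p is the invariant probability vector of the chain (X_{tau_n}) *)
  invariant_prob P D p ->
  let sigma2 := \sum_(d <- D) p d * fine (\int[P d]_w (Z w ^+ 2)%:E) in
  (* for every initial law mu on S, the law of n^{-1/2} sum_{j=1}^n Z_j under
     P_mu converges weakly to N(0, sigma2), the law of sqrt(sigma2) * G,
     G standard normal *)
  forall mu : probability R R, mu (Sset k) = 1%E ->
  forall f : R -> R, continuous f -> (exists M : R, forall x, `|f x| <= M) ->
  (fun n : nat =>
     (\int[mu]_(x in Sset k)
        \int[P x]_w
          (f ((Num.sqrt n%:R)^-1 * \sum_(1 <= j < n.+1) Zseq D Z j w))%:E)%E)
    @ \oo --> (\int[normal_prob 0 1]_y (f (Num.sqrt sigma2 * y))%:E)%E.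
Proof.
move=> Pdiff uD sD DS ZF _ Z2 EZ [p0 psum pinv] sigma2 mu muS f cf [M fM].
pose Q := trans_matrix P D.
pose b (i : 'I_(size D)) : R := \int[P (site i)]_(w in setT) (Z w ^+ 2).
have mZ : measurable_fun setT Z := cycle_value_measurable ZF.
have sumD (F : R -> R) : \sum_(d <- D) F d = \sum_(i < size D) F (site i).
  by rewrite (big_nth 0) big_mkord.
have sigma2E : sigma2 = \sum_(i < size D) p (site i) * b i by rewrite /sigma2 sumD.
have b0 i : 0 <= b i by apply: fine_ge0; apply: integral_ge0 => w _; rewrite lee_fin sqr_ge0.
have sigma2_ge0 : 0 <= sigma2.
  by rewrite sigma2E sumr_ge0// => i _; rewrite mulr_ge0// p0// site_in.
have [g gE] : exists g : 'cV[R]_(size D), g - Q *m g = \col_i (b i - sigma2).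
  apply: (@poisson_solution _ _ Q (\row_i p (site i))).
  - exact: harmonic_constant.
  - apply/eqP => /rowP p00; have := psum; rewrite sumD big1 => [/eqP|i _]; first by rewrite eq_sym oner_eq0.
    by have := p00 i; rewrite !mxE.
  - apply/rowP => j; rewrite !mxE -[RHS]pinv ?site_in// sumD.
    by apply: eq_bigr => i _; rewrite !mxE.
  (* Solvability condition: p is orthogonal to b - sigma2 because sigma2 is the p-mean of b and p
     has total mass 1. *)
  - apply/matrixP => i j; rewrite !mxE; under eq_bigr do rewrite !mxE mulrBr.
    by rewrite sumrB -mulr_suml -sigma2E -sumD psum mul1r subrr.
have mE := @next_site_measurable R k D.
have transE i j : cycle_trans (fun i : 'I_(size D) => P (site i)) (@next_site R k D) i j = Q i j.
  rewrite /cycle_trans /cycle_law /Rintegral integral_indic//.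
  by rewrite /Q mxE; congr (fine (P _ _)); exact: setIT.
have clt (x : R) : Sset k x ->
  (fun n => \int[P x]_(w in setT) f ((Num.sqrt n%:R)^-1 * cycle_sum (next_cycle D) Z n w)) @ \oo
    --> \int[normal_prob 0 1]_(z in [set: R]) f (Num.sqrt sigma2 * z).
  move=> Sx.
  pose X n w := (Num.sqrt n%:R)^-1 * cycle_sum (@next_cycle R k D) Z n w.
  have mX n : measurable_fun setT (X n).
    apply: measurable_funM => //; apply: measurable_cycle_sum => //; exact: next_cycle_measurable.
  pose Y (z : R) := Num.sqrt sigma2 * z.
  have mY : measurable_fun setT Y by exact: measurable_funM.
  suff XY a c : 1 <= c -> (fun n => \int[P x]_(w in setT) step (c * X n w - a)) @ \oo -->
      \int[normal_prob 0 1]_(z in [set: R]) step (c * Y z - a).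
    exact: (cvg_bounded_continuous (P := P x) (Q := normal_prob 0 1) mX mY XY cf (ex_intro _ M fM)).
  move=> c1; apply: (@smooth_clt _ _ _ _ (fun i : 'I_(size D) => P (site i)) (@next_site R k D) (next_cycle D) Z mE _ mZ _ _ _ _ (fun i => g i 0) (Num.sqrt sigma2) _ _ (P x) _ _ _ _ _ (step_scaled_smooth a c1)).
  - exact: next_cycle_measurable.
  - by move=> i j w; exact: next_site_disj.
  - by move=> i; apply: regenerative_diffusion => //; exact/DS/site_in.
  - by move=> i; exact/Z2/site_in.
  - by move=> i; rewrite /Rintegral EZ// site_in.
  - exact: sqrtr_ge0.
  - move=> i; rewrite sqr_sqrtr// -/(b i).
      have := congr1 (fun v : 'cV_ _ => v i 0) gE; rewrite !mxE => <-; congr (_ - _).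
      by apply: eq_bigr => j _; rewrite transE.
  - exact: regenerative_diffusion.
  - move=> y; have [/andP[-> h] _ _] := step_bounds (c * y - a).
      by rewrite (le_trans h)//; have := exprn_ege1 3 c1; lra.
rewrite (@Rintegral_fin _ _ _ (normal_prob 0 1)); last first.
  apply: integrable_bounded (fun z => fM _).
  by apply: measurableT_comp; [exact: continuous_measurable_fun|exact: measurable_funM].
have mh n : measurable_fun setT (fun w => f ((Num.sqrt n%:R)^-1 * \sum_(1 <= j < n.+1) Zseq D Z j w)).
  apply: measurableT_comp; first exact: continuous_measurable_fun.
  by apply: measurable_funM => //; apply: measurable_sum => j; exact: Zseq_measurable.
apply: (cvg_integral_mixture (Sset_measurable k) _ muS mh (fun n w => fM _)).
  by have [_ ? _ _] := Pdiff.
move=> x Sx; have := clt x Sx; rewrite (_ : (fun n => _) = (fun n => \int[P x]_(w in setT) f ((Num.sqrt n%:R)^-1 * \sum_(1 <= j < n.+1) Zseq D Z j w)))//.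
apply/funext => n; congr fine; apply: ae_eq_integral => //.
- apply/measurable_EFinP; apply: measurableT_comp; first exact: continuous_measurable_fun.
  by apply: measurable_funM => //; apply: measurable_cycle_sum => //; exact: next_cycle_measurable.
- exact/measurable_EFinP.
(* The sum of the [Zseq] terms and [cycle_sum] agree only where all cycles are finite, which holds
   almost surely. *)
- apply: negligibleS (negligible_cycles Pdiff uD sD DS Sx) => w /= H fin; apply: H => _.
  by rewrite sum_ZseqE.
Qed.
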